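(* The category $\mathsf{Fre}$ of Fréchet spaces (with continuous linear maps as morphisms) as well as its dual category $\mathsf{Bra}$ of Brauner spaces (with continuous linear maps as morphisms) embed as full subcategories into the category $\mathsf{L}$ of paired linear $hk$-spaces, via $V\mapsto (V, V^*=V^\wedge)$, and the self-duality $(-)^*$ of $\mathsf{L}$ restricts to the duality $V\mapsto V^\wedge$ between Fréchet spaces and Brauner spaces (an equivalence $\mathsf{Fre}^{\mathrm{op}}\simeq\mathsf{Bra}$). Moreover, the tensor product of Fréchet spaces as taken in $\mathsf{L}$ coincides with the completed projective tensor product of Fréchet spaces: for Fréchet spaces $V,W$ there is a canonical isomorphism $$\iota(V\,\widehat{\otimes}_\pi W)\cong\iota(V)\,\widehat{\otimes}\,\iota(W),$$ where $\iota:\mathsf{Fre}\to\mathsf{L}$ is the embedding and $\widehat{\otimes}_\pi$ is the completed projective tensor product.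
   Context: $\mathbb{K}$ denotes $\mathbb{R}$ or $\mathbb{C}$. A topological space $X$ is a $k$-space if every map $f:X\to Y$ to a topological space $Y$, such that $f\circ p$ is continuous for every continuous $p:K\to X$ with $K$ compact Hausdorff, is continuous. The $k$-ification $kX$ of a topological space $X$ is the set $X$ with the topology whose open sets are those $U$ for which $p^{-1}(U)$ is open for every continuous $p:K\to X$ from a compact Hausdorff space $K$. The product $X\times Y$ of $k$-spaces always means $k(X\times_{\mathsf{Top}}Y)$. An $hk$-space is a $k$-space $X$ whose diagonal is closed in $X\times X$. For $hk$-spaces $X,Y$, $C(X,Y)$ is the $k$-ification of the set of continuous maps $X\to Y$ with the compact-open topology. A linear $hk$-space is an $hk$-space $V$ with a $\mathbb{K}$-vector space structure such that addition $V\times V\to V$ and scalar multiplication $\mathbb{K}\times V\to V$ are continuous (for the products just described). Its natural dual $V^\wedge$ is the closed subspace of $C(V,\mathbb{K})$ consisting of the continuous linear functionals. Every Fréchet space is a linear $hk$-space. A Brauner space is a linear $hk$-space which is hemicompact (i.e. the colimit of a sequence of compact spaces with injective transition maps) and which is also a complete locally convex topological vector space with respect to the same topology. A paired linear $hk$-space is a linear $hk$-space $V$ together with a closed linear subspace $V^*\subseteq V^\wedge$ such that $V\to (V^* )^\wedge$, $x\mapsto(\phi\mapsto\phi(x))$, is a closed embedding. A morphism $V\to W$ is a continuous linear map $f$ with $\phi\circ f\in V^*$ for all $\phi\in W^*$. This defines the category $\mathsf{L}$. For $V,W\in\mathsf{L}$, $[V,W]$ is the set of morphisms $V\to W$, topologised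 as a (closed) subspace of $C(V,W)$, with $[V,W]^*$ the closed linear span in $[V,W]^\wedge$ of the functionals $f\mapsto\phi(f(x))$ ($x\in V$, $\phi\in W^*$). The self-duality of $\mathsf{L}$ is $V\mapsto V^*:=[V,\mathbb{K}]$, $f\mapsto(\phi\mapsto\phi\circ f)$ (where $\mathbb{K}^*=\mathbb{K}^\wedge$), and the tensor product of $\mathsf{L}$ is $V\,\widehat{\otimes}\,W=[V,W^*]^*$, which is left adjoint to the internal hom: $[V\,\widehat{\otimes}\,W,Z]\cong[V,[W,Z]]$. *)

(* Defs.v *)
From HB Require Import structures.
From mathcomp Require Import all_boot all_order all_algebra.
From mathcomp Require Import all_classical reals topology normedtype convex.
From mathcomp Require Import complex.

Set Implicit Arguments.
Unset Strict Implicit.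
Unset Printing Implicit Defensive.
Import Order.TTheory GRing.Theory Num.Theory.
Import numFieldNormedType.Exports.
Local Open Scope quotient_scope.
Local Open Scope classical_set_scope.
Local Open Scope ring_scope.

Definition kspace (X : topologicalType) : Prop :=
  forall (Y : topologicalType) (f : X -> Y),
    (forall (C : topologicalType) (p : C -> X),
       compact [set: C] -> hausdorff_space C -> continuous p ->
       continuous (f \o p)) ->
    continuous f.

Definition kopen (X : topologicalType) (U : set X) : Prop :=
  forall (C : topologicalType) (p : C -> X),
    compact [set: C] -> hausdorff_space C -> continuous p -> open (p @^-1` U).

(* The k-ification of X, on the same underlying type: its open sets are the
   kopen sets of X. *)
Definition kify (X : topologicalType) : Type := X.

Section kification.
Variable X : topologicalType.

Let kopenT : @kopen X setT.
Proof. by move=> C p _ _ _; rewrite preimage_setT; exact: openT. Qed.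

Let kopenI : setI_closed (@kopen X).
Proof.
move=> A B kA kB C p cC hC cp.
by rewrite preimage_setI; apply: openI; [exact: kA|exact: kB].
Qed.

Let kopen_bigU (I : Type) (f : I -> set X) :
  (forall i, kopen (f i)) -> kopen (\bigcup_i f i).
Proof.
move=> kf C p cC hC cp; rewrite preimage_bigcup.
by apply: bigcup_open => i _; exact: kf.
Qed.

HB.instance Definition _ := Choice.on (kify X).
HB.instance Definition _ :=
  isOpenTopological.Build (kify X) kopenT kopenI kopen_bigU.

Lemma kopenE (U : set (kify X)) : open U = @kopen X U.
Proof. by []. Qed.

End kification.

Definition kprod (X Y : topologicalType) : topologicalType :=
  kify (X * Y)%type.

Definition hkspace (X : topologicalType) : Prop :=
  kspace X /\ closed ([set xy | xy.1 = xy.2] : set (kprod X X)).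

Section kspace_theory.

Lemma kify_cont_id (X : topologicalType) : continuous (id : kify X -> X).
Proof.
apply/continuousP => U oU; rewrite kopenE => C p _ _ cp; rewrite preimage_id.
by move/continuousP : cp; apply.
Qed.

Lemma compact_kspace (X : topologicalType) :
  compact [set: X] -> hausdorff_space X -> kspace X.
Proof. by move=> cX hX Y f /(_ X id cX hX); apply=> x. Qed.

Lemma test_kify (X C : topologicalType) (p : C -> X) :
  compact [set: C] -> hausdorff_space C -> continuous p ->
  continuous (p : C -> kify X).
Proof. by move=> cC hC cp; apply/continuousP => U oU; exact: oU. Qed.

Lemma kify_kspace (X : topologicalType) : kspace (kify X).
Proof.
move=> Y f h; apply/continuousP => U oU; rewrite kopenE => C p cC hC cp.
have := h C p cC hC (test_kify cC hC cp).
by move=> /continuousP/(_ _ oU).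
Qed.

Lemma kspace_to_kify (Z X : topologicalType) (f : Z -> X) :
  kspace Z -> continuous f -> continuous (f : Z -> kify X).
Proof.
move=> kZ cf; apply: kZ => C p cC hC cp.
apply: test_kify => //; move=> x; apply: continuous_comp; [exact: cp|exact: cf].
Qed.

Lemma kspace_open (X : topologicalType) (U : set X) :
  kspace X -> kopen U -> open U.
Proof.
move=> kX kU.
have : continuous (id : X -> kify X) by apply: kspace_to_kify => // x.
by move=> /continuousP/(_ U); apply.
Qed.

Lemma cont_comp (X Y Z : topologicalType) (f : X -> Y) (g : Y -> Z) :
  continuous f -> continuous g -> continuous (g \o f).
Proof. by move=> cf cg x; apply: continuous_comp; [exact: cf|exact: cg]. Qed.

Lemma kprod_pair (Z X Y : topologicalType) (f : Z -> X) (g : Z -> Y) :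
  kspace Z -> continuous f -> continuous g ->
  continuous ((fun z => (f z, g z)) : Z -> kprod X Y).
Proof.
move=> kZ cf cg; apply: kspace_to_kify => // z.
by apply: cvg_pair; [exact: cf|exact: cg].
Qed.

Lemma kprod_fst (X Y : topologicalType) : continuous (fst : kprod X Y -> X).
Proof.
apply: (@cont_comp _ (X * Y)%type _ (id : kprod X Y -> _) fst).
  exact: kify_cont_id.
by move=> x; exact: cvg_fst.
Qed.

Lemma kprod_snd (X Y : topologicalType) : continuous (snd : kprod X Y -> Y).
Proof.
apply: (@cont_comp _ (X * Y)%type _ (id : kprod X Y -> _) snd).
  exact: kify_cont_id.
by move=> x; exact: cvg_snd.
Qed.

Lemma hausdorff_hk (X : topologicalType) :
  kspace X -> hausdorff_space X -> hkspace X.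
Proof.
move=> kX hX; split=> //.
have cl : closed [set xy : X * X | xy.1 = xy.2].
  move=> [x y] xy; apply: hX => A B Ax By.
  have [] := xy (A `*` B); first by exists (A, B).
  by move=> [a b] /= [-> [Ab Bb]]; exists b.
by have /continuous_closedP/(_ _ cl) := @kify_cont_id (X * X)%type.
Qed.

Lemma set_type_cont (X : topologicalType) (A : set X) :
  continuous (@set_val X A).
Proof. exact: initial_continuous. Qed.

Lemma cont_to_set (Z X : topologicalType) (A : set X) (f : Z -> A) :
  continuous (fun z => set_val (f z)) -> continuous f.
Proof.
move=> cf; apply/continuousP => _ [O oO <-].
by move/continuousP : cf => /(_ _ oO).
Qed.

Lemma set_type_closed (X : topologicalType) (A : set X) (B : set A) :
  closed A -> closed B -> closed (set_val @` B).
Proof.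
move=> cA /closed_openC [O oO OB].
suff -> : set_val @` B = A `&` ~` O.
  by apply: closedI => //; exact: open_closedC.
rewrite -[B]setCK -OB; apply/seteqP; split=> [_ [a /= nO <-]|x [Ax nO]].
  by split=> //; exact: set_valP.
by exists (exist _ x (mem_set Ax)).
Qed.

Lemma set_type_hausdorff (X : topologicalType) (A : set X) :
  hausdorff_space X -> hausdorff_space A.
Proof.
move=> hX x y xy; apply: val_inj; apply: hX => P Q Px Qy.
have [] := xy (set_val @^-1` P) (set_val @^-1` Q).
- exact: set_type_cont.
- exact: set_type_cont.
by move=> z [? ?]; exists (set_val z).
Qed.

Lemma set_type_compact (X : topologicalType) (A : set X) :
  compact A -> compact [set: A].
Proof.
move=> cA F FF _.
have FF' : ProperFilter (fmap (@set_val X A) F) by exact: fmap_proper_filter.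
have : fmap (@set_val X A) F A.
  by apply: (@filterS _ F _ setT) => [a _|]; [exact: set_valP|exact: filterT].
move=> /(cA _ FF')[x [Ax clx]].
exists (exist _ x (mem_set Ax)); split=> // P Q FP.
case=> _ [[O oO <-] Ox OQ].
have [] := clx (set_val @` P) O.
- by rewrite /fmap /=; apply: (@filterS _ F _ P) => // p Pp; exists p.
- exact: open_nbhs_nbhs.
by move=> _ [[p Pp <-] Op]; exists p; split=> //; exact: OQ.
Qed.

Lemma closed_kspace (X : topologicalType) (A : set X) :
  kspace X -> closed A -> kspace A.
Proof.
move=> kX cA Y f tf; apply/continuous_closedP => D cD.
pose E := set_val @` (f @^-1` D).
have cE : closed E.
  rewrite -[E]setCK; apply: open_closedC; apply: kspace_open => // C p cC hC cp.
  rewrite -closedC -preimage_setC setCK.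
  pose C' := p @^-1` A.
  have cC' : closed C' by move/continuous_closedP : cp; apply.
  pose q (c : C') : A := exist _ (p (set_val c)) (mem_set (set_valP c)).
  have cq : continuous q.
    by apply: cont_to_set; apply: cont_comp cp; exact: set_type_cont.
  have := tf C' q; have hC' : hausdorff_space C' by exact: set_type_hausdorff.
  have kC' : compact [set: C'].
    by apply: set_type_compact; exact: subclosed_compact cC' cC _.
  move=> /(_ kC' hC' cq)/continuous_closedP/(_ _ cD)/(set_type_closed cC').
  congr closed; apply/seteqP; split=> [_ [c /= Dc <-]|c [a /= Da ac]].
    by exists (q c).
  have C'c : C' c by rewrite /C' /= -ac; exact: set_valP.
  exists (exist _ c (mem_set C'c)) => //=.
  by congr (D (f _)) : Da; apply: val_inj; rewrite /= -ac.
have -> : f @^-1` D = set_val @^-1` E.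
  apply/seteqP; split=> [a Da|a [b Db /val_inj <-//]]; first by exists a.
by move/continuous_closedP : (@set_type_cont X A); apply.
Qed.

End kspace_theory.

(* C(X, Y): the continuous maps with the compact-open topology, k-ified. *)
Definition cmap (X Y : topologicalType) : Type :=
  kify (set_type [set f : {compact-open, X -> Y} | continuous f]).

HB.instance Definition _ (X Y : topologicalType) :=
  Topological.copy (cmap X Y)
    (kify (set_type [set f : {compact-open, X -> Y} | continuous f])).

Definition cmap_fun (X Y : topologicalType) (f : cmap X Y) : X -> Y :=
  @set_val {compact-open, X -> Y} _ f.
Coercion cmap_fun : cmap >-> Funclass.

Section cmap_theory.
Variables X Y : topologicalType.

Definition mkcmap (f : X -> Y) (cf : continuous f) : cmap X Y :=
  exist _ (f : {compact-open, X -> Y}) (mem_set cf).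

Lemma cmap_cont (f : cmap X Y) : continuous f.
Proof. exact: (set_valP f). Qed.

Lemma cmap_inj (f g : cmap X Y) : (forall x, f x = g x) -> f = g.
Proof. by move=> fg; apply: val_inj; apply/funext. Qed.

Lemma cmap_kspace : kspace (cmap X Y).
Proof. exact: kify_kspace. Qed.

Lemma cmap_val_cont :
  continuous (@cmap_fun X Y : cmap X Y -> {compact-open, X -> Y}).
Proof.
apply: (@cont_comp _ _ _ (id : cmap X Y -> set_type _) set_val).
  exact: kify_cont_id.
exact: set_type_cont.
Qed.

Lemma test_eval (C : topologicalType) (p : C -> cmap X Y) (q : C -> X) :
  compact [set: C] -> hausdorff_space C -> continuous p -> continuous q ->
  continuous (fun c => p c (q c)).
Proof.
move=> cC hC cp cq c U /=; rewrite nbhsE => -[O [oO Oc] OU].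
have : nbhs c (fun d => O (p c (q d))).
  apply: (@cont_comp _ _ _ q (p c)) => //; first exact: cmap_cont.
  exact: open_nbhs_nbhs.
have cCn : compact [set: C] := cC.
have := @compact_regular C c [set: C] hC cC (filterT).
move=> /[apply] -[N Nc NO].
have cN : compact (q @` closure N).
  apply: continuous_compact; first exact: continuous_subspaceT.
  by apply: (subclosed_compact _ cC) => //; exact: closed_closure.
have oW := compact_open_open cN oO.
have : nbhs c [set d | [set g : {compact-open, X -> Y} |
     g @` (q @` closure N) `<=` O] (cmap_fun (p d))].
  apply: (@cont_comp _ _ _ p
    (@cmap_fun X Y : cmap X Y -> {compact-open, X -> Y})) => //.
    exact: cmap_val_cont.
  apply: open_nbhs_nbhs; split=> //.
  by move=> _ [_ [d Nd <-] <-]; exact: NO.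
apply: filterS2 Nc => d Nd Hd; apply: OU; apply: Hd.
by exists (q d) => //; exists d => //; exact: subset_closure.
Qed.

Lemma cmap_eval (Z : topologicalType) (f : Z -> cmap X Y) (g : Z -> X) :
  kspace Z -> continuous f -> continuous g -> continuous (fun z => f z (g z)).
Proof.
move=> kZ cf cg; apply: kZ => C p cC hC cp.
by apply: (@test_eval _ (f \o p) (g \o p)) => //; exact: cont_comp.
Qed.

Lemma cmap_curry (Z : topologicalType) (f : Z -> cmap X Y) :
  kspace Z -> hausdorff_space X ->
  (forall (C : topologicalType) (p : C -> Z) (q : C -> X),
     compact [set: C] -> hausdorff_space C -> continuous p -> continuous q ->
     continuous (fun c => f (p c) (q c))) ->
  continuous f.
Proof.
move=> kZ hX H; apply: kZ => C p cC hC cp.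
apply: (@test_kify (set_type _)) => //.
apply: cont_to_set.
move=> c; apply/compact_open_cvgP => A O cA oO fAO.
have hA : hausdorff_space A by exact: set_type_hausdorff.
have cA' : compact [set: A] by exact: set_type_compact.
have cCA : compact [set: C * A] by rewrite -setXTT; exact: compact_setX.
have hCA : hausdorff_space (C * A)%type.
  move=> [c1 a1] [c2 a2] cl; congr pair.
    apply: hC => P Q Pc Qc.
    have [] := cl (P `*` setT) (Q `*` setT).
    - by exists (P, setT) => //; split=> //; exact: filterT.
    - by exists (Q, setT) => //; split=> //; exact: filterT.
    by move=> [x1 x2] [[? _] [? _]]; exists x1.
  apply: hA => P Q Pc Qc.
  have [] := cl (setT `*` P) (setT `*` Q).
  - by exists (setT, P) => //; split=> //; exact: filterT.
  - by exists (setT, Q) => //; split=> //; exact: filterT.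
  by move=> [x1 x2] [[_ ?] [_ ?]]; exists x2.
have cF : continuous (fun z : C * A => f (p z.1) (set_val z.2)).
  apply: (H (C * A)%type (p \o fst) (set_val \o snd)) => //.
    by apply: cont_comp cp => x; exact: cvg_fst.
  by apply: (@cont_comp _ _ _ snd) => [x|];
    [exact: cvg_snd|exact: set_type_cont].
have /compact_near_coveringP ncA := cA'.
have near_c : \forall d \near nbhs c,
    forall a : A, [set: A] a -> O (f (p d) (set_val a)).
  apply: ncA => a _.
  have Oa : O (f (p c) (set_val a)).
    by apply: fAO; exists (set_val a) => //; exact: set_valP.
  have := cF (c, a) O (open_nbhs_nbhs (conj oO Oa)).
  move=> [[P Q] [Pc Qa] PQ].
  by exists (Q, P) => // -[b d] /= [Qb Pd]; exact: (PQ (d, b)).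
move: near_c; apply: filterS => d Hd _ [x Ax <-].
exact: (Hd (exist _ x (mem_set Ax)) I).
Qed.

End cmap_theory.

(* An injection compatible with the operations pulls back the module axioms. *)
Section pullback_lmodule.
Variables (K : pzRingType) (E : lmodType K) (T : Type) (v : T -> E).
Variables (zero : T) (opp : T -> T) (add : T -> T -> T) (scale : K -> T -> T).
Hypotheses (vI : injective v) (v0 : v zero = 0).
Hypotheses (vN : forall x, v (opp x) = - v x).
Hypotheses (vD : forall x y, v (add x y) = v x + v y).
Hypotheses (vZ : forall a x, v (scale a x) = a *: v x).

Lemma pull_addA : associative add.
Proof. by move=> x y z; apply: vI; rewrite !vD addrA. Qed.
Lemma pull_addC : commutative add.
Proof. by move=> x y; apply: vI; rewrite !vD addrC. Qed.
Lemma pull_add0 : left_id zero add.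
Proof. by move=> x; apply: vI; rewrite vD v0 add0r. Qed.
Lemma pull_addN : left_inverse zero opp add.
Proof. by move=> x; apply: vI; rewrite vD vN v0 addNr. Qed.
Lemma pull_scaleA a b x : scale a (scale b x) = scale (a * b) x.
Proof. by apply: vI; rewrite !vZ scalerA. Qed.
Lemma pull_scale1 : left_id 1 scale.
Proof. by move=> x; apply: vI; rewrite vZ scale1r. Qed.
Lemma pull_scaleDr : right_distributive scale add.
Proof. by move=> a x y; apply: vI; rewrite !(vD, vZ) scalerDr. Qed.
Lemma pull_scaleDl x a b : scale (a + b) x = add (scale a x) (scale b x).
Proof. by apply: vI; rewrite !(vD, vZ) scalerDl. Qed.

End pullback_lmodule.

Record submod (K : numFieldType) (E : lmodType K) := Submod {
  sm_set : set E ;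
  sm0 : sm_set 0 ;
  sm_lin : forall a x y, sm_set x -> sm_set y -> sm_set (a *: x + y) }.

Definition subsp (K : numFieldType) (E : preTopologicalLmodType K)
  (S : submod E) : Type := set_type (sm_set S).

HB.instance Definition _ (K : numFieldType) (E : preTopologicalLmodType K)
  (S : submod E) := Topological.copy (subsp S) (set_type (sm_set S)).

Section subsp_lmod.
Variables (K : numFieldType) (E : preTopologicalLmodType K) (S : submod E).

Definition subsp_val (x : subsp S) : E := set_val x.

Lemma subsp_valP x : sm_set S (subsp_val x).
Proof. exact: (set_valP x). Qed.

Lemma subsp_inj : injective subsp_val.
Proof. exact: val_inj. Qed.

Definition mksub (x : E) (Sx : sm_set S x) : subsp S := exist _ x (mem_set Sx).

Lemma smN x : sm_set S x -> sm_set S (- x).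
Proof. by move=> Sx; have := sm_lin (-1) Sx (sm0 S); rewrite addr0 scaleN1r. Qed.
Lemma smD x y : sm_set S x -> sm_set S y -> sm_set S (x + y).
Proof. by move=> Sx Sy; have := sm_lin 1 Sx Sy; rewrite scale1r. Qed.
Lemma smZ a x : sm_set S x -> sm_set S (a *: x).
Proof. by move=> Sx; have := sm_lin a Sx (sm0 S); rewrite addr0. Qed.

Let zero := mksub (sm0 S).
Let opp x := mksub (smN (subsp_valP x)).
Let add x y := mksub (smD (subsp_valP x) (subsp_valP y)).
Let scale a x := mksub (smZ a (subsp_valP x)).
Let v0 : subsp_val zero = 0. Proof. by []. Qed.
Let vN x : subsp_val (opp x) = - subsp_val x. Proof. by []. Qed.
Let vD x y : subsp_val (add x y) = subsp_val x + subsp_val y.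
Proof. by []. Qed.
Let vZ a x : subsp_val (scale a x) = a *: subsp_val x. Proof. by []. Qed.

HB.instance Definition _ := GRing.isZmodule.Build (subsp S)
  (pull_addA subsp_inj vD) (pull_addC subsp_inj vD)
  (pull_add0 subsp_inj v0 vD) (pull_addN subsp_inj v0 vN vD).
HB.instance Definition _ := GRing.Zmodule_isLmodule.Build K (subsp S)
  (pull_scaleA subsp_inj vZ) (pull_scale1 subsp_inj vZ)
  (pull_scaleDr subsp_inj vD vZ) (pull_scaleDl subsp_inj vD vZ).

Lemma subsp_val_linear : linear subsp_val.
Proof. by []. Qed.

End subsp_lmod.

(* The natural dual, as a subspace of C(V, K); K^o is the field K seen as a
   topological module over itself. *)
Definition ndual (K : numFieldType) (V : preTopologicalLmodType K) : Type :=
  set_type [set f : cmap V K^o | linear f].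

HB.instance Definition _ (K : numFieldType) (V : preTopologicalLmodType K) :=
  Topological.copy (ndual V) (set_type [set f : cmap V K^o | linear f]).

Section ndual_lmod.
Variables (K : numFieldType) (V : preTopologicalLmodType K).

Definition ndual_fun (f : ndual V) : V -> K^o := cmap_fun (set_val f).
Local Coercion ndual_fun : ndual >-> Funclass.

Lemma ndual_cont (f : ndual V) : continuous f.
Proof. exact: cmap_cont. Qed.

Lemma ndual_linear (f : ndual V) : linear f.
Proof. exact: (set_valP f). Qed.

Lemma ndual_ext (f g : ndual V) : (forall x, f x = g x) -> f = g.
Proof. by move=> fg; apply: val_inj; apply: cmap_inj. Qed.

Lemma ndual_inj : injective ndual_fun.
Proof. by move=> f g fg; apply: ndual_ext => x; rewrite fg. Qed.

Definition mkndual (f : V -> K^o) (cf : continuous f) (lf : linear f) :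
  ndual V := exist _ (mkcmap cf) (mem_set (lf : linear (mkcmap cf))).

Let c0 : continuous (fun _ : V => 0 : K^o). Proof. by move=> x; exact: cvg_cst. Qed.
Let l0 : linear (fun _ : V => 0 : K^o).
Proof. by move=> a x y; rewrite scaler0 addr0. Qed.
Let cN (f : ndual V) : continuous (fun x => - f x).
Proof. by move=> x; apply: cvgN; exact: ndual_cont. Qed.
Let lN (f : ndual V) : linear (fun x => - f x).
Proof. by move=> a x y; rewrite ndual_linear opprD scalerN. Qed.
Let cD (f g : ndual V) : continuous (fun x => f x + g x).
Proof. by move=> x; apply: cvgD; exact: ndual_cont. Qed.
Let lD (f g : ndual V) : linear (fun x => f x + g x).
Proof. by move=> a x y; rewrite !ndual_linear scalerDr addrACA. Qed.
Let cZ b (f : ndual V) : continuous (fun x => b *: f x).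
Proof. by move=> x; apply: cvgZr; exact: ndual_cont. Qed.
Let lZ b (f : ndual V) : linear (fun x => b *: f x).
Proof. by move=> a x y; rewrite !ndual_linear scalerDr !scalerA mulrC. Qed.

Let zero := mkndual c0 l0.
Let opp f := mkndual (@cN f) (@lN f).
Let add f g := mkndual (@cD f g) (@lD f g).
Let scale b f := mkndual (@cZ b f) (@lZ b f).
Let v0 : ndual_fun zero = 0. Proof. by []. Qed.
Let vN x : ndual_fun (opp x) = - ndual_fun x. Proof. by []. Qed.
Let vD x y : ndual_fun (add x y) = ndual_fun x + ndual_fun y.
Proof. by []. Qed.
Let vZ a x : ndual_fun (scale a x) = a *: ndual_fun x. Proof. by []. Qed.

HB.instance Definition _ := GRing.isZmodule.Build (ndual V)
  (pull_addA ndual_inj vD) (pull_addC ndual_inj vD)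
  (pull_add0 ndual_inj v0 vD) (pull_addN ndual_inj v0 vN vD).
HB.instance Definition _ := GRing.Zmodule_isLmodule.Build K (ndual V)
  (pull_scaleA ndual_inj vZ) (pull_scale1 ndual_inj vZ)
  (pull_scaleDr ndual_inj vD vZ) (pull_scaleDl ndual_inj vD vZ).

Lemma ndualD (f g : ndual V) x : ndual_fun (f + g) x = f x + g x. Proof. by []. Qed.
Lemma ndualZ a (f : ndual V) x : ndual_fun (a *: f) x = a *: f x. Proof. by []. Qed.
End ndual_lmod.
Coercion ndual_fun : ndual >-> Funclass.

Section more_top.

Lemma closed_eqset_T2 (Z X : topologicalType) (f g : Z -> X) :
  hausdorff_space X -> continuous f -> continuous g ->
  closed [set z | f z = g z].
Proof.
move=> hX cf cg z clz; apply: hX => A B Afz Bgz.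
have nz : nbhs z (f @^-1` A `&` g @^-1` B).
  by apply: filterI; [exact: cf|exact: cg].
by have [w [fgw [Aw Bw]]] := clz _ nz; exists (f w); split=> //; rewrite fgw.
Qed.

Lemma cst_cont (X Y : topologicalType) (y : Y) : continuous (fun _ : X => y).
Proof. by move=> x; exact: cvg_cst. Qed.

Lemma hausdorff_sep (X Y : topologicalType) : hausdorff_space Y ->
  (forall x y : X, (forall g : X -> Y, continuous g -> g x = g y) -> x = y) ->
  hausdorff_space X.
Proof.
move=> hY H x y xy; apply: H => g cg; apply: hY => A B Ax By.
have [] := xy (g @^-1` A) (g @^-1` B); [exact: cg|exact: cg|].
by move=> z [? ?]; exists (g z).
Qed.

Lemma cmap_pt (X Y : topologicalType) (x : X) :
  continuous (fun f : cmap X Y => f x).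
Proof.
apply: (@cont_comp _ _ _ (@cmap_fun X Y : _ -> {compact-open, X -> Y})
   (fun f => f x)); first exact: cmap_val_cont.
apply/continuousP => O oO.
have := @compact_open_open X Y [set x] O (@compact_set1 _ x) oO.
congr open; apply/seteqP; split=> f /=; first by apply; exists x.
by move=> Ofx _ [_ -> <-].
Qed.

End more_top.

Definition closed_embedding (X Y : topologicalType) (f : X -> Y) : Prop :=
  [/\ injective f,
      forall U, open U <-> exists2 O, open O & U = f @^-1` O
    & closed (range f)].

Lemma cemb_to (Z X Y : topologicalType) (f : X -> Y) (g : Z -> X) :
  closed_embedding f -> continuous (f \o g) -> continuous g.
Proof.
move=> [_ fo _] cfg; apply/continuousP => U /fo[O oO ->].
by move/continuousP : cfg; apply.
Qed.

Lemma cemb_cont (X Y : topologicalType) (f : X -> Y) :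
  closed_embedding f -> continuous f.
Proof. by move=> [_ fo _]; apply/continuousP => O oO; apply/fo; exists O. Qed.

Section linear_hk.
Variable K : numFieldType.

Definition linear_hk (V : preTopologicalLmodType K) : Prop :=
  [/\ hkspace V,
      continuous ((fun xy => xy.1 + xy.2) : kprod V V -> V)
    & continuous ((fun ax => ax.1 *: ax.2) : kprod K^o V -> V)].

Lemma linhkD (V : preTopologicalLmodType K) (Z : topologicalType)
  (f g : Z -> V) : linear_hk V -> kspace Z -> continuous f -> continuous g ->
  continuous (fun z => f z + g z).
Proof.
move=> [_ cD _] kZ cf cg.
exact: (cont_comp (kprod_pair kZ cf cg) cD).
Qed.

Lemma linhkZ (V : preTopologicalLmodType K) (Z : topologicalType)
  (a : Z -> K^o) (f : Z -> V) :
  linear_hk V -> kspace Z -> continuous a -> continuous f ->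
  continuous (fun z => a z *: f z).
Proof.
move=> [_ _ cZ] kZ ca cf.
exact: (cont_comp (kprod_pair kZ ca cf) cZ).
Qed.

Lemma linear_hkI (V : preTopologicalLmodType K) :
  kspace V -> hausdorff_space V ->
  (forall (C : topologicalType) (p q : C -> V), compact [set: C] -> hausdorff_space C ->
    continuous p -> continuous q -> continuous (fun c => p c + q c)) ->
  (forall (C : topologicalType) (p : C -> K^o) (q : C -> V), compact [set: C] ->
    hausdorff_space C ->
    continuous p -> continuous q -> continuous (fun c => p c *: q c)) ->
  linear_hk V.
Proof.
move=> kV hV hD hZ; split.
- exact: hausdorff_hk.
- apply: (@kify_kspace (V * V)%type) => C p cC hC cp.
  apply: hD => //.
    by apply: (@cont_comp _ (kprod V V) _ p fst) => //; exact: kprod_fst.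
  by apply: (@cont_comp _ (kprod V V) _ p snd) => //; exact: kprod_snd.
- apply: (@kify_kspace (K^o * V)%type) => C p cC hC cp.
  apply: hZ => //.
    by apply: (@cont_comp _ (kprod K^o V) _ p fst) => //; exact: kprod_fst.
  by apply: (@cont_comp _ (kprod K^o V) _ p snd) => //; exact: kprod_snd.
Qed.

Lemma Ko_hausdorff : hausdorff_space K^o.
Proof. exact: norm_hausdorff. Qed.

Lemma KoD (Z : topologicalType) (f g : Z -> K^o) :
  continuous f -> continuous g -> continuous (fun z => f z + g z : K^o).
Proof. by move=> cf cg z; apply: cvgD; [exact: cf|exact: cg]. Qed.

Lemma KoZ (Z : topologicalType) a (f : Z -> K^o) :
  continuous f -> continuous (fun z => a *: f z : K^o).
Proof. by move=> cf z; apply: cvgZr; exact: cf. Qed.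

Lemma closed_linear (V W : preTopologicalLmodType K) :
  linear_hk W -> hausdorff_space W ->
  closed [set f : cmap V W | linear f].
Proof.
move=> hkW hW.
suff -> : [set f : cmap V W | linear f] =
    \bigcap_(t in [set: K * V * V])
       [set f : cmap V W | f (t.1.1 *: t.1.2 + t.2) = t.1.1 *: f t.1.2 + f t.2].
  apply: closed_bigI => -[[a x] y] _ /=.
  apply: closed_eqset_T2 => //; first exact: cmap_pt.
  have kc := @cmap_kspace V W.
  apply: (linhkD hkW kc); last exact: cmap_pt.
  apply: (linhkZ hkW kc) ; [exact: cst_cont|exact: cmap_pt].
apply/seteqP; split=> [f lf [[a x] y] _ /=|f lf a x y]; first exact: lf.
exact: (lf (a, x, y)).
Qed.

End linear_hk.

Section ndual_theory.
Variable K : numFieldType.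
Implicit Types V W : preTopologicalLmodType K.

Lemma ndual_to V (Z : topologicalType) (f : Z -> ndual V) :
  kspace Z -> hausdorff_space V ->
  (forall (C : topologicalType) (p : C -> Z) (q : C -> V),
     compact [set: C] -> hausdorff_space C -> continuous p -> continuous q ->
     continuous (fun c => f (p c) (q c) : K^o)) ->
  continuous f.
Proof.
move=> kZ hV H; apply: cont_to_set.
by apply: cmap_curry => // C p q cC hC cp cq; exact: H.
Qed.

Lemma ndual_eval V (Z : topologicalType) (f : Z -> ndual V) (g : Z -> V) :
  kspace Z -> continuous f -> continuous g ->
  continuous (fun z => f z (g z) : K^o).
Proof.
move=> kZ cf cg.
apply: (@cmap_eval _ _ _ (fun z => set_val (f z)) g) => //.
by apply: (@cont_comp _ _ _ f set_val) => //; exact: set_type_cont.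
Qed.

Lemma ndual_pt V (x : V) : continuous (fun f : ndual V => f x : K^o).
Proof.
apply: (@cont_comp _ _ _ set_val (fun f : cmap V K^o => f x)).
  exact: set_type_cont.
exact: cmap_pt.
Qed.

Lemma ndual_hausdorff V : hausdorff_space (ndual V).
Proof.
apply: (hausdorff_sep (@Ko_hausdorff K)) => f g H; apply: ndual_ext => x.
by have := H (fun f : ndual V => f x : K^o) (@ndual_pt V x).
Qed.

Lemma closed_ndual V : closed [set f : cmap V K^o | linear f].
Proof.
have -> : [set f : cmap V K^o | linear f] =
    \bigcap_(t in [set: K * V * V])
      [set f : cmap V K^o | f (t.1.1 *: t.1.2 + t.2) = t.1.1 *: f t.1.2 + f t.2].
  apply/seteqP; split=> [f lf [[a x] y] _ /=|f lf a x y]; first exact: lf.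
  exact: (lf (a, x, y)).
apply: closed_bigI => -[[a x] y] _ /=.
apply: closed_eqset_T2; [exact: Ko_hausdorff|exact: cmap_pt|].
have cp z : continuous (fun f : cmap V K^o => f z : K^o) by exact: cmap_pt.
by apply: KoD; [apply: KoZ; exact: cp|exact: cp].
Qed.

Lemma ndual_kspace V : kspace (ndual V).
Proof.
by apply: (@closed_kspace (cmap V K^o));
  [exact: cmap_kspace|exact: closed_ndual].
Qed.

Lemma subsp_cont V (S : submod V) : continuous (@subsp_val K V S).
Proof. exact: set_type_cont. Qed.

Lemma subsp_hausdorff V (S : submod V) :
  hausdorff_space V -> hausdorff_space (subsp S).
Proof. exact: set_type_hausdorff. Qed.

Lemma subsp_kspace V (S : submod V) :
  kspace V -> closed (sm_set S) -> kspace (subsp S).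
Proof. exact: closed_kspace. Qed.

Lemma ndual_precomp_cont V W (f : V -> W) (cf : continuous f)
  (lf : linear f) (phi : ndual W) : continuous (fun x => phi (f x)).
Proof. by apply: cont_comp cf _; exact: ndual_cont. Qed.

Lemma ndual_precomp_lin V W (f : V -> W) (cf : continuous f)
  (lf : linear f) (phi : ndual W) : linear (fun x => phi (f x) : K^o).
Proof. by move=> a x y; rewrite lf ndual_linear. Qed.

Section eval.
Variables (V : preTopologicalLmodType K) (D : submod (ndual V)) (x : V).

Let cev : continuous (fun phi : subsp D => ndual_fun (subsp_val phi) x : K^o).
Proof.
apply: (@cont_comp _ _ _ (@subsp_val K _ D)
  (fun f : ndual V => f x : K^o)).
  exact: subsp_cont.
exact: ndual_pt.
Qed.

Let lev : linear (fun phi : subsp D => ndual_fun (subsp_val phi) x : K^o).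
Proof. by []. Qed.

Definition dual_eval : ndual (subsp D) := mkndual cev lev.

Lemma dual_evalE (phi : subsp D) : dual_eval phi = ndual_fun (subsp_val phi) x.
Proof. by []. Qed.

End eval.

End ndual_theory.

(* As pdual is closed in the k-space ndual psp, its subspace topology (the one
   carried by subsp pdual) is already a k-topology. *)
Record pairedHK (K : numFieldType) := PairedHK {
  psp :> preTopologicalLmodType K ;
  pdual : submod (ndual psp) ;
  psp_linear_hk : linear_hk psp ;
  pdual_closed : closed (sm_set pdual) ;
  peval_embedding : closed_embedding (dual_eval pdual) }.

Section paired_theory.
Variable K : numFieldType.
Implicit Types V W : pairedHK K.

Lemma paired_kspace V : kspace V.
Proof. by have [[]] := psp_linear_hk V. Qed.

Lemma paired_sep V (x y : V) :
  (forall phi : ndual V, sm_set (pdual V) phi -> phi x = phi y) -> x = y.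
Proof.
move=> H; have [inj _ _] := peval_embedding V; apply: inj.
by apply: ndual_ext => phi; exact: (H _ (subsp_valP phi)).
Qed.

Lemma paired_hausdorff V : hausdorff_space V.
Proof.
apply: (hausdorff_sep (@Ko_hausdorff K)) => x y H; apply: paired_sep => phi _.
exact: (H phi (@ndual_cont _ _ phi)).
Qed.

Lemma pdual_kspace V : kspace (subsp (pdual V)).
Proof. by apply: subsp_kspace; [exact: ndual_kspace|exact: pdual_closed]. Qed.

Lemma pdual_hausdorff V : hausdorff_space (subsp (pdual V)).
Proof. by apply: subsp_hausdorff; exact: ndual_hausdorff. Qed.

(* g belongs to V^* *)
Definition in_dual V (g : V -> K) : Prop :=
  exists2 psi : ndual V, sm_set (pdual V) psi & forall x, psi x = g x.

Lemma in_dualP V (psi : ndual V) : in_dual psi -> sm_set (pdual V) psi.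
Proof. by case=> psi' + H; have -> : psi' = psi by exact: ndual_ext. Qed.

Definition ihom_set V W : set (cmap V W) :=
  [set f | linear f /\
     forall phi : ndual W, sm_set (pdual W) phi -> in_dual (fun x => phi (f x))].

Definition ihom V W : Type := set_type (@ihom_set V W).

HB.instance Definition _ V W :=
  Topological.copy (ihom V W) (set_type (@ihom_set V W)).

Section ihom_lmod.
Variables V W : pairedHK K.

Definition ihom_fun (f : ihom V W) : V -> W := cmap_fun (set_val f).
Local Coercion ihom_fun : ihom >-> Funclass.

Lemma ihom_cont (f : ihom V W) : continuous f.
Proof. exact: cmap_cont. Qed.

Lemma ihom_linear (f : ihom V W) : linear f.
Proof. by have [] := set_valP f. Qed.

Lemma ihom_dualP (f : ihom V W) (phi : ndual W) :
  sm_set (pdual W) phi -> in_dual (fun x => phi (f x)).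
Proof. by have [_] := set_valP f; apply. Qed.

Lemma ihom_inj : injective ihom_fun.
Proof.
by move=> f g fg; apply: val_inj; apply: cmap_inj => x;
  have := congr1 (fun h => h x) fg.
Qed.

Lemma ihom_ext (f g : ihom V W) : (forall x, f x = g x) -> f = g.
Proof. by move=> H; apply: ihom_inj; apply/funext. Qed.

Definition mkihom (f : V -> W) (cf : continuous f) (lf : linear f)
  (df : forall phi : ndual W, sm_set (pdual W) phi -> in_dual (fun x => phi (f x))) :
  ihom V W :=
  exist _ (mkcmap cf) (mem_set (conj lf df : ihom_set (mkcmap cf))).

Let hkW := psp_linear_hk W.
Let kV := @paired_kspace V.

Let c0 : continuous (fun _ : V => 0 : W). Proof. by move=> x; exact: cvg_cst. Qed.
Let l0 : linear (fun _ : V => 0 : W).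
Proof. by move=> a x y; rewrite scaler0 addr0. Qed.
Lemma ndual0 (U : preTopologicalLmodType K) (phi : ndual U) : phi 0 = 0.
Proof. by have := ndual_linear phi (-1) 0 0; rewrite scaler0 addr0 scaleN1r addNr. Qed.
Let d0 (phi : ndual W) : sm_set (pdual W) phi -> in_dual (fun x : V => phi (0 : W)).
Proof. by move=> _; exists 0; [exact: sm0|move=> x; rewrite ndual0]. Qed.

Let cL a (f g : ihom V W) : continuous (fun x => a *: f x + g x).
Proof.
apply: (linhkD hkW kV); last exact: ihom_cont.
by apply: (linhkZ hkW kV) ; [exact: cst_cont|exact: ihom_cont].
Qed.
Let lL a (f g : ihom V W) : linear (fun x => a *: f x + g x).
Proof.
by move=> b x y; rewrite !ihom_linear !scalerDr !scalerA [b * a]mulrC addrACA.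
Qed.
Let dL a (f g : ihom V W) (phi : ndual W) : sm_set (pdual W) phi ->
  in_dual (fun x => phi (a *: f x + g x)).
Proof.
move=> Wphi; have [pf Vf Hf] := ihom_dualP f Wphi.
have [pg Vg Hg] := ihom_dualP g Wphi.
exists (a *: pf + pg); first exact: sm_lin.
by move=> x; rewrite ndual_linear -Hf -Hg.
Qed.
Let lin a f g := mkihom (@cL a f g) (@lL a f g) (@dL a f g).

Let zero := mkihom c0 l0 d0.
Let opp f := lin (-1) f zero.
Let add f g := lin 1 f g.
Let scale b f := lin b f zero.
Let v0 : ihom_fun zero = 0. Proof. by []. Qed.
Let vN f : ihom_fun (opp f) = - ihom_fun f.
Proof. apply/funext => x; rewrite (_ : ihom_fun _ x = -1 *: f x + 0) //.
by rewrite addr0 scaleN1r. Qed.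
Let vD f g : ihom_fun (add f g) = ihom_fun f + ihom_fun g.
Proof. apply/funext => x; rewrite (_ : ihom_fun _ x = 1 *: f x + g x) //.
by rewrite scale1r. Qed.
Let vZ a f : ihom_fun (scale a f) = a *: ihom_fun f.
Proof. apply/funext => x; rewrite (_ : ihom_fun _ x = a *: f x + 0) //.
by rewrite addr0. Qed.

HB.instance Definition _ := GRing.isZmodule.Build (ihom V W)
  (pull_addA ihom_inj vD) (pull_addC ihom_inj vD)
  (pull_add0 ihom_inj v0 vD) (pull_addN ihom_inj v0 vN vD).
HB.instance Definition _ := GRing.Zmodule_isLmodule.Build K (ihom V W)
  (pull_scaleA ihom_inj vZ) (pull_scale1 ihom_inj vZ)
  (pull_scaleDr ihom_inj vD vZ) (pull_scaleDl ihom_inj vD vZ).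

Lemma ihomD (f g : ihom V W) x : ihom_fun (f + g) x = f x + g x.
Proof. by have := congr1 (fun h => h x) (vD f g). Qed.
Lemma ihomZ a (f : ihom V W) x : ihom_fun (a *: f) x = a *: f x.
Proof. by have := congr1 (fun h => h x) (vZ a f). Qed.

End ihom_lmod.
End paired_theory.
Coercion ihom_fun : ihom >-> Funclass.

Section closed_span.
Variables (K : numFieldType) (E : preTopologicalLmodType K) (A : set E).

Definition closed_span_set : set E :=
  [set y | forall S : submod E,
     closed (sm_set S) -> A `<=` sm_set S -> sm_set S y].

Lemma closed_span0 : closed_span_set 0.
Proof. by move=> S _ _; exact: sm0. Qed.

Lemma closed_span_lin a x y :
  closed_span_set x -> closed_span_set y -> closed_span_set (a *: x + y).
Proof. by move=> Ax Ay S cS AS; apply: sm_lin; [exact: Ax|exact: Ay]. Qed.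

Definition closed_span : submod E := Submod closed_span0 closed_span_lin.

Lemma closed_span_closed : closed (sm_set closed_span).
Proof.
move=> x clx S cS AS; apply: (cS) => N Nx.
by have [y [Hy Ny]] := clx N Nx; exists y; split=> //; exact: Hy.
Qed.

Lemma sub_closed_span : A `<=` sm_set closed_span.
Proof. by move=> x Ax S _; apply. Qed.

End closed_span.

Section ihom_paired.
Variables (K : numFieldType) (V W : pairedHK K).

Lemma ihom_to (Z : topologicalType) (f : Z -> ihom V W) :
  kspace Z ->
  (forall (C : topologicalType) (p : C -> Z) (q : C -> V),
     compact [set: C] -> hausdorff_space C -> continuous p -> continuous q ->
     continuous (fun c => f (p c) (q c) : W)) ->
  continuous f.
Proof.
move=> kZ H; apply: cont_to_set.
by apply: cmap_curry => //; exact: paired_hausdorff.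
Qed.

Lemma ihom_eval (Z : topologicalType) (f : Z -> ihom V W) (g : Z -> V) :
  kspace Z -> continuous f -> continuous g ->
  continuous (fun z => f z (g z) : W).
Proof.
move=> kZ cf cg.
apply: (@cmap_eval _ _ _ (fun z => set_val (f z)) g) => //.
by apply: (@cont_comp _ _ _ f set_val) => //; exact: set_type_cont.
Qed.

Lemma ihom_pt (x : V) : continuous (fun f : ihom V W => f x : W).
Proof.
apply: (@cont_comp _ _ _ set_val (fun f : cmap V W => f x)).
  exact: set_type_cont.
exact: cmap_pt.
Qed.

Lemma ihom_hausdorff : hausdorff_space (ihom V W).
Proof.
apply: (hausdorff_sep (@paired_hausdorff K W)) => f g H; apply: ihom_ext => x.
exact: (H (fun f : ihom V W => f x : W) (@ihom_pt x)).
Qed.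

Lemma closed_in_dual : closed [set g : cmap V K^o | in_dual g].
Proof.
have -> : [set g : cmap V K^o | in_dual g] =
    (@set_val (cmap V K^o) [set f : cmap V K^o | linear f])
      @` (sm_set (pdual V)).
  apply/seteqP; split=> [g [psi Vpsi H]|_ [psi Vpsi <-]].
    by exists psi => //; exact: cmap_inj.
  by exists psi.
apply: set_type_closed; first exact: closed_ndual.
exact: pdual_closed.
Qed.

Lemma postcomp_cont (phi : ndual W) (H : forall f : cmap V W, continuous (phi \o f)) :
  continuous (fun f => mkcmap (H f)).
Proof.
apply: cmap_curry; [exact: cmap_kspace|exact: paired_hausdorff|].
move=> C p q cC hC cp cq.
have : continuous ((phi : W -> K^o) \o (fun c => cmap_fun (p c) (q c))).
  by apply: cont_comp; [exact: test_eval|exact: ndual_cont].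
by [].
Qed.

Lemma closed_ihom_set : closed (@ihom_set K V W).
Proof.
have H (phi : ndual W) (f : cmap V W) : continuous (phi \o f).
  by apply: cont_comp; [exact: cmap_cont|exact: ndual_cont].
have -> : @ihom_set K V W = [set f : cmap V W | linear f] `&`
    \bigcap_(phi in sm_set (pdual W))
      ((fun f : cmap V W => mkcmap (H phi f)) @^-1`
       [set g : cmap V K^o | in_dual g]) by [].
apply: closedI.
  by apply: closed_linear; [exact: psp_linear_hk|exact: paired_hausdorff].
apply: closed_bigI => phi _.
have /continuous_closedP := @postcomp_cont phi (H phi).
by apply; exact: closed_in_dual.
Qed.

Lemma ihom_kspace : kspace (ihom V W).
Proof.
by apply: (@closed_kspace (cmap V W));
  [exact: cmap_kspace|exact: closed_ihom_set].
Qed.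

Lemma ihom_linear_hk : linear_hk (ihom V W).
Proof.
have hW := psp_linear_hk W.
apply: linear_hkI; [exact: ihom_kspace|exact: ihom_hausdorff| |].
- move=> C p q cC hC cp cq; have kC := compact_kspace cC hC.
  apply: ihom_to => // D r s cD hD cr cs.
  have kD := compact_kspace cD hD.
  under eq_fun do rewrite ihomD.
  by apply: linhkD => //; apply: ihom_eval => //; exact: cont_comp cr _.
- move=> C p q cC hC cp cq; have kC := compact_kspace cC hC.
  apply: ihom_to => // D r s cD hD cr cs.
  have kD := compact_kspace cD hD.
  under eq_fun do rewrite ihomZ.
  apply: linhkZ => //; first exact: cont_comp cr _.
  by apply: ihom_eval => //; exact: cont_comp cr _.
Qed.

(* [V, W]^*: the smallest closed linear subspace of the natural dual of [V, W]
   containing the functionals f |-> phi (f x). *)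
Definition ihom_dual : submod (ndual (ihom V W)) :=
  closed_span [set psi : ndual (ihom V W) | exists x : V,
    exists2 phi : ndual W, sm_set (pdual W) phi &
      forall f : ihom V W, psi f = phi (f x)].

Lemma hev_cont (x : V) (phi : ndual W) :
  continuous (fun f : ihom V W => phi (f x) : K^o).
Proof.
by apply: (cont_comp (@ihom_pt x)); exact: ndual_cont.
Qed.
Lemma hev_lin (x : V) (phi : ndual W) :
  linear (fun f : ihom V W => phi (f x) : K^o).
Proof. by move=> a f g; rewrite ihomD ihomZ ndual_linear. Qed.
Definition hev x phi : ndual (ihom V W) :=
  mkndual (@hev_cont x phi) (@hev_lin x phi).

Lemma hev_dual x phi : sm_set (pdual W) phi -> sm_set ihom_dual (hev x phi).
Proof. by move=> Wphi; apply: sub_closed_span; exists x, phi. Qed.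

Local Notation H := (ihom V W).
Local Notation D := (subsp ihom_dual).
Local Notation B := (ndual (subsp ihom_dual)).
Local Notation W' := (subsp (pdual W)).

Lemma ihom_dual_closed : closed (sm_set ihom_dual).
Proof. exact: closed_span_closed. Qed.

Let kH : kspace H. Proof. exact: ihom_kspace. Qed.
Let kD : kspace D.
Proof. by apply: subsp_kspace; [exact: ndual_kspace|exact: ihom_dual_closed]. Qed.
Let hD : hausdorff_space D.
Proof. by apply: subsp_hausdorff; exact: ndual_hausdorff. Qed.
Let kB : kspace B. Proof. exact: ndual_kspace. Qed.

Definition del (x : V) (phi : W') : D := mksub (hev_dual x (subsp_valP phi)).

Lemma delE x phi (f : H) :
  ndual_fun (subsp_val (del x phi)) f = ndual_fun (subsp_val phi) (f x).
Proof. by []. Qed.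

Lemma del_test (C : topologicalType) (p : C -> V) (q : C -> W') :
  kspace C -> continuous p -> continuous q ->
  continuous (fun c => del (p c) (q c) : D).
Proof.
move=> kC cp cq; apply: cont_to_set.
apply: ndual_to => //; first exact: ihom_hausdorff.
move=> C' p' q' cC' hC' cp' cq'; have kC' := compact_kspace cC' hC'.
apply: (@ndual_eval _ _ _ (fun c => subsp_val (q (p' c)))
  (fun c => ihom_fun (q' c) (p (p' c)))) => //.
- exact: (cont_comp (cont_comp cp' cq) (@subsp_cont _ _ (pdual W))).
- by apply: ihom_eval => //; exact: (cont_comp cp' cp).
Qed.

Lemma bx_cont (e : B) x : continuous (fun phi : W' => e (del x phi) : K^o).
Proof.
apply: (@cont_comp _ _ _ (fun phi => del x phi) e); last exact: ndual_cont.
apply: del_test; [exact: pdual_kspace|exact: cst_cont|by move=> ?].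
Qed.
Lemma del_linr x : linear (del x).
Proof. by move=> a f g; apply: subsp_inj; apply: ndual_ext. Qed.
Lemma bx_lin (e : B) x : linear (fun phi : W' => e (del x phi) : K^o).
Proof. by move=> a f g; rewrite del_linr ndual_linear. Qed.
Definition bx e x : ndual W' := mkndual (@bx_cont e x) (@bx_lin e x).

Lemma bphi_cont (e : B) (phi : W') : continuous (fun x : V => e (del x phi) : K^o).
Proof.
apply: (@cont_comp _ _ _ (fun x => del x phi) e); last exact: ndual_cont.
apply: del_test; [exact: paired_kspace|by move=> ?|exact: cst_cont].
Qed.
Lemma del_linl phi : linear (fun x => del x phi).
Proof.
move=> a x y; apply: subsp_inj; apply: ndual_ext => f.
by rewrite delE ihom_linear ndual_linear.
Qed.
Lemma bphi_lin (e : B) (phi : W') : linear (fun x : V => e (del x phi) : K^o).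
Proof.
by move=> a x y; rewrite (del_linl phi) ndual_linear.
Qed.
Definition bphi e phi : ndual V := mkndual (@bphi_cont e phi) (@bphi_lin e phi).

Lemma bx_test (C : topologicalType) (p : C -> B) (q : C -> V) :
  kspace C -> continuous p -> continuous q ->
  continuous (fun c => bx (p c) (q c) : ndual W').
Proof.
move=> kC cp cq; apply: ndual_to => //; first exact: pdual_hausdorff.
move=> C' p' q' cC' hC' cp' cq'; have kC' := compact_kspace cC' hC'.
apply: (@ndual_eval _ _ _ (fun c => p (p' c))
  (fun c => del (q (p' c)) (q' c))) => //; first exact: (cont_comp cp' cp).
by apply: del_test => //; exact: (cont_comp cp' cq).
Qed.

Lemma bphi_test (C : topologicalType) (p : C -> B) (phi : W') :
  kspace C -> continuous p -> continuous (fun c => bphi (p c) phi : ndual V).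
Proof.
move=> kC cp; apply: ndual_to => //; first exact: paired_hausdorff.
move=> C' p' q' cC' hC' cp' cq'; have kC' := compact_kspace cC' hC'.
apply: (@ndual_eval _ _ _ (fun c => p (p' c))
  (fun c => del (q' c) phi)) => //; first exact: (cont_comp cp' cp).
by apply: del_test => //; exact: cst_cont.
Qed.

(* The image of [V, W] in the dual of [V, W]^* consists of those e for which
   phi |-> e (del x phi) is evaluation at a point of W, for all x, and
   x |-> e (del x phi) lies in V^*, for all phi. *)
Definition goodset : set B :=
  [set e | (forall x, range (dual_eval (pdual W)) (bx e x)) /\
           (forall phi, sm_set (pdual V) (bphi e phi))].

Lemma goodset_closed : closed goodset.
Proof.
have -> : goodset =
   (\bigcap_(x in [set: V]) ((fun e => bx e x) @^-1` range (dual_eval (pdual W))))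
   `&` \bigcap_(phi in [set: W']) ((fun e => bphi e phi) @^-1` (sm_set (pdual V))).
  by apply/seteqP; split=> e [e1 e2]; split=> x *;
    [exact: e1|exact: e2|exact: (e1 x I)|exact: (e2 x I)].
apply: closedI; apply: closed_bigI => x _.
  have : continuous (fun e => bx e x).
    by apply: bx_test => // [?|] //; exact: cst_cont.
  by move/continuous_closedP; apply; have [] := peval_embedding W.
have : continuous (fun e => bphi e x) by apply: bphi_test => // ?.
by move/continuous_closedP; apply; exact: pdual_closed.
Qed.

Let kG : kspace goodset.
Proof. by apply: closed_kspace => //; exact: goodset_closed. Qed.

Lemma good_ex (e : goodset) (x : V) :
  {w : W | dual_eval (pdual W) w = bx (set_val e) x}.
Proof.
by apply: cid; have [+ _] := set_valP e; move=> /(_ x)[w _ <-]; exists w.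
Qed.

Definition rfun (e : goodset) (x : V) : W := sval (good_ex e x).

Lemma rfunE e x : dual_eval (pdual W) (rfun e x) = bx (set_val e) x.
Proof. exact: (svalP (good_ex e x)). Qed.

Lemma rfunP e x (phi : W') :
  ndual_fun (subsp_val phi) (rfun e x) = ndual_fun (set_val e) (del x phi).
Proof.
by have := congr1 (fun h => ndual_fun h phi) (rfunE e x).
Qed.

Lemma rfun_test (C : topologicalType) (p : C -> goodset) (q : C -> V) :
  kspace C -> continuous p -> continuous q ->
  continuous (fun c => rfun (p c) (q c)).
Proof.
move=> kC cp cq; apply: (cemb_to (peval_embedding W)).
rewrite (_ : _ \o _ = fun c => bx (set_val (p c)) (q c)); last first.
  by apply/funext => c /=; rewrite rfunE.
by apply: bx_test => //; exact: (cont_comp cp (@set_type_cont _ goodset)).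
Qed.

Lemma rfun_cont e : continuous (rfun e).
Proof.
apply: rfun_test; [exact: paired_kspace|exact: cst_cont|by move=> ?].
Qed.

Lemma rfun_lin e : linear (rfun e).
Proof.
move=> a x y; apply: paired_sep => phi Wphi.
have E z := rfunP e z (mksub Wphi).
rewrite ndual_linear; rewrite !(E : forall z, phi (rfun e z) = _).
by rewrite (del_linl (mksub Wphi)) ndual_linear.
Qed.

Lemma rfun_dual e (phi : ndual W) : sm_set (pdual W) phi ->
  in_dual (fun x => phi (rfun e x)).
Proof.
move=> Wphi; exists (bphi (set_val e) (mksub Wphi)).
  by have [_] := set_valP e; apply.
by move=> x; exact: esym (rfunP e x (mksub Wphi)).
Qed.

Definition rhom (e : goodset) : H :=
  mkihom (@rfun_cont e) (@rfun_lin e) (@rfun_dual e).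

Lemma rhom_cont : continuous rhom.
Proof.
apply: ihom_to => // C p q cC hC cp cq.
by apply: rfun_test => //; exact: compact_kspace.
Qed.

Local Notation j := (dual_eval ihom_dual).

Lemma dual_eval_rhom e : j (rhom e) = set_val e.
Proof.
apply: ndual_ext => psi; rewrite dual_evalE.
pose P : set (ndual H) := @subsp_val _ _ ihom_dual @`
  [set psi : D | ndual_fun (subsp_val psi) (rhom e) = ndual_fun (set_val e) psi].
have P0 : P 0.
  exists 0 => //=; rewrite ndual0.
  by rewrite (_ : subsp_val 0 = 0).
have Plin a f g : P f -> P g -> P (a *: f + g).
  move=> [f' /= Hf <-] [g' /= Hg <-]; exists (a *: f' + g') => //=.
  rewrite ndual_linear -Hf -Hg.
  by rewrite subsp_val_linear ndualD ndualZ.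
have cP : closed P.
  apply: set_type_closed; first exact: ihom_dual_closed.
  apply: (@closed_eqset_T2 D K^o
    (fun psi => ndual_fun (subsp_val psi) (rhom e)) (ndual_fun (set_val e))).
  - exact: Ko_hausdorff.
  - exact: (cont_comp (@subsp_cont _ _ ihom_dual) (@ndual_pt _ _ (rhom e))).
  - exact: ndual_cont.
have AP : [set psi : ndual (ihom V W) | exists x : V,
    exists2 phi : ndual W, sm_set (pdual W) phi &
      forall f : ihom V W, psi f = phi (f x)] `<=` P.
  move=> _psi [x [phi Wphi Hpsi]]; exists (del x (mksub Wphi)) => /=.
    exact: (rfunP e x (mksub Wphi)).
  by apply: ndual_ext => f; rewrite Hpsi.
have [psi' /= + /subsp_inj <-//] := subsp_valP psi (Submod P0 Plin) cP AP.
Qed.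

Lemma good_eval (f : ihom V W) : goodset (j f).
Proof.
split=> [x|phi].
  exists (f x) => //; exact: ndual_ext.
have [psi Vpsi E] := ihom_dualP f (subsp_valP phi).
rewrite (_ : bphi _ _ = psi) //; apply: ndual_ext => x; exact: esym.
Qed.

Definition jgood f : goodset := exist _ (j f) (mem_set (good_eval f)).

Lemma rhomK f : rhom (jgood f) = f.
Proof.
apply: ihom_ext => x; apply: paired_sep => phi Wphi.
exact: (rfunP (jgood f) x (mksub Wphi)).
Qed.

Lemma ihom_eval_cont : continuous j.
Proof.
apply: ndual_to => // C p q cC hC cp cq.
apply: (@ndual_eval _ _ _ (fun c => subsp_val (q c)) p) => //.
  exact: compact_kspace.
exact: (cont_comp cq (@subsp_cont _ _ ihom_dual)).
Qed.

Lemma ihom_embedding : closed_embedding j.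
Proof.
split.
- move=> f g fg; rewrite -(rhomK f) -(rhomK g); congr rhom.
  exact: val_inj.
- move=> U; split=> [oU|[O oO ->]]; last first.
    by move/continuousP : ihom_eval_cont; apply.
  have /continuousP/(_ _ oU) [O oO OU] := rhom_cont.
  exists O => //; rewrite -[LHS](_ : jgood @^-1` (rhom @^-1` U) = _); last first.
    by apply/seteqP; split=> f; rewrite /preimage /= rhomK.
  by rewrite -OU.
- rewrite (_ : range j = goodset); first exact: goodset_closed.
  apply/seteqP; split=> [_ [f _ <-]|e Ge]; first exact: good_eval.
  exists (rhom (exist _ e (mem_set Ge))) => //.
  by rewrite dual_eval_rhom.
Qed.

Definition ihomL : pairedHK K :=
  PairedHK ihom_linear_hk ihom_dual_closed ihom_embedding.

End ihom_paired.

Variant real_or_complex (R : realType) : numFieldType -> Prop :=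
| scalars_real : real_or_complex R R
| scalars_complex : real_or_complex R R[i].

Section scalars.
Variables (R : realType) (K : numFieldType).
Hypothesis hK : real_or_complex R K.

Lemma scalars_archi (e : K) : 0 < e -> exists n : nat, n.+1%:R^-1 < e.
Proof.
have archiR (x : R) : 0 < x -> exists n : nat, n.+1%:R^-1 < x.
  move=> x0; exists (Num.bound x^-1).
  rewrite invf_plt ?posrE//.
  by rewrite (lt_trans (archi_boundP _)) ?invr_ge0 ?(ltW x0)// ltr_nat.
case: hK e => [|[a b]]; first exact: archiR.
rewrite ltcE /= => /andP[/eqP -> /archiR[n na]]; exists n.
have -> : (n.+1%:R : R[i])^-1 = ((n.+1%:R)^-1)%:C%C by rewrite fmorphV rmorph_nat.
by rewrite ltcE /= eqxx.
Qed.

Lemma Ko_kspace : kspace K^o.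
Proof.
suff H (U : set K^o) : @kopen K^o U -> open U.
  move=> Y f tf; apply/continuousP => O oO; apply: H => C p cC hC cp.
  by have /continuousP/(_ _ oO) := tf C p cC hC cp.
move=> kU; rewrite openE => x Ux; apply: contrapT => nU.
have y_ex (n : nat) : {y : K^o | `|x - y| < n.+1%:R^-1 & ~ U y}.
  apply: cid2; apply: contrapT => Hn; apply: nU.
  apply/nbhs_ballP; exists (n.+1%:R^-1) => /=; first by rewrite invr_gt0.
  move=> y; rewrite -ball_normE /= => xy.
  by apply: contrapT => nUy; apply: Hn; exists y.
pose y n : K^o := s2val (y_ex n).
pose p (o : one_point_compactification nat) : K^o := if o is Some n then y n else x.
have cp : continuous p.
  move=> [n|].
    move=> V /nbhs_singleton /= Vy; rewrite /nbhs /= /one_point_nbhs /=.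
    rewrite /fmap /= nbhs_principalE; exact/principal_filterP.
  move=> V /nbhs_ballP[e /= e0 eV].
  have [N Ne] := scalars_archi e0.
  exists `I_N.
    split; first by apply: finite_compact; exact: finite_II.
    by rewrite -[`I_N]setCK; apply: open_closedC; exact: discrete_open.
  move=> _ [[n /= nN <-]|->] /=; last by apply: eV; exact: ballxx.
  apply: eV; rewrite -ball_normE /= /y; case: (y_ex n) => z /= xz _.
  apply: (lt_trans xz); apply: le_lt_trans Ne.
  rewrite lef_pV2 ?posrE// ler_nat ltnS leqNgt; exact/negP.
have hnat : hausdorff_space nat by exact: discrete_hausdorff.
have lnat : locally_compact [set: nat].
  move=> n _; exists [set n].
    by rewrite withinET nbhs_principalE; apply/principal_filterP.
  split; first exact: compact_set1.
  by rewrite -[[set n]]setCK; apply: open_closedC; exact: discrete_open.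
have := kU _ p (@one_point_compactification_compact nat)
  (one_point_compactification_hausdorff lnat hnat) cp.
rewrite openE => /(_ None) [//|/= C [cC _] CU].
have [n nC] : exists n, ~ C n.
  apply: contrapT => hC.
  have CT : C = setT
    by apply/seteqP; split=> // n _; apply: contrapT => nC; apply: hC; exists n.
  have := cC \oo _; rewrite CT => /(_ _ filterT)[n [_ cn]].
  move: cn => /(_ [set m | (n < m)%N] [set n]).
  case; [by exists n.+1|by rewrite nbhs_principalE; exact/principal_filterP|].
  by move=> m [/= nm mn]; move: nm; rewrite mn ltnn.
have := CU (Some n) (or_introl _); rewrite /= /y.
by case: (y_ex n) => z _ /= nUz H; apply: nUz; apply: H; exists n.
Qed.

End scalars.

Definition submodT (K : numFieldType) (E : lmodType K) : submod E :=
  @Submod K E setT I (fun _ _ _ _ _ => I).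

Section natural_pairing.
Variables (K : numFieldType) (V : preTopologicalLmodType K).

(* V with V^* its whole natural dual is a paired linear hk-space; the whole dual
   is closed in itself. *)
Definition naturally_paired : Prop :=
  linear_hk V /\ closed_embedding (dual_eval (submodT (ndual V))).

Definition natural_pairing (h : naturally_paired) : pairedHK K :=
  @PairedHK K V (submodT (ndual V)) h.1 closedT h.2.

End natural_pairing.

Section scalar_object.
Variables (R : realType) (K : numFieldType).
Hypothesis hK : real_or_complex R K.

Lemma Ko_linear_hk : linear_hk K^o.
Proof.
split; first by apply: hausdorff_hk; [exact: Ko_kspace hK|exact: Ko_hausdorff].
  exact: (cont_comp (@kify_cont_id (K^o * K^o)%type) (@add_continuous K^o)).
exact: (cont_comp (@kify_cont_id (K^o * K^o)%type) (@scale_continuous K K^o)).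
Qed.

Local Notation D := (submodT (ndual K^o)).

Let idK : subsp D :=
  @mksub _ _ D (@mkndual K K^o id (fun x U h => h) (fun _ _ _ => erefl)) I.

Lemma Ko_embedding : closed_embedding (dual_eval D).
Proof.
pose j := dual_eval D; pose r (e : ndual (subsp D)) : K^o := e idK.
have rj : cancel j r by [].
have jr : cancel r j.
  move=> e; apply: ndual_ext => phi; rewrite dual_evalE /r.
  have E (t : K^o) : ndual_fun (subsp_val phi) t = t *: ndual_fun (subsp_val phi) 1.
    have := ndual_linear (subsp_val phi) t 1 0.
    by rewrite addr0 ndual0 addr0 => <-; rewrite /GRing.scale /= mulr1.
  set c := ndual_fun (subsp_val phi) 1 in E *.
  have Ephi : phi = c *: idK + 0.
    apply: subsp_inj; apply: ndual_ext => t.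
    rewrite E (_ : ndual_fun (subsp_val _) t = c *: t + 0) // addr0.
    by rewrite /GRing.scale /= mulrC.
  rewrite [in RHS]Ephi ndual_linear ndual0 addr0 E.
  by rewrite /GRing.scale /= mulrC.
have cr : continuous r by exact: ndual_pt.
have cj : continuous j.
  apply: ndual_to; [exact: Ko_kspace hK| |].
    by apply: subsp_hausdorff; exact: ndual_hausdorff.
  move=> C p q cC hC cp cq.
  apply: (@ndual_eval _ _ _ (fun c => subsp_val (q c)) p) => //.
    exact: compact_kspace.
  exact: (cont_comp cq (@subsp_cont _ _ D)).
split; first exact: can_inj rj.
  move=> U; split=> [oU|[O oO ->]]; last by move/continuousP : cj; apply.
  exists (r @^-1` U); first by move/continuousP : cr; apply.
  by apply/seteqP; split=> x; rewrite /preimage /= -/j rj.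
rewrite (_ : range _ = setT); first exact: closedT.
by apply/seteqP; split=> // e _; exists (r e) => //; exact: jr.
Qed.

Definition scalL : pairedHK K := natural_pairing (conj Ko_linear_hk Ko_embedding).

(* The dual V^* is the internal hom [V, K], where K^* is the
   whole natural dual of K. *)
Definition dualL (V : pairedHK K) : pairedHK K := ihomL V scalL.

Definition tensorL (V W : pairedHK K) : pairedHK K := dualL (ihomL V (dualL W)).

End scalar_object.

Section precomposition.

Lemma precomp_cont (X X' Y : topologicalType) (f : X -> X')
  (H : forall g : cmap X' Y, continuous (g \o f)) : continuous f ->
  continuous (fun g : cmap X' Y => mkcmap (H g)).
Proof.
move=> cf; apply: kspace_to_kify; first exact: cmap_kspace.
apply: (@cont_to_set (cmap X' Y) {compact-open, X -> Y}).
apply: (@cont_comp _ _ _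
  (@cmap_fun X' Y : cmap X' Y -> {compact-open, X' -> Y})
  ((fun g => g \o f) : {compact-open, X' -> Y} -> {compact-open, X -> Y})).
  exact: cmap_val_cont.
move=> g; apply/compact_open_cvgP.
  by apply: fmap_filter; exact: nbhs_filter.
move=> C O cC oO gC.
have cfC : compact (f @` C).
  by apply: continuous_compact => //; exact: continuous_subspaceT.
have := compact_open_open cfC oO; rewrite openE => /(_ g).
have : forall y, (g @` (f @` C)) y -> O y.
  by move=> _ [_ [x Cx <-] <-]; apply: gC; exists x.
move=> gO /(_ gO); apply: filterS => h hO _ [x Cx <-].
by apply: hO; exists (f x) => //; exists x.
Qed.

Variable K : numFieldType.

Record clin (V W : preTopologicalLmodType K) := Clin {
  clin_fun :> V -> W ;
  clin_cont : continuous clin_fun ;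
  clin_lin : linear clin_fun }.

Lemma clin_ext (V W : preTopologicalLmodType K) (f g : clin V W) :
  (forall x, f x = g x) -> f = g.
Proof.
case: f g => [f cf lf] [g cg lg] /= /funext fg; move: cf lf; rewrite fg => cf lf.
by congr Clin; exact: Prop_irrelevance.
Qed.

Lemma clin_id_lin (V : preTopologicalLmodType K) : linear (id : V -> V).
Proof. by []. Qed.
Definition clin_id (V : preTopologicalLmodType K) : clin V V :=
  Clin (fun x U h => h) (@clin_id_lin V).

Lemma clin_comp_cont (U V W : preTopologicalLmodType K) (g : clin V W) (f : clin U V) :
  continuous (g \o f).
Proof. exact: (cont_comp (@clin_cont _ _ f) (@clin_cont _ _ g)). Qed.
Lemma clin_comp_lin (U V W : preTopologicalLmodType K) (g : clin V W) (f : clin U V) :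
  linear (g \o f).
Proof. by move=> a x y /=; rewrite !clin_lin. Qed.
Definition clin_comp (U V W : preTopologicalLmodType K) (g : clin V W) (f : clin U V) :
  clin U W := Clin (@clin_comp_cont U V W g f) (@clin_comp_lin U V W g f).

Section transpose.
Variables (V W : preTopologicalLmodType K) (f : clin V W).

Definition trfun (phi : ndual W) : ndual V :=
  mkndual (@ndual_precomp_cont K V W f (@clin_cont _ _ f) (@clin_lin _ _ f) phi)
    (@ndual_precomp_lin K V W f (@clin_cont _ _ f) (@clin_lin _ _ f) phi).

Lemma trfun_cont : continuous trfun.
Proof.
have H (g : cmap W K^o) : continuous (g \o f).
  exact: (cont_comp (@clin_cont _ _ f) (@cmap_cont _ _ g)).
apply: (@cont_to_set (ndual W) (cmap V K^o)).
rewrite (_ : (fun phi => set_val (trfun phi)) = (fun g => mkcmap (H g)) \o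
    (@set_val (cmap W K^o) [set f : cmap W K^o | linear f])); last first.
  by apply/funext => phi; exact: cmap_inj.
apply: cont_comp; first exact: set_type_cont.
by apply: precomp_cont; exact: clin_cont.
Qed.

Lemma trfun_lin : linear trfun.
Proof. by move=> a phi psi; exact: ndual_ext. Qed.

Definition transpose : clin (ndual W) (ndual V) := Clin trfun_cont trfun_lin.

End transpose.

Section ihom_cat.
Implicit Types V W Z : pairedHK K.

Lemma ihom_id_dual V (phi : ndual V) :
  sm_set (pdual V) phi -> in_dual (fun x : V => phi x).
Proof. by move=> Vphi; exists phi. Qed.

Definition ihom_id V : ihom V V :=
  mkihom (fun x U h => h) (@clin_id_lin V) (@ihom_id_dual V).

Definition ihom_clin V W (f : ihom V W) : clin V W :=
  Clin (@ihom_cont _ _ _ f) (@ihom_linear _ _ _ f).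

Lemma ihom_comp_dual V W Z (g : ihom W Z) (f : ihom V W) (phi : ndual Z) :
  sm_set (pdual Z) phi -> in_dual (fun x => phi (g (f x))).
Proof.
move=> /(ihom_dualP g)[psi /(ihom_dualP f)[chi Vchi Hchi] Hpsi].
by exists chi => // x; rewrite Hchi Hpsi.
Qed.

Definition ihom_comp V W Z (g : ihom W Z) (f : ihom V W) : ihom V Z :=
  mkihom (@clin_comp_cont V W Z (ihom_clin g) (ihom_clin f))
    (@clin_comp_lin V W Z (ihom_clin g) (ihom_clin f)) (@ihom_comp_dual V W Z g f).

Section ihom_pre.
Variables (V W Z : pairedHK K) (f : ihom V W).

Definition ihom_pre_fun (g : ihomL W Z) : ihomL V Z := ihom_comp (g : ihom W Z) f.

Lemma ihom_pre_cont : continuous ihom_pre_fun.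
Proof.
apply: (@ihom_to _ V Z (ihomL W Z)); first exact: ihom_kspace.
move=> C p q cC hC cp cq.
apply: (@ihom_eval _ W Z C p (fun c => f (q c))) => //.
  exact: compact_kspace.
exact: (cont_comp cq (@ihom_cont _ _ _ f)).
Qed.

Lemma ihom_pre_lin : linear ihom_pre_fun.
Proof.
move=> a g h; apply: ihom_ext => x.
rewrite ihomD ihomZ.
rewrite (_ : ihom_fun (ihom_pre_fun _) x = ihom_fun (a *: g + h) (f x)) //.
by rewrite ihomD ihomZ.
Qed.

Definition ihom_pre_clin : clin (ihomL W Z) (ihomL V Z) :=
  Clin ihom_pre_cont ihom_pre_lin.

Lemma ihom_pre_dual (psi : ndual (ihomL V Z)) :
  sm_set (pdual (ihomL V Z)) psi -> in_dual (fun g => psi (ihom_pre_fun g)).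
Proof.
pose t := transpose ihom_pre_clin.
pose P : set (ndual (ihomL V Z)) := t @^-1` (sm_set (pdual (ihomL W Z))).
have P0 : P 0.
  rewrite /P /preimage /=; suff -> : trfun ihom_pre_clin 0 = 0.
    exact: (sm0 (pdual (ihomL W Z))).
  exact: ndual_ext.
have Plin a (x y : ndual (ihomL V Z)) : P x -> P y -> P (a *: x + y).
  move=> Px Py; rewrite /P /preimage /= trfun_lin.
  exact: (sm_lin a Px Py).
have cP : closed P.
  have /continuous_closedP := @clin_cont _ _ t; apply; exact: pdual_closed.
move=> /(_ (Submod P0 Plin) cP) H.
suff Ppsi : P psi by exists (t psi).
apply: H => chi [x [phi Zphi E]].
apply: sub_closed_span; exists (f x), phi => // g.
exact: (E (ihom_pre_fun g)).
Qed.

Definition ihom_pre : ihom (ihomL W Z) (ihomL V Z) :=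
  mkihom ihom_pre_cont ihom_pre_lin ihom_pre_dual.

End ihom_pre.
End ihom_cat.
End precomposition.

Section locally_convex.
Variables (R : realType) (K : numFieldType).
Implicit Types V P : preTopologicalLmodType K.

(* As in the library's tvsType, without the choice of a uniform structure.
   When K is complex, the weights in convex_set range over the l : K with
   0 <= l <= 1, which are real. *)
Definition lctvs V : Prop :=
  [/\ continuous (fun xy : V * V => xy.1 + xy.2),
      continuous (fun ax : K^o * V => ax.1 *: ax.2)
    & exists2 B : set_system V, (forall b, b \in B -> convex_set b) & basis B].

(* Cauchy for the translation-invariant uniformity determined by the topology. *)
Definition tvs_cauchy V (F : set_system V) : Prop :=
  forall U, nbhs (0 : V) U ->
    exists2 A, F A & forall x y, A x -> A y -> U (x - y).

Definition tvs_complete V : Prop :=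
  forall F : set_system V, ProperFilter F -> tvs_cauchy F ->
    exists x : V, F --> x.

Definition metrizable (X : topologicalType) : Prop :=
  exists d : X -> X -> R,
    [/\ forall x y, d x y = 0 <-> x = y,
        forall x y, d x y = d y x,
        forall x y z, d x z <= d x y + d y z
      & forall x A, nbhs x A <->
          exists2 e : R, 0 < e & [set y | d x y < e] `<=` A].

Definition frechet V : Prop := [/\ lctvs V, metrizable V & tvs_complete V].

(* X is the colimit of compact spaces C 0 -> C 1 -> ..., with injective
   transition maps s. *)
Definition hemicompact (X : topologicalType) : Prop :=
  exists (C : nat -> topologicalType) (s : forall n, C n -> C n.+1)
         (i : forall n, C n -> X),
    [/\ forall n, compact [set: C n] /\ hausdorff_space (C n),
        forall n, continuous (s n) /\ injective (s n),
        forall n, continuous (i n),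
        forall n c, i n.+1 (s n c) = i n c
      & forall (Y : topologicalType) (f : forall n, C n -> Y),
          (forall n, continuous (f n)) ->
          (forall n c, f n.+1 (s n c) = f n c) ->
          exists! g : X -> Y, continuous g /\ forall n c, g (i n c) = f n c].

Definition brauner V : Prop :=
  [/\ linear_hk V, hemicompact V, lctvs V & tvs_complete V].

(* (P, j) is the Hausdorff completion of V, which is determined up to a unique
   isomorphism compatible with j. *)
Definition completion V P (j : V -> P) : Prop :=
  [/\ lctvs P /\ hausdorff_space P /\ tvs_complete P,
      linear j,
      forall U, open U <-> exists2 O, open O & U = j @^-1` O
    & closure (range j) = setT].

End locally_convex.

Section tensor.
Variables (K : numFieldType) (V W : preTopologicalLmodType K).

Definition bilinear_map (Z : lmodType K) (b : V -> W -> Z) : Prop :=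
  (forall y, linear (b ^~ y)) /\ (forall x, linear (b x)).

(* A sequence s of pairs stands for the formal sum of the x (x) y, (x, y) in s;
   it is sent by b to tsum b s. *)
Definition tsum (Z : lmodType K) (b : V -> W -> Z) (s : seq (V * W)) : Z :=
  \sum_(u <- s) b u.1 u.2.

(* Two formal sums agree in the algebraic tensor product when all bilinear maps
   agree on them; tens_universal below is the usual universal property. *)
Definition tens_eq (s t : seq (V * W)) : bool :=
  `[< forall (Z : lmodType K) (b : V -> W -> Z), bilinear_map b ->
        tsum b s = tsum b t >].

Lemma tens_eq_refl : reflexive tens_eq.
Proof. by move=> s; apply/asboolP. Qed.
Lemma tens_eq_sym : symmetric tens_eq.
Proof.
by move=> s t; apply/asboolP/asboolP => H Z b hb; rewrite H.
Qed.
Lemma tens_eq_trans : transitive tens_eq.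
Proof.
move=> t s u /asboolP H1 /asboolP H2; apply/asboolP => Z b hb.
by rewrite H1// H2.
Qed.

Canonical tens_equiv := EquivRel tens_eq tens_eq_refl tens_eq_sym tens_eq_trans.

Definition ptensor : Type := {eq_quot tens_equiv}.

HB.instance Definition _ := Choice.on ptensor.

Definition tclass (s : seq (V * W)) : ptensor := \pi_({eq_quot tens_equiv}) s.
Definition trepr (z : ptensor) : seq (V * W) := repr (z : {eq_quot tens_equiv}).
Definition tlift (Z : lmodType K) (b : V -> W -> Z) (z : ptensor) : Z :=
  tsum b (trepr z).

Lemma tliftE (Z : lmodType K) (b : V -> W -> Z) s :
  bilinear_map b -> tlift b (tclass s) = tsum b s.
Proof.
move=> hb; have /eqmodP/asboolP H : trepr (tclass s) = s %[mod {eq_quot tens_equiv}].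
  exact: reprK.
exact: H.
Qed.

Lemma tens_ext (x y : ptensor) :
  (forall (Z : lmodType K) (b : V -> W -> Z), bilinear_map b ->
     tlift b x = tlift b y) -> x = y.
Proof.
move=> H; rewrite -[x]reprK -[y]reprK; apply/eqmodP/asboolP => Z b hb.
exact: H.
Qed.

Definition tzero : ptensor := tclass [::].
Definition topp (x : ptensor) := tclass [seq (- u.1, u.2) | u <- trepr x].
Definition tadd (x y : ptensor) := tclass (trepr x ++ trepr y).
Definition tscale (a : K) (x : ptensor) :=
  tclass [seq (a *: u.1, u.2) | u <- trepr x].

Section lift.
Variables (Z : lmodType K) (b : V -> W -> Z).
Hypothesis hb : bilinear_map b.

Lemma bilZl a x y : b (a *: x) y = a *: b x y.
Proof.
have [H _] := hb.
have b0 : b 0 y = 0 by have := H y (-1) 0 0; rewrite scaler0 addr0 scaleN1r addNr.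
by have := H y a x 0; rewrite addr0 b0 addr0.
Qed.

Lemma tlift0 : tlift b tzero = 0.
Proof. by rewrite tliftE// /tsum big_nil. Qed.
Lemma tliftZ a x : tlift b (tscale a x) = a *: tlift b x.
Proof.
rewrite tliftE// /tsum big_map scaler_sumr; apply: eq_bigr => u _.
by rewrite /= bilZl.
Qed.
Lemma tliftN x : tlift b (topp x) = - tlift b x.
Proof.
rewrite tliftE// /tsum big_map -sumrN; apply: eq_bigr => u _.
by rewrite /= -scaleN1r bilZl scaleN1r.
Qed.
Lemma tliftD x y : tlift b (tadd x y) = tlift b x + tlift b y.
Proof. by rewrite tliftE// /tsum big_cat. Qed.
End lift.

Let taddA : associative tadd.
Proof. by move=> x y z; apply: tens_ext => Z b hb; rewrite !tliftD// addrA. Qed.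
Let taddC : commutative tadd.
Proof. by move=> x y; apply: tens_ext => Z b hb; rewrite !tliftD// addrC. Qed.
Let tadd0 : left_id tzero tadd.
Proof. by move=> x; apply: tens_ext => Z b hb; rewrite !tliftD// tlift0// add0r. Qed.
Let taddN : left_inverse tzero topp tadd.
Proof.
by move=> x; apply: tens_ext => Z b hb; rewrite !tliftD// tlift0// tliftN// addNr.
Qed.
HB.instance Definition _ := GRing.isZmodule.Build ptensor taddA taddC tadd0 taddN.

Let tscaleA a c x : tscale a (tscale c x) = tscale (a * c) x.
Proof. by apply: tens_ext => Z b hb; rewrite !tliftZ// scalerA. Qed.
Let tscale1 : left_id 1 tscale.
Proof. by move=> x; apply: tens_ext => Z b hb; rewrite tliftZ// scale1r. Qed.
Let tscaleDr : right_distributive tscale +%R.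
Proof.
by move=> a x y; apply: tens_ext => Z b hb;
  rewrite !(tliftZ, tliftD)// scalerDr.
Qed.
Let tscaleDl x a c : tscale (a + c) x = tscale a x + tscale c x.
Proof.
by apply: tens_ext => Z b hb; rewrite !(tliftZ, tliftD)// scalerDl.
Qed.
HB.instance Definition _ := GRing.Zmodule_isLmodule.Build K ptensor
  tscaleA tscale1 tscaleDr tscaleDl.

Lemma tlift_lin (Z : lmodType K) (b : V -> W -> Z) :
  bilinear_map b -> linear (tlift b).
Proof. by move=> hb a x y; rewrite tliftD// tliftZ. Qed.

Definition tens (x : V) (y : W) : ptensor := tclass [:: (x, y)].

Lemma tclassE s : tclass s = \sum_(u <- s) tens u.1 u.2.
Proof.
elim: s => [|u s IH]; first by rewrite big_nil.
rewrite big_cons -IH; apply: tens_ext => Z b hb.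
rewrite -[tens _ _ + _]/(tadd (tens u.1 u.2) (tclass s)) tliftD//.
by rewrite !tliftE// /tsum big_cons big_seq1.
Qed.

Lemma tens_bilinear : bilinear_map tens.
Proof.
split=> [y a x x'|x a y y']; apply: tens_ext => Z b hb;
  rewrite tlift_lin// !tliftE// /tsum !big_seq1 /=; have [h1 h2] := hb.
  exact: h1.
exact: h2.
Qed.

Lemma tens_universal (Z : lmodType K) (b : V -> W -> Z) : bilinear_map b ->
  exists! f : ptensor -> Z, linear f /\ forall x y, f (tens x y) = b x y.
Proof.
move=> hb; exists (tlift b); split.
  by split=> [|x y]; [exact: tlift_lin|rewrite tliftE// /tsum big_seq1].
move=> f [lf fE]; apply/funext => z.
rewrite -[z in RHS](reprK (z : {eq_quot tens_equiv})) -/(tclass _) tclassE /tlift.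
have f0 : f 0 = 0 by have := lf (-1) 0 0; rewrite scaler0 addr0 scaleN1r addNr.
rewrite -/(trepr z); elim: (trepr z) => [|u s IH].
  by rewrite /tsum !big_nil f0.
rewrite /tsum !big_cons -[X in f (X + _)]scale1r lf scale1r fE; congr (_ + _).
exact: IH.
Qed.

Definition cseminorm (E : preTopologicalLmodType K) (p : E -> K^o) : Prop :=
  [/\ forall x, 0 <= p x,
      forall x y, p (x + y) <= p x + p y,
      forall a x, p (a *: x) = `|a| * p x
    & continuous p].

(* The projective topology on the algebraic tensor product, generated by the
   seminorms (p (x) q)(z) = inf (sum_i p(x_i) q(y_i)), the infimum being over
   all z = sum_i x_i (x) y_i, for p and q continuous seminorms. The infimum is
   < e exactly when some representation has its sum < e, and a finite family
   of such seminorms is dominated by a single one. *)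
Definition popen (U : set ptensor) : Prop :=
  forall z, U z -> exists (p : V -> K^o) (q : W -> K^o) (e : K),
    [/\ cseminorm p, cseminorm q, 0 < e
      & forall s : seq (V * W),
          \sum_(u <- s) p u.1 * q u.2 < e -> U (z + tclass s)].

Let cseminorm0 (E : preTopologicalLmodType K) : cseminorm (fun _ : E => 0 : K^o).
Proof.
by split=> [x|x y|a x|]; rewrite ?addr0 ?mulr0//; exact: cst_cont.
Qed.

Let popenT : popen setT.
Proof.
move=> z _; exists (fun=> 0), (fun=> 0), 1; split=> //.
Qed.

Let cseminormD (E : preTopologicalLmodType K) (p q : E -> K^o) :
  cseminorm p -> cseminorm q -> cseminorm (fun x => p x + q x : K^o).
Proof.
move=> [p0 pD pZ cp] [q0 qD qZ cq]; split=> [x|x y|a x|].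
- by rewrite addr_ge0.
- by rewrite addrACA lerD.
- by rewrite pZ qZ mulrDr.
- exact: KoD.
Qed.

Let popenI : setI_closed popen.
Proof.
move=> A B oA oB z [/oA[p1 [q1 [e1 [hp1 hq1 e10 H1]]]]].
move=> /oB[p2 [q2 [e2 [hp2 hq2 e20 H2]]]].
exists (fun x => p1 x + p2 x), (fun x => q1 x + q2 x), ((e1^-1 + e2^-1)^-1).
have le1 : (e1^-1 + e2^-1)^-1 <= e1.
  rewrite -[leRHS]invrK lef_pV2 ?posrE ?invr_gt0// ?addr_gt0 ?invr_gt0//.
  by rewrite lerDl invr_ge0 ltW.
have le2 : (e1^-1 + e2^-1)^-1 <= e2.
  rewrite -[leRHS]invrK lef_pV2 ?posrE ?invr_gt0// ?addr_gt0 ?invr_gt0//.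
  by rewrite lerDr invr_ge0 ltW.
split; [exact: cseminormD|exact: cseminormD|by rewrite invr_gt0 addr_gt0// invr_gt0|].
move=> s hs.
have [p10 _ _ _] := hp1; have [p20 _ _ _] := hp2.
have [q10 _ _ _] := hq1; have [q20 _ _ _] := hq2.
split; [apply: H1|apply: H2].
  apply: le_lt_trans (lt_le_trans hs le1); apply: ler_sum => u _.
  by apply: ler_pM => //; rewrite lerDl.
apply: le_lt_trans (lt_le_trans hs le2); apply: ler_sum => u _.
by apply: ler_pM => //; rewrite lerDr.
Qed.

Let popen_bigU (I : Type) (f : I -> set ptensor) :
  (forall i, popen (f i)) -> popen (\bigcup_i f i).
Proof.
move=> of_ z [i _ fiz]; have [p [q [e [hp hq e0 H]]]] := of_ i z fiz.
exists p, q, e; split=> // s hs; exists i => //; exact: H.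
Qed.

HB.instance Definition _ :=
  isOpenTopological.Build ptensor popenT popenI popen_bigU.

End tensor.

Record category := Category {
  obj : Type ;
  arr : obj -> obj -> Type ;
  idarr : forall A, arr A A ;
  comparr : forall A B C, arr B C -> arr A B -> arr A C ;
  comparr1l : forall A B (f : arr A B), comparr (idarr B) f = f ;
  comparr1r : forall A B (f : arr A B), comparr f (idarr A) = f ;
  comparrA : forall A B C D (h : arr C D) (g : arr B C) (f : arr A B),
    comparr h (comparr g f) = comparr (comparr h g) f }.

Definition opcat (C : category) : category :=
  @Category (obj C) (fun A B => arr B A) (@idarr C)
    (fun A B D g f => comparr f g)
    (fun A B f => comparr1r f) (fun A B f => comparr1l f)
    (fun A B D E h g f => esym (comparrA f g h)).

Record functor (C D : category) := Functor {
  fobj :> obj C -> obj D ;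
  farr : forall A B, arr A B -> arr (fobj A) (fobj B) ;
  farr_id : forall A, farr (idarr A) = idarr (fobj A) ;
  farr_comp : forall A B E (g : arr B E) (f : arr A B),
    farr (comparr g f) = comparr (farr g) (farr f) }.

Definition functor_id (C : category) : functor C C :=
  @Functor C C id (fun _ _ f => f) (fun _ => erefl) (fun _ _ _ _ _ => erefl).

Section functor_ops.
Variables C D E : category.

Lemma functor_comp_id (G : functor D E) (F : functor C D) A :
  farr G (farr F (idarr A)) = idarr (G (F A)).
Proof. by rewrite !farr_id. Qed.
Lemma functor_comp_comp (G : functor D E) (F : functor C D) A B B'
  (g : arr B B') (f : arr A B) :
  farr G (farr F (comparr g f)) = comparr (farr G (farr F g)) (farr G (farr F f)).
Proof. by rewrite !farr_comp. Qed.
Definition functor_comp (G : functor D E) (F : functor C D) : functor C E :=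
  @Functor C E (fun A => G (F A)) (fun A B f => farr G (farr F f))
    (functor_comp_id G F) (functor_comp_comp G F).

Definition functor_op (F : functor C D) : functor (opcat C) (opcat D) :=
  @Functor (opcat C) (opcat D) F (fun A B f => farr F f)
    (fun A => farr_id F A) (fun A B B' g f => farr_comp F f g).

(* A contravariant functor, seen with the opposite category as target. *)
Definition functor_transpose (F : functor (opcat C) D) : functor C (opcat D) :=
  @Functor C (opcat D) F (fun A B f => farr F (f : @arr (opcat C) B A))
    (fun A => farr_id F A) (fun A B B' g f => @farr_comp _ _ F _ _ _ f g).

End functor_ops.

Definition fully_faithful (C D : category) (F : functor C D) : Prop :=
  forall A B, bijective (@farr C D F A B).

Definition is_iso (C : category) (A B : obj C) (f : arr A B) : Prop :=
  exists g : arr B A, comparr g f = idarr A /\ comparr f g = idarr B.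

Record nat_iso (C D : category) (F G : functor C D) := NatIso {
  nt :> forall A, arr (F A) (G A) ;
  nt_natural : forall A B (f : arr A B),
    comparr (nt B) (farr F f) = comparr (farr G f) (nt A) ;
  nt_iso : forall A, is_iso (nt A) }.

Section categories.
Variables (R : realType) (K : numFieldType).
Hypothesis hK : real_or_complex R K.

Definition tvs_cat (P : preTopologicalLmodType K -> Prop) : category.
refine (@Category {V : preTopologicalLmodType K | P V}
  (fun V W => clin (sval V) (sval W)) (fun V => clin_id (sval V))
  (fun U V W g f => clin_comp g f) _ _ _).
- by move=> V W f; apply: clin_ext.
- by move=> V W f; apply: clin_ext.
- by move=> V W U X h g f; apply: clin_ext.
Defined.

Definition Lcat : category.
refine (@Category (pairedHK K) (fun V W => ihom V W) (@ihom_id K)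
  (fun U V W g f => ihom_comp g f) _ _ _).
- by move=> V W f; apply: ihom_ext.
- by move=> V W f; apply: ihom_ext.
- by move=> V W U X h g f; apply: ihom_ext.
Defined.

Definition Fre : category := tvs_cat (@frechet R K).
Definition Bra : category := tvs_cat (@brauner K).

Definition dual_functor : functor (opcat Lcat) Lcat.
refine (@Functor (opcat Lcat) Lcat (dualL hK)
  (fun V W f => ihom_pre (scalL hK) (f : ihom W V)) _ _).
- by move=> V; apply: ihom_ext => phi; apply: ihom_ext.
- by move=> V W Z g f; apply: ihom_ext => phi; apply: ihom_ext.
Defined.

Section embedding.
Variable P : preTopologicalLmodType K -> Prop.
Hypothesis pP : forall V, P V -> naturally_paired V.

Definition embed_obj (V : obj (tvs_cat P)) : pairedHK K :=
  natural_pairing (pP (svalP V)).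

Let embed_dual (V W : obj (tvs_cat P)) (f : clin (sval V) (sval W))
  (phi : ndual (embed_obj W)) : sm_set (pdual (embed_obj W)) phi ->
  in_dual (fun x : embed_obj V => phi (f x)).
Proof. by move=> _; exists (transpose f phi). Qed.

Definition embed_arr (V W : obj (tvs_cat P)) (f : clin (sval V) (sval W)) :
  ihom (embed_obj V) (embed_obj W) :=
  @mkihom K (embed_obj V) (embed_obj W) f (@clin_cont _ _ _ f) (@clin_lin _ _ _ f)
    (embed_dual f).

Definition embed : functor (tvs_cat P) Lcat.
refine (@Functor (tvs_cat P) Lcat embed_obj embed_arr _ _).
- by move=> V; apply: ihom_ext.
- by move=> U V W g f; apply: ihom_ext.
Defined.
End embedding.

Section natural_duals.
Variables P Q : preTopologicalLmodType K -> Prop.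
Hypothesis dPQ : forall V, P V -> Q (ndual V).

Definition natural_dual_functor : functor (opcat (tvs_cat P)) (tvs_cat Q).
refine (@Functor (opcat (tvs_cat P)) (tvs_cat Q)
  (fun V => exist _ (ndual (sval V) : preTopologicalLmodType K)
     (dPQ (svalP V)))
  (fun V W f => transpose (f : clin (sval W) (sval V))) _ _).
- by move=> V; apply: clin_ext => phi; apply: ndual_ext.
- by move=> U V W g f; apply: clin_ext => phi; apply: ndual_ext.
Defined.
End natural_duals.
End categories.

(* Main.v *)
Require Import Defs.
From HB Require Import structures.
From mathcomp Require Import all_boot all_order all_algebra.
From mathcomp Require Import all_classical reals topology normedtype convex.
From mathcomp Require Import interval_inference complex ring lra.
Set Implicit Arguments.
Unset Strict Implicit.
Unset Printing Implicit Defensive.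
Import Order.TTheory GRing.Theory Num.Theory.
Import numFieldNormedType.Exports.
Local Open Scope classical_set_scope.
Local Open Scope ring_scope.

(** The whole argument rests on one compactness fact: for a continuous seminorm p on
a locally convex space V, the polar of p, that is the set of functionals dominated by p,
is compact in the dual with its k-topology (polar_compact). It is a closed subset of a
product of disks, and by equicontinuity the identity from the product topology to the
compact-open topology is continuous on it. Together with the Hahn-Banach theorem, by
which p is the supremum of the absolute values of the members of its polar, this gives
two things.

First, reflexivity. A functional e on the dual is continuous on the polar of p, hence
uniformly approximated there by points of V (bidual_approx); the approximations form
a Cauchy filter, and when V is complete its limit represents e (bidual_representable).
As the topology of V is uniform convergence on polars, which are compact, V is
homeomorphic to its bidual (bidual_inv_cont). This applies to Frechet and to Brauner
spaces alike, and makes them naturally paired (complete_naturally_paired).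

Second, the exchange of the two classes. When V is Frechet, the polars of
a fundamental sequence of seminorms are compact sets such that every compact subset of
the dual lies in one of them (polar_exhaustion), so that the dual is hemicompact. That
its k-topology is locally convex is the Banach-Dieudonne theorem (banach_dieudonne):
k-ifying the compact-open topology adds no open set. Conversely a hemicompact space has
an exhaustion by compact sets (hemicompact_exhaustion), and uniform convergence on its
members is a metrizable, hence k-space, topology on the dual (exhausted_frechet).

For the tensor product of V and W, the morphisms from V to the dual of W are the
continuous bilinear forms, and the sets of those dominated by products of seminorms
form an exhaustion of them by compact sets (bilinear_exhaustion). The tensor product in the
category of paired spaces is a closed subspace of the dual of this space of bilinear
forms, hence a Frechet space whose topology is uniform convergence on these sets. By
Hahn-Banach on the algebraic tensor product, that is exactly the projective topology
(proj_attained), and the elementary tensors span a dense subspace; hence the tensor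
product is a completion of the algebraic one (tensor_completion), and completions are
unique (completion_unique). Its paired dual is the whole natural dual, because a closed
subspace of the dual which separates the points of a reflexive space is everything
(pdual_full). *)

(** * Real and complex scalars *)

(** The embedding of the reals, the real part and the imaginary unit, with the
properties which let the real and the complex case be treated at once; the imaginary
unit is 0 when the scalars are real. *)
Definition real_structure (R : realType) (K : numFieldType)
  (inj : {rmorphism R -> K}) (re : K -> R) (i : K) : Prop :=
  [/\ forall r s : R, (inj r <= inj s) = (r <= s),
      forall z : K, exists r : R, `|z| = inj r,
      [/\ forall z w, re (z + w) = re z + re w,
          forall r z, re (inj r * z) = r * re z,
          re 1 = 1 & forall z, inj (re z) <= `|z|]
    & [/\ i = 0 \/ i * i = -1, re i = 0
        & forall z, z = inj (re z) - i * inj (re (i * z))]].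

Section scalars.
Variables (R : realType) (K : numFieldType).
Hypothesis hK : real_or_complex R K.

Lemma real_structure_exists : exists t : {rmorphism R -> K} * (K -> R) * K,
  real_structure t.1.1 t.1.2 t.2.
Proof.
case: hK => [|].
  exists (idfun : {rmorphism R -> R}, idfun, 0); split=> //=.
  - by move=> z; exists `|z|.
  - by split=> // z; exact: ler_norm.
  - by split=> // [|z]; [left|rewrite mul0r subr0].
exists (real_complex R : {rmorphism R -> R[i]}, @complex.Re R, 'i%C); split=> /=.
- by move=> r s; rewrite lecR.
- by case=> a b; eexists; rewrite normc_def.
- split=> [[a b] [c d]|r [a b]||[a b]] //=; first by rewrite mul0r subr0.
  rewrite normc_def lecR; apply: le_trans (ler_norm _) _.
  by rewrite -sqrtr_sqr ler_wsqrtr// lerDl sqr_ge0.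
- split=> [||[a b]] //; first by right; rewrite -expr2 sqr_i.
  by apply/eqP; rewrite eq_complex /=; apply/andP; split; apply/eqP; ring.
Qed.

Definition ofreal : {rmorphism R -> K} := (sval (cid real_structure_exists)).1.1.
Definition repart : K -> R := (sval (cid real_structure_exists)).1.2.
Definition imunit : K := (sval (cid real_structure_exists)).2.

Lemma real_structureP : real_structure ofreal repart imunit.
Proof. exact: svalP (cid real_structure_exists). Qed.

Lemma ofreal_le r s : (ofreal r <= ofreal s) = (r <= s).
Proof. by have [] := real_structureP. Qed.

Lemma ofreal_lt r s : (ofreal r < ofreal s) = (r < s).
Proof. by rewrite !lt_neqAle ofreal_le (inj_eq (fmorph_inj ofreal)). Qed.

Lemma abs_exists (z : K) : exists r : R, `|z| = ofreal r.
Proof. by have [_ H _ _] := real_structureP; exact: H. Qed.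

Definition absval (z : K) : R := sval (cid (abs_exists z)).
Local Notation nm := absval.

Lemma normE z : `|z| = ofreal (nm z).
Proof. exact: svalP (cid (abs_exists z)). Qed.

Lemma absval_ge0 z : 0 <= nm z.
Proof. by rewrite -ofreal_le rmorph0 -normE. Qed.

Lemma absval0 : nm 0 = 0.
Proof. by apply: (fmorph_inj ofreal); rewrite -normE normr0 rmorph0. Qed.

Lemma absval1 : nm 1 = 1.
Proof. by apply: (fmorph_inj ofreal); rewrite -normE normr1 rmorph1. Qed.

Lemma absval_eq0 z : nm z = 0 -> z = 0.
Proof. by move=> z0; apply/eqP; rewrite -normr_eq0 normE z0 rmorph0. Qed.

Lemma absvalM z w : nm (z * w) = nm z * nm w.
Proof. by apply: (fmorph_inj ofreal); rewrite rmorphM -!normE normrM. Qed.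

Lemma absvalD z w : nm (z + w) <= nm z + nm w.
Proof. by rewrite -ofreal_le rmorphD -!normE ler_normD. Qed.

Lemma absvalN z : nm (- z) = nm z.
Proof. by apply: (fmorph_inj ofreal); rewrite -!normE normrN. Qed.

Lemma absvalB z w : nm (z - w) = nm (w - z).
Proof. by rewrite -absvalN opprB. Qed.

Lemma absval_triangle z w u : nm (z - u) <= nm (z - w) + nm (w - u).
Proof. by rewrite -[z - u](_ : z - w + (w - u) = _) ?absvalD// addrA subrK. Qed.

Lemma absvalV z : nm z^-1 = (nm z)^-1.
Proof. by apply: (fmorph_inj ofreal); rewrite fmorphV -!normE normfV. Qed.

Lemma ofreal_norm r : `|ofreal r| = ofreal `|r|.
Proof.
have [r0|r0] := leP 0 r.
  by rewrite (ger0_norm r0) ger0_norm// -[0](rmorph0 ofreal) ofreal_le.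
by rewrite (ltr0_norm r0) rmorphN ltr0_norm// -[ltRHS](rmorph0 ofreal) ofreal_lt.
Qed.

Lemma absval_ofreal r : nm (ofreal r) = `|r|.
Proof. by apply: (fmorph_inj ofreal); rewrite -normE ofreal_norm. Qed.

Lemma absval_ofreal_ge0 r : 0 <= r -> nm (ofreal r) = r.
Proof. by move=> r0; rewrite absval_ofreal ger0_norm. Qed.

Lemma ge0_ofreal (e : K) : 0 <= e -> e = ofreal (nm e).
Proof. by move=> e0; rewrite -normE ger0_norm. Qed.

Lemma absval_gt0 z : z != 0 -> 0 < nm z.
Proof.
move=> z0; rewrite lt_neqAle absval_ge0 andbT eq_sym; apply: contra z0 => /eqP.
by move/absval_eq0 ->.
Qed.

Lemma repartD z w : repart (z + w) = repart z + repart w.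
Proof. by have [_ _ [H _ _ _] _] := real_structureP. Qed.

Lemma repartZ r z : repart (ofreal r * z) = r * repart z.
Proof. by have [_ _ [_ H _ _] _] := real_structureP. Qed.

Lemma repart1 : repart 1 = 1.
Proof. by have [_ _ [_ _ H _] _] := real_structureP. Qed.

Lemma repart_le z : repart z <= nm z.
Proof. by have [_ _ [_ _ _ H] _] := real_structureP; rewrite -ofreal_le -normE. Qed.

Lemma repart_ofreal r : repart (ofreal r) = r.
Proof. by rewrite -[ofreal r]mulr1 repartZ repart1 mulr1. Qed.

Lemma nbhs_Ko (z : K^o) (A : set K^o) :
  nbhs z A <-> exists2 r : R, 0 < r & forall w, nm (w - z) < r -> A w.
Proof.
split=> [/nbhs_ballP[e /= e0 eA]|[r r0 rA]].
  exists (nm e); first by apply: absval_gt0; rewrite gt_eqF.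
  move=> w wz; apply: eA; rewrite -ball_normE /= distrC normE.
  by rewrite [ltRHS]ge0_ofreal ?ltW// ofreal_lt.
apply/nbhs_ballP; exists (ofreal r) => /=.
  by rewrite -(rmorph0 ofreal) ofreal_lt.
move=> w; rewrite -ball_normE /= distrC normE ofreal_lt; exact: rA.
Qed.

Lemma cvg_Ko (T : Type) (F : set_system T) (f : T -> K^o) (z : K^o) :
  Filter F ->
  (f @ F --> z) <-> forall r : R, 0 < r -> \forall x \near F, nm (f x - z) < r.
Proof.
move=> FF; split=> [fz r r0|H A /nbhs_Ko[r r0 rA]].
  by apply: (fz [set w | nm (w - z) < r]); apply/nbhs_Ko; exists r.
by apply: filterS (H r r0) => x; exact: rA.
Qed.

Lemma continuous_Ko (T : topologicalType) (f : T -> K^o) :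
  continuous f <->
  forall x (r : R), 0 < r -> \forall y \near x, nm (f y - f x) < r.
Proof.
split=> [cf x r r0|H x].
  by have /cvg_Ko := cf x; apply.
by apply/cvg_Ko => r r0; exact: H.
Qed.

Lemma open_absval_lt (r : R) : open [set z : K^o | nm z < r].
Proof.
rewrite openE => z /= zr; apply/nbhs_Ko; exists (r - nm z).
  by rewrite subr_gt0.
move=> w wz /=; have := absval_triangle w z 0; rewrite !subr0; lra.
Qed.

Lemma closed_absval_le (r : R) : closed [set z : K^o | nm z <= r].
Proof.
rewrite -[X in closed X]setCK; apply: open_closedC.
rewrite openE => z /= /negP; rewrite -ltNge => zr; apply/nbhs_Ko; exists (nm z - r).
  by rewrite subr_gt0.
move=> w wz /=; apply/negP; rewrite -ltNge.
by have := absval_triangle z w 0; rewrite !subr0 absvalB; lra.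
Qed.

End scalars.

Section scalar_compactness.
Variables (R : realType) (K : numFieldType).
Hypothesis hK : real_or_complex R K.
Local Notation nm := (absval hK).

Lemma compact_parametrization : exists (X : topologicalType) (g : X -> K^o) ,
  continuous g /\ forall r : R, exists2 C, compact C &
    [set z : K^o | nm z <= r] `<=` g @` C.
Proof.
have nmR (z : K) (r : R) : nm z <= r <-> `|z| <= ofreal hK r.
  by rewrite (normE hK) ofreal_le.
suff H : exists (X : topologicalType) (g : X -> K^o) ,
  continuous g /\ forall r : K, exists2 C, compact C &
    [set z : K^o | `|z| <= r] `<=` g @` C.
  have [X [g [cg gC]]] := H; exists X, g; split=> // r.
  have [C cC CH] := gC (ofreal hK r); exists C => // z /nmR; exact: CH.
case: hK => [|].
  exists R, id; split=> [x //|r]; exists `[- r, r]%classic; first exact: segment_compact.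
  by move=> z /=; rewrite ler_norml => zr; exists z; rewrite //= in_itv.
exists (R * R)%type, (fun z => (z.1 +i* z.2)%C : R[i]^o); split.
  move=> [a b]; apply/cvgrPdist_lt => /= e.
  case: e => e e'; rewrite ltcE /= => /andP[/eqP -> e0].
  have e20 : 0 < e / 2 by rewrite divr_gt0.
  near=> w.
  rewrite normc_def /= ltcE /= eqxx /=.
  have aw : `|a - w.1| < e / 2.
    near: w; exists ([set x | `|a - x| < e / 2], setT) => /=.
      split; last exact: filterT.
      by apply/nbhs_ballP; exists (e / 2).
    by move=> [x y] [].
  have bw : `|b - w.2| < e / 2.
    near: w; exists (setT, [set x | `|b - x| < e / 2]) => /=.
      split; first exact: filterT.
      by apply/nbhs_ballP; exists (e / 2).
    by move=> [x y] [].
  have s0 : 0 <= Num.sqrt ((a - w.1) ^+ 2 + (b - w.2) ^+ 2) by exact: sqrtr_ge0.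
  rewrite -(@ltr_pXn2r _ 2) ?nnegrE ?(ltW e0)// sqr_sqrtr ?addr_ge0 ?sqr_ge0//.
  rewrite -(real_normK (num_real (a - w.1))) -(real_normK (num_real (b - w.2))).
  have := normr_ge0 (a - w.1); have := normr_ge0 (b - w.2); nra.
move=> [r r']; exists (`[- r, r]%classic `*` `[- r, r]%classic).
  by apply: compact_setX; exact: segment_compact.
move=> [a b] /=; rewrite normc_def lecE /= => /andP[_ sr].
have s0 : 0 <= Num.sqrt (a ^+ 2 + b ^+ 2) by exact: sqrtr_ge0.
have r0 : 0 <= r by exact: le_trans s0 sr.
have {sr} : a ^+ 2 + b ^+ 2 <= r ^+ 2.
  by rewrite -[leLHS]sqr_sqrtr ?addr_ge0 ?sqr_ge0// lerXn2r ?nnegrE.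
move=> abr; exists (a, b) => //; split; rewrite /= in_itv /= -ler_norml;
  rewrite -(@ler_pXn2r _ 2) ?nnegrE ?normr_ge0// real_normK ?num_real//;
  have := sqr_ge0 a; have := sqr_ge0 b; lra.
Unshelve. all: by end_near. Qed.

Lemma compact_disk (r : R) : compact [set z : K^o | nm z <= r].
Proof.
have [X [g [cg gC]]] := compact_parametrization.
have [C cC Cr] := gC r.
apply: (@subclosed_compact _ _ (g @` C)) => //; first exact: closed_absval_le.
by apply: continuous_compact => //; exact: continuous_subspaceT.
Qed.

(** A Cauchy filter eventually lies in a disk, which is compact. *)
Lemma scalar_complete (F : set_system K^o) : ProperFilter F ->
  (forall r : R, 0 < r ->
     exists2 A, F A & forall x y, A x -> A y -> nm (x - y) < r) ->
  exists z : K^o, F --> z.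
Proof.
move=> FF FC; have [A FA A1] := FC 1 ltr01.
have [a Aa] := filter_ex FA.
have FD : F [set z : K^o | nm z <= nm a + 1].
  apply: filterS FA => z Az /=; have := A1 _ _ Az Aa.
  have := absval_triangle hK z a 0; rewrite !subr0; lra.
have [z [_ clz]] := compact_disk FF FD.
exists z => N /(nbhs_Ko hK)[r r0 rN].
have r20 : 0 < r / 2 by rewrite divr_gt0.
have [B FB Br] := FC _ r20.
have nz : nbhs z [set w : K^o | nm (w - z) < r / 2] by apply/(nbhs_Ko hK); exists (r / 2).
have [b [Bb bz]] := clz _ _ FB nz.
apply: filterS FB => w Bw; apply: rN; have := Br _ _ Bw Bb; move: bz => /=.
have := absval_triangle hK w b z; lra.
Qed.

End scalar_compactness.

(** * Seminorms *)

Section seminorms.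
Variables (R : realType) (K : numFieldType).
Hypothesis hK : real_or_complex R K.
Local Notation nm := (absval hK).
Local Notation inj := (ofreal hK).

Definition seminorm (E : lmodType K) (p : E -> R) : Prop :=
  (forall x y, p (x + y) <= p x + p y) /\ (forall a x, p (a *: x) = nm a * p x).

Section one_seminorm.
Variables (E : lmodType K) (p : E -> R).
Hypothesis hp : seminorm p.

Lemma snD x y : p (x + y) <= p x + p y. Proof. exact: hp.1. Qed.
Lemma snZ a x : p (a *: x) = nm a * p x. Proof. exact: hp.2. Qed.
Lemma sn0 : p 0 = 0.
Proof. by rewrite -(scale0r (0 : E)) snZ absval0 mul0r. Qed.
Lemma snN x : p (- x) = p x.
Proof. by rewrite -scaleN1r snZ absvalN absval1 mul1r. Qed.
Lemma snB x y : p (x - y) = p (y - x).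
Proof. by rewrite -snN opprB. Qed.
Lemma sn_ge0 x : 0 <= p x.
Proof. have := snD x (- x); rewrite subrr sn0 snN; lra. Qed.
Lemma sn_triangle x y z : p (x - z) <= p (x - y) + p (y - z).
Proof. by rewrite -[x - z](_ : x - y + (y - z) = _) ?snD// addrA subrK. Qed.
Lemma snZr r x : 0 <= r -> p (inj r *: x) = r * p x.
Proof. by move=> r0; rewrite snZ absval_ofreal_ge0. Qed.
End one_seminorm.

Lemma seminormD (E : lmodType K) (p q : E -> R) :
  seminorm p -> seminorm q -> seminorm (fun x => p x + q x).
Proof.
move=> hp hq; split=> [x y|a x]; last by rewrite (snZ hp) (snZ hq) mulrDr.
by have := snD hp x y; have := snD hq x y; lra.
Qed.

Lemma seminormM (E : lmodType K) (p : E -> R) (c : R) :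
  0 <= c -> seminorm p -> seminorm (fun x => c * p x).
Proof.
move=> c0 hp; split=> [x y|a x]; last by rewrite (snZ hp) mulrCA.
by rewrite -mulrDr ler_wpM2l// (snD hp).
Qed.

Lemma linear_fun0 (E F : lmodType K) (f : E -> F) : linear f -> f 0 = 0.
Proof. by move=> lf; have := lf (-1) 0 0; rewrite scaler0 addr0 scaleN1r addNr. Qed.
Lemma linear_funD (E F : lmodType K) (f : E -> F) x y : linear f -> f (x + y) = f x + f y.
Proof. by move=> lf; rewrite -[x]scale1r lf !scale1r. Qed.
Lemma linear_funZ (E F : lmodType K) (f : E -> F) a x : linear f -> f (a *: x) = a *: f x.
Proof. by move=> lf; rewrite -[a *: x]addr0 lf linear_fun0 // addr0. Qed.
Lemma linear_funN (E F : lmodType K) (f : E -> F) x : linear f -> f (- x) = - f x.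
Proof. by move=> lf; rewrite -scaleN1r linear_funZ// scaleN1r. Qed.
Lemma linear_funB (E F : lmodType K) (f : E -> F) x y : linear f -> f (x - y) = f x - f y.
Proof. by move=> lf; rewrite linear_funD// linear_funN. Qed.

Lemma seminorm_linear (E : lmodType K) (f : E -> K^o) :
  linear f -> seminorm (fun x => nm (f x)).
Proof.
move=> lf; split=> [x y|a x]; first by rewrite linear_funD// absvalD.
by rewrite linear_funZ// /GRing.scale /= absvalM.
Qed.

(** If p x < q x, the multiple t x of x with t = 2 / (p x + q x) has p (t x) < 1 < q (t x). *)
Lemma unit_ball_le (E : lmodType K) (p q : E -> R) : seminorm p -> seminorm q ->
  (forall x, p x < 1 -> q x <= 1) -> forall x, q x <= p x.
Proof.
move=> hp hq H x; rewrite leNgt; apply/negP => px.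
have p0 := sn_ge0 hp x; pose t := 2 / (p x + q x).
have t0 : 0 < t by rewrite divr_gt0//; lra.
have tE : t * (p x + q x) = 2 by rewrite /t divfK// gt_eqF//; lra.
have tpq : t * p x < t * q x by rewrite ltr_pM2l.
have h1 : p (inj t *: x) < 1 by rewrite (snZr hp) ?(ltW t0)//; lra.
have := H _ h1; rewrite (snZr hq) ?(ltW t0)//; lra.
Qed.

Lemma unit_ball_polar (E : lmodType K) (p : E -> R) (f : E -> K^o) :
  seminorm p -> linear f ->
  (forall x, p x < 1 -> nm (f x) <= 1) -> forall x, nm (f x) <= p x.
Proof. by move=> hp lf; apply: unit_ball_le => //; exact: seminorm_linear. Qed.

End seminorms.

(** * The Hahn-Banach theorem *)

Section hahn_banach.
Variables (R : realType) (K : numFieldType).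
Hypothesis hK : real_or_complex R K.
Local Notation nm := (absval hK).
Local Notation inj := (ofreal hK).
Local Notation re := (repart hK).
Variables (E : lmodType K) (p : E -> R).
Hypothesis hp : seminorm hK p.

(** Partial real-linear functionals dominated by p are encoded by their graphs, so that
extension is inclusion and a chain is bounded by its union. *)
Definition real_graph (G : set (E * R)) : Prop :=
  [/\ G (0, 0),
      forall (a : R) (u v : E * R), G u -> G v -> G (inj a *: u.1 + v.1, a * u.2 + v.2)
    & forall u, G u -> u.2 <= p u.1].

(** The value at x0 is the supremum of the lower bounds u.2 - p (u.1 - x0) imposed by the
points of the graph; each of them lies below each of the upper bounds p (v.1 + x0) - v.2. *)
Lemma real_graph_extend G x0 : real_graph G -> ~ (exists r, G (x0, r)) ->
  exists G', [/\ real_graph G', G `<=` G' & exists r, G' (x0, r)].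
Proof.
move=> [G0 Gl Gp] _.
pose A : set R := [set t | exists2 u, G u & t = u.2 - p (u.1 - x0)].
have ub v : G v -> ubound A (p (v.1 + x0) - v.2).
  move=> Gv _ [u Gu ->].
  have := Gp _ (Gl 1 _ _ Gu Gv); rewrite rmorph1 scale1r mul1r /=.
  have := snD hp (u.1 - x0) (v.1 + x0); rewrite addrACA addNr addr0; lra.
have A0 : A !=set0 by exists (0 - p (0 - x0)), (0, 0).
pose c := sup A.
have cub v : G v -> c <= p (v.1 + x0) - v.2.
  by move=> Gv; apply: ge_sup => //; exact: ub.
have clb u : G u -> u.2 - p (u.1 - x0) <= c.
  move=> Gu; apply: ub_le_sup; last by exists u.
  by exists (p (0 + x0) - 0); exact: (ub (0, 0)).
have Gs a u : G u -> G (inj a *: u.1, a * u.2).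
  by move=> Gu; have := Gl a _ _ Gu G0; rewrite /= !addr0.
exists [set w | exists2 u, G u & exists t : R, w = (u.1 + inj t *: x0, u.2 + t * c)].
split; first split.
- by exists (0, 0) => //; exists 0; rewrite rmorph0 scale0r mul0r !addr0.
- move=> a _ _ [u Gu [t ->]] [v Gv [s ->]] /=.
  exists (inj a *: u.1 + v.1, a * u.2 + v.2); first exact: Gl.
  exists (a * t + s); congr pair => /=; last by ring.
  by rewrite scalerDr scalerA -rmorphM rmorphD scalerDl addrACA.
- move=> _ [u Gu [t ->]] /=.
  have [t0|t0|->] := ltrgtP t 0; last first.
  + by rewrite rmorph0 scale0r mul0r !addr0; exact: Gp.
  + have := cub _ (Gs t^-1 _ Gu); rewrite /= => H.
    have -> : u.1 + inj t *: x0 = inj t *: (inj t^-1 *: u.1 + x0).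
      by rewrite scalerDr scalerA -rmorphM mulfV ?gt_eqF// rmorph1 scale1r.
    rewrite (snZr hp _ (ltW t0)).
    have : t * (c + t^-1 * u.2) <= t * p (inj t^-1 *: u.1 + x0).
      by rewrite ler_pM2l//; lra.
    by rewrite mulrDr mulVKf ?gt_eqF//; lra.
  + have nt0 : 0 < - t by rewrite oppr_gt0.
    have := clb _ (Gs (- t)^-1 _ Gu); rewrite /= => H.
    have -> : u.1 + inj t *: x0 = inj (- t) *: (inj (- t)^-1 *: u.1 - x0).
      rewrite scalerBr scalerA -rmorphM mulfV ?gt_eqF// rmorph1 scale1r.
      by rewrite rmorphN scaleNr opprK.
    rewrite (snZr hp _ (ltW nt0)).
    have : (- t) * ((- t)^-1 * u.2 - c) <= (- t) * p (inj (- t)^-1 *: u.1 - x0).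
      by rewrite ler_pM2l//; lra.
    by rewrite mulrBr mulVKf ?gt_eqF//; lra.
- move=> u Gu; exists u => //; exists 0.
  by rewrite rmorph0 scale0r mul0r !addr0 -surjective_pairing.
- exists c; exists (0, 0) => //; exists 1.
  by rewrite rmorph1 scale1r mul1r !add0r.
Qed.

Lemma real_hahn_banach G0 : real_graph G0 ->
  exists g : E -> R, [/\ forall a x y, g (inj a *: x + y) = a * g x + g y,
    forall x, g x <= p x & forall u, G0 u -> g u.1 = u.2].
Proof.
move=> hG0.
(* The empty graph is admitted for the sake of the empty chain. *)
pose P G := G = set0 \/ (real_graph G /\ G0 `<=` G).
have [F FP Ftot|A [PA Amax]] := @Zorn_bigcup _ P.
  have [[X [FX X0]]|H] := pselect (exists X, F X /\ X !=set0); last first.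
    left; apply/seteqP; split=> // u [X FX Xu].
    by exfalso; apply: H; exists X; split=> //; exists u.
  have gX Y u : F Y -> Y u -> real_graph Y /\ G0 `<=` Y.
    by move=> FY Yu; have [Y0|//] := FP _ FY; rewrite Y0 in Yu.
  have [x Xx] := X0.
  have [[X00 _ _] G0X] := gX _ _ FX Xx.
  right; split; last by move=> u /G0X Xu; exists X.
  split; first by exists X.
    move=> a u v [Y FY Yu] [Z FZ Zv].
    have [YZ|ZY] := Ftot _ _ FY FZ.
      by exists Z => //; have [[_ H _] _] := gX _ _ FZ Zv; apply: H => //; exact: YZ.
    by exists Y => //; have [[_ H _] _] := gX _ _ FY Yu; apply: H => //; exact: ZY.
  by move=> u [Y FY Yu]; have [[_ _ H] _] := gX _ _ FY Yu; exact: H.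
have [A0|[gA G0A]] := PA.
  exfalso; apply: (Amax G0); last by right; split.
  by have [G00 _ _] := hG0; rewrite A0; split=> // /(_ _ G00).
have [A00 Al Ap] := gA.
have tot x : exists r, A (x, r).
  apply: contrapT => nx; have [G' [gG' AG' [r G'r]]] := real_graph_extend gA nx.
  apply: (Amax G'); last by right; split=> // u /G0A; exact: AG'.
  by split=> // G'A; apply: nx; exists r; exact: G'A.
have fn0 r : A (0, r) -> r = 0.
  move=> A0r.
  have H a : a * r <= 0.
    have := Ap _ (Al a _ _ A0r A00); by rewrite /= scaler0 !addr0 (sn0 hp).
  by have := H 1; have := H (-1); lra.
have fn x r s : A (x, r) -> A (x, s) -> r = s.
  move=> Ar As; have := Al (-1) _ _ Ar As; rewrite /= rmorphN rmorph1 scaleN1r addNr.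
  by move=> /fn0; lra.
exists (fun x => sval (cid (tot x))); split=> [a x y|x|[x r] /G0A Ar].
- case: (cid _) => r Ar; case: (cid _) => s As; case: (cid _) => t At /=.
  by apply: (fn _ _ _ Ar); exact: (Al a _ _ As At).
- by case: (cid _) => r Ar /=; exact: (Ap _ Ar).
- by case: (cid _) => s As /=; exact: fn As Ar.
Qed.

(** A real-linear functional g extends to the K-linear functional with real part g,
namely x |-> g x - i g (i x). *)
Theorem hahn_banach (M : submod E) (f : E -> K^o) :
  (forall a x y, sm_set M x -> sm_set M y -> f (a *: x + y) = a *: f x + f y) ->
  (forall x, sm_set M x -> nm (f x) <= p x) ->
  exists g : E -> K^o, [/\ linear g, forall x, nm (g x) <= p x
    & forall x, sm_set M x -> g x = f x].
Proof.
move=> lf fp.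
have f0 : f 0 = 0.
  by have := lf (-1) 0 0 (sm0 M) (sm0 M); rewrite scaler0 addr0 scaleN1r addNr.
pose G0 : set (E * R) := [set u | sm_set M u.1 /\ u.2 = re (f u.1)].
have hG0 : real_graph G0.
  split=> [|a [x r] [y s] [/= Mx ->] [/= My ->]|[x r] [/= Mx ->]].
  - split=> /=; first exact: sm0.
    by have := repartD hK 0 0; rewrite f0 addr0; lra.
  - by split=> /=; [exact: sm_lin|rewrite lf// repartD repartZ].
  - by apply: le_trans (fp x Mx); exact: repart_le.
have [g [gl gp gG]] := real_hahn_banach hG0.
have [_ _ _ [ii rei zE]] := real_structureP hK.
set i := imunit hK in ii rei zE.
have gD x y : g (x + y) = g x + g y.
  by have := gl 1 x y; rewrite rmorph1 scale1r mul1r.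
have g0 : g 0 = 0 by have := gD 0 0; rewrite addr0; lra.
have gZ a x : g (inj a *: x) = a * g x.
  by have := gl a x 0; rewrite g0 !addr0.
pose h x : K^o := inj (g x) - i * inj (g (i *: x)).
have hD x y : h (x + y) = h x + h y.
  by rewrite /h scalerDr !gD !rmorphD; ring.
have hZr a x : h (inj a *: x) = inj a * h x.
  rewrite /h.
  have -> : i *: (inj a *: x) = inj a *: (i *: x) by rewrite !scalerA mulrC.
  rewrite !gZ !rmorphM; ring.
have hi x : h (i *: x) = i * h x.
  case: ii => [i0|ii]; first by rewrite /h i0 scale0r g0 scale0r g0 rmorph0; ring.
  rewrite /h scalerA ii.
  have -> : g (-1 *: x) = - g x.
    by rewrite -[-1](_ : inj (-1) = _) ?gZ ?mulN1r// rmorphN rmorph1.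
  rewrite rmorphN mulrBr mulrA ii; ring.
have hZ a x : h (a *: x) = a * h x.
  have h0 : h 0 = 0 by have := hZr 0 0; rewrite scaler0 rmorph0 mul0r.
  have hN y : h (- y) = - h y.
    by apply/eqP; rewrite -subr_eq0 opprK -hD addNr h0.
  have -> : a *: x = inj (re a) *: x + - (i *: (inj (re (i * a)) *: x)).
    by rewrite {1}(zE a) scalerBl scalerA.
  rewrite hD hN hi !hZr [in RHS](zE a); ring.
have reh x : re (h x) = g x.
  rewrite /h -mulrN -rmorphN mulrC repartD repartZ rei mulr0 addr0.
  exact: repart_ofreal.
exists h; split.
- by move=> a x y; rewrite hD hZ.
(* Multiplying x by a scalar u of absolute value 1 makes h (u x) real, so that it is
   equal to g (u x). *)
- move=> x; have [->|hx0] := eqVneq (h x) 0; first by rewrite absval0 (sn_ge0 hp).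
  pose u := inj (nm (h x)) / h x.
  have nu : nm u = 1.
    by rewrite /u absvalM absvalV absval_ofreal_ge0 ?absval_ge0// mulfV// gt_eqF// absval_gt0.
  have : re (h (u *: x)) <= p (u *: x) by rewrite reh.
  by rewrite hZ (snZ hp) nu mul1r /u divfK// repart_ofreal.
- move=> x Mx; apply: contrapT => /eqP; rewrite -subr_eq0 => d0.
  pose d := h x - f x; pose y := d^-1 *: x.
  have My : sm_set M y by have := sm_lin d^-1 Mx (sm0 M); rewrite addr0.
  have fy : f y = d^-1 * f x by have := lf d^-1 x 0 Mx (sm0 M); rewrite f0 !addr0.
  have : re (h y - f y) = 0.
    have hy : g y = re (f y) by exact: (gG (y, re (f y))).
    have <- : inj (-1) * f y = - f y by rewrite rmorphN rmorph1 mulN1r.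
    by rewrite repartD repartZ reh hy; lra.
  by rewrite fy /y hZ -mulrBr -/d mulVf// repart1 => /eqP; rewrite oner_eq0.
Qed.

Corollary hahn_banach_point (x0 : E) :
  exists g : E -> K^o, [/\ linear g, forall x, nm (g x) <= p x
    & g x0 = inj (p x0)].
Proof.
have [p0|p0] := eqVneq (p x0) 0.
  exists (fun=> 0); split=> [a x y|x|]; rewrite ?p0 ?rmorph0 ?scaler0 ?addr0//.
  by rewrite absval0 (sn_ge0 hp).
have x00 : x0 != 0 by apply: contra_neq p0 => ->; rewrite (sn0 hp).
pose L : set E := [set x | exists a, x = a *: x0].
have L0 : L 0 by exists 0; rewrite scale0r.
have Ll a x y : L x -> L y -> L (a *: x + y).
  move=> [b ->] [c ->]; exists (a * b + c); by rewrite scalerDl scalerA.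
have cf_ex x : exists a : K, L x -> x = a *: x0.
  by have [[a xa]|nL] := pselect (L x); [exists a|exists 0].
pose cf x := sval (cid (cf_ex x)).
have cfE a : cf (a *: x0) = a.
  have : a *: x0 = cf (a *: x0) *: x0.
    by apply: (svalP (cid (cf_ex (a *: x0)))); exists a.
  by move/eqP; rewrite -subr_eq0 -scalerBl scaler_eq0 (negbTE x00) orbF subr_eq0 => /eqP.
have [|x [a ->]|g [lg gp gf]] := @hahn_banach (Submod L0 Ll) (fun x => cf x * inj (p x0)).
- by move=> a _ _ [b ->] [c ->]; rewrite scalerA -scalerDl !cfE /GRing.scale /=; ring.
- by rewrite cfE absvalM (snZ hp) absval_ofreal_ge0 ?(sn_ge0 hp).
exists g; split=> //; rewrite gf; last by exists 1; rewrite scale1r.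
by rewrite -[X in cf X]scale1r cfE mul1r.
Qed.

End hahn_banach.

(** * Locally convex topologies and continuous seminorms *)

Section gauge.
Variables (R : realType) (K : numFieldType).
Hypothesis hK : real_or_complex R K.
Local Notation nm := (absval hK).
Local Notation inj := (ofreal hK).
Variables (E : lmodType K) (B : set E).
Hypothesis balB : forall a x, nm a <= 1 -> B x -> B (a *: x).
Hypothesis cvxB : forall r x y, 0 <= r -> r <= 1 -> B x -> B y ->
  B (inj r *: x + inj (1 - r) *: y).
Hypothesis absB : forall x, exists2 t, 0 < t & B (inj t^-1 *: x).

Let T x : set R := [set t | 0 < t /\ B (inj t^-1 *: x)].

Definition gauge x : R := inf (T x).

Let T_has_inf x : has_inf (T x).
Proof.
split; first by have [t t0 Bt] := absB x; exists t.
by exists 0 => t [t0 _]; exact: ltW.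
Qed.

Lemma gauge_ge0 x : 0 <= gauge x.
Proof.
apply: lb_le_inf; last by move=> t [/ltW].
by have [] := T_has_inf x.
Qed.

Let gauge_le x t : T x t -> gauge x <= t.
Proof. by move=> Tt; apply: ge_inf => //; have [] := T_has_inf x. Qed.

Let T_up x s t : T x s -> s <= t -> T x t.
Proof.
move=> [s0 Bs] st; have t0 : 0 < t by exact: lt_le_trans st.
split=> //; have -> : inj t^-1 *: x = inj (s / t) *: (inj s^-1 *: x).
  by rewrite scalerA -rmorphM mulrAC mulfV ?gt_eqF// mul1r.
apply: balB => //; rewrite absval_ofreal_ge0 ?divr_ge0 ?(ltW s0) ?(ltW t0)//.
by rewrite ler_pdivrMr// mul1r.
Qed.

Let gauge_lt x t : gauge x < t -> T x t.
Proof.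
move=> /(inf_lt (proj1 (T_has_inf x))).
by case=> s Ts /ltW; exact: T_up.
Qed.

Lemma gauge_lt1 x : gauge x < 1 -> B x.
Proof. by move=> /gauge_lt[_]; rewrite invr1 rmorph1 scale1r. Qed.

Lemma gauge_le1 x : B x -> gauge x <= 1.
Proof. by move=> Bx; apply: gauge_le; split=> //; rewrite invr1 rmorph1 scale1r. Qed.

Let gaugeD x y : gauge (x + y) <= gauge x + gauge y.
Proof.
apply/ler_addgt0Pr => e e0.
have e2 : 0 < e / 2 by rewrite divr_gt0.
have [s0 Bs] : T x (gauge x + e / 2) by apply: gauge_lt; lra.
have [t0 Bt] : T y (gauge y + e / 2) by apply: gauge_lt; lra.
set s := gauge x + e / 2 in s0 Bs; set t := gauge y + e / 2 in t0 Bt.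
have -> : gauge x + gauge y + e = s + t by rewrite /s /t; field.
apply: gauge_le; have st0 : 0 < s + t by rewrite addr_gt0.
split=> //; have -> : inj (s + t)^-1 *: (x + y) =
    inj (s / (s + t)) *: (inj s^-1 *: x) + inj (1 - s / (s + t)) *: (inj t^-1 *: y).
  rewrite scalerDr !scalerA -!rmorphM; congr (inj _ *: _ + inj _ *: _).
    by rewrite mulrAC mulfV ?gt_eqF// mul1r.
  by field; rewrite !gt_eqF.
apply: cvxB => //; first by rewrite divr_ge0 ?ltW.
by rewrite ler_pdivrMr// mul1r lerDl ltW.
Qed.

Let gauge0 : gauge 0 = 0.
Proof.
apply/eqP; rewrite eq_le gauge_ge0 andbT; apply/ler_addgt0Pr => e e0; rewrite add0r.
apply: gauge_le; split=> //; rewrite scaler0; have [t _ B0] := absB 0.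
by rewrite scaler0 in B0.
Qed.

Let gaugeZ_le a x : gauge (a *: x) <= nm a * gauge x.
Proof.
have [->|a0] := eqVneq a 0; first by rewrite scale0r gauge0 absval0 mul0r.
have na := absval_gt0 hK a0.
rewrite mulrC -ler_pdivrMr//; apply/ler_addgt0Pr => e e0.
rewrite ler_pdivrMr//; have [t0 Bt] : T x (gauge x + e) by apply: gauge_lt; lra.
apply: gauge_le; split; first by rewrite mulr_gt0.
set t := gauge x + e in t0 Bt *.
have -> : inj (t * nm a)^-1 *: (a *: x) = (a / inj (nm a)) *: (inj t^-1 *: x).
  rewrite !scalerA invfM rmorphM [inj (nm a)^-1]fmorphV; congr (_ *: _).
  by ring.
apply: balB => //; rewrite absvalM absvalV absval_ofreal_ge0 ?absval_ge0// mulfV// gt_eqF//.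
Qed.

Lemma gauge_seminorm : seminorm hK gauge.
Proof.
split; first exact: gaugeD.
move=> a x; have [->|a0] := eqVneq a 0; first by rewrite scale0r gauge0 absval0 mul0r.
apply/eqP; rewrite eq_le gaugeZ_le /=.
have := gaugeZ_le a^-1 (a *: x); rewrite scalerA mulVf// scale1r absvalV.
by rewrite [_^-1 * _]mulrC ler_pdivlMr ?absval_gt0// mulrC.
Qed.

End gauge.

Section continuous_seminorms.
Variables (R : realType) (K : numFieldType).
Hypothesis hK : real_or_complex R K.
Local Notation nm := (absval hK).
Local Notation inj := (ofreal hK).
Implicit Types V : preTopologicalLmodType K.

Definition cont_seminorm V (p : V -> R) : Prop :=
  seminorm hK p /\ nbhs (0 : V) [set x | p x < 1].

Lemma lctvs_add V (Z : topologicalType) (f g : Z -> V) : lctvs V ->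
  continuous f -> continuous g -> continuous (fun z => f z + g z).
Proof.
move=> [cD _ _] cf cg z.
apply: (@continuous_comp _ _ _ (fun z => (f z, g z)) (fun xy : V * V => xy.1 + xy.2)).
  by apply: cvg_pair; [exact: cf|exact: cg].
exact: cD.
Qed.

Lemma lctvs_scale V (Z : topologicalType) (a : Z -> K^o) (f : Z -> V) : lctvs V ->
  continuous a -> continuous f -> continuous (fun z => a z *: f z).
Proof.
move=> [_ cZ _] ca cf z.
apply: (@continuous_comp _ _ _ (fun z => (a z, f z)) (fun xy : K^o * V => xy.1 *: xy.2)).
  exact: (cvg_pair (ca z) (cf z)).
exact: cZ.
Qed.

Lemma lctvs_translate V (x y : V) (A : set V) : lctvs V ->
  nbhs (x + y) A -> nbhs y [set z | A (x + z)].
Proof.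
move=> lV nA.
have c : continuous (fun z => x + z).
  by apply: lctvs_add => //; [exact: cst_cont|move=> ? ?].
exact: (c y).
Qed.

Lemma lctvs_dilate V (a : K) (x : V) (A : set V) : lctvs V ->
  nbhs (a *: x) A -> nbhs x [set z | A (a *: z)].
Proof.
move=> lV nA.
have c : continuous (fun z : V => (a : K^o) *: z).
  by apply: (@lctvs_scale V V) => //; [exact: cst_cont|move=> ? ?].
exact: (c x).
Qed.

Lemma convex_comb (V : lmodType K) (b : set V) (r : R) x y : convex_set b ->
  0 <= r -> r <= 1 -> b x -> b y -> b (inj r *: x + inj (1 - r) *: y).
Proof.
move=> cb r0 r1 bx yb.
have k0 : 0 <= inj r by rewrite -(rmorph0 inj) ofreal_le.
have k1 : inj r <= 1 by rewrite -(rmorph1 inj) ofreal_le.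
have := cb x y (Itv01 k0 k1) (mem_set bx) (mem_set yb).
by move=> /set_mem; rewrite rmorphB rmorph1.
Qed.

(** The largest balanced subset of a convex neighborhood of 0 is a neighborhood of 0,
as multiplication by scalars is continuous at (0, 0); its gauge is the seminorm. *)
Lemma lctvs_cont_seminorm V (A : set V) : lctvs V -> nbhs (0 : V) A ->
  exists2 p, cont_seminorm p & forall x, p x < 1 -> A x.
Proof.
move=> lV nA; have [_ cZ [Bs Bcvx [Bopen Bb]]] := lV.
have [b [Bsb b0] bA] := Bb 0 A nA.
have cb := Bcvx b (mem_set Bsb).
have nb : nbhs (0 : V) b by apply: open_nbhs_nbhs; split=> //; exact: Bopen.
pose B : set V := [set x | forall a, nm a <= 1 -> b (a *: x)].
have nB : nbhs (0 : V) B.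
  have := cZ (0, 0); rewrite /continuous_at /= scaler0 => /(_ _ nb).
  move=> [[P Q] [/(nbhs_Ko hK)[d d0 dP] Q0] PQ].
  have d20 : 0 < d / 2 by rewrite divr_gt0.
  have i0 : inj (d / 2) != 0 by rewrite fmorph_eq0 gt_eqF.
  have nQ : nbhs ((inj (d / 2))^-1 *: (0 : V)) Q by rewrite scaler0.
  apply: filterS (lctvs_dilate lV nQ) => x /= Qx a a1.
  have -> : a *: x = (a * inj (d / 2)) *: ((inj (d / 2))^-1 *: x).
    by rewrite scalerA mulfK.
  apply: (PQ (_, _)); split=> //=; apply: dP.
  rewrite subr0 absvalM absval_ofreal_ge0 ?ltW//.
  by have := absval_ge0 hK a; nra.
have balB a x : nm a <= 1 -> B x -> B (a *: x).
  move=> a1 Bx c c1; rewrite scalerA; apply: Bx; rewrite absvalM.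
  by have := absval_ge0 hK a; have := absval_ge0 hK c; nra.
have cvxB r x y : 0 <= r -> r <= 1 -> B x -> B y -> B (inj r *: x + inj (1 - r) *: y).
  move=> r0 r1 Bx By a a1; rewrite scalerDr !scalerA ![a * _]mulrC -!scalerA.
  by apply: convex_comb => //; [exact: Bx|exact: By].
have absB x : exists2 t, 0 < t & B (inj t^-1 *: x).
  have : continuous (fun a : K^o => a *: x).
    by apply: lctvs_scale => //; [move=> ? ?|exact: cst_cont].
  move=> /(_ 0); rewrite /continuous_at scale0r => /(_ _ nB)/(nbhs_Ko hK)[d d0 dB].
  exists (2 / d); first by rewrite divr_gt0.
  apply: dB; rewrite subr0 absval_ofreal_ge0 ?invr_ge0 ?divr_ge0 ?ltW//.
  by rewrite invf_div; lra.
have hp := gauge_seminorm balB cvxB absB.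
exists (gauge hK B); last first.
  move=> x /(gauge_lt1 balB absB)/(_ 1); rewrite absval1 scale1r => Bx.
  by apply: bA; apply: Bx.
split=> //; have i0 : inj 2 != 0 by rewrite fmorph_eq0.
have nB2 : nbhs (inj 2 *: (0 : V)) B by rewrite scaler0.
apply: filterS (lctvs_dilate lV nB2) => x /= /(gauge_le1 absB).
by rewrite (snZr hp)//; lra.
Qed.

Lemma cont_seminorm_lt V p (x : V) (r : R) : lctvs V -> cont_seminorm p -> 0 < r ->
  nbhs x [set y | p (y - x) < r].
Proof.
move=> lV [hp p1] r0.
have n1 : nbhs ((inj r)^-1 *: (0 : V)) [set x | p x < 1] by rewrite scaler0.
have n0 : nbhs (- x + x) [set x | p ((inj r)^-1 *: x) < 1].
  by rewrite addNr; exact: (lctvs_dilate lV n1).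
apply: filterS (lctvs_translate lV n0) => y /=; rewrite addrC.
rewrite (snZ hp) absvalV absval_ofreal_ge0 ?ltW// mulrC ltr_pdivrMr// mul1r.
exact.
Qed.

Lemma nbhs_cont_seminorm V (x : V) (A : set V) : lctvs V -> (nbhs x A <->
  exists2 p, cont_seminorm p & forall y, p (y - x) < 1 -> A y).
Proof.
move=> lV; split=> [nA|[p cp pA]]; last first.
  by apply: filterS (cont_seminorm_lt x lV cp ltr01) => y; exact: pA.
have n0 : nbhs (x + 0) A by rewrite addr0.
have [p cp pA] := lctvs_cont_seminorm lV (lctvs_translate lV n0).
exists p => // y /pA /=; by rewrite addrC subrK.
Qed.

Lemma cont_seminormD V (p q : V -> R) : cont_seminorm p -> cont_seminorm q -> lctvs V ->
  cont_seminorm (fun x => p x + q x).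
Proof.
move=> cp cq lV; split; first exact: seminormD cp.1 cq.1.
have h0 : 0 < 1 / 2 :> R by rewrite divr_gt0.
apply: filterS2 (cont_seminorm_lt 0 lV cp h0) (cont_seminorm_lt 0 lV cq h0) => x /=.
by rewrite subr0; lra.
Qed.

Lemma cont_seminormM V (p : V -> R) (c : R) : 0 <= c -> cont_seminorm p -> lctvs V ->
  cont_seminorm (fun x => c * p x).
Proof.
move=> c0 cp lV; split; first exact: seminormM cp.1.
have d0 : 0 < (c + 1)^-1 by rewrite invr_gt0; lra.
apply: filterS (cont_seminorm_lt 0 lV cp d0) => x /=; rewrite subr0 => H.
have : (c + 1) * p x < (c + 1) * (c + 1)^-1 by rewrite ltr_pM2l//; lra.
rewrite mulfV ?gt_eqF//; last by lra.
have := sn_ge0 cp.1 x; lra.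
Qed.

Lemma cont_seminorm_linear V (f : V -> K^o) : continuous f -> linear f ->
  cont_seminorm (fun x => nm (f x)).
Proof.
move=> cf lf; split; first exact: seminorm_linear.
have /continuous_Ko -/(_ R hK 0 1 ltr01) := cf.
by rewrite linear_fun0//; apply: filterS => x; rewrite subr0.
Qed.

Lemma dominated_continuous V (f : V -> K^o) p : lctvs V -> cont_seminorm p -> linear f ->
  (forall x, nm (f x) <= p x) -> continuous f.
Proof.
move=> lV cp lf fp; apply/(continuous_Ko hK) => x r r0.
apply: filterS (cont_seminorm_lt x lV cp r0) => y /=; apply: le_lt_trans.
by rewrite -linear_funB.
Qed.

Lemma hausdorff_seminorm_eq0 V (x : V) : lctvs V -> hausdorff_space V ->
  (forall p, cont_seminorm p -> p x = 0) -> x = 0.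
Proof.
move=> lV hV H; apply/eqP/negP => /negP x0; apply/negP : x0.
rewrite negbK; apply/eqP; apply: hV => A B /(nbhs_cont_seminorm _ _ lV)[p cp pA].
move=> /nbhs_singleton B0; exists 0; split=> //; apply: pA.
by rewrite sub0r (snN cp.1) H.
Qed.

End continuous_seminorms.

(** * Compactness of polars *)

Lemma compact_directed (X : topologicalType) (A : set X) (I : Type) (D : set I)
    (U : I -> set X) : compact A -> D !=set0 -> (forall i, D i -> open (U i)) ->
  (forall i j, D i -> D j -> exists2 k, D k & U i `|` U j `<=` U k) ->
  (forall x, A x -> exists2 i, D i & U i x) ->
  exists2 i, D i & A `<=` U i.
Proof.
move=> cA [i0 Di0] oU dU AU; apply: contrapT => H.
pose F := filter_from D (fun i => A `\` U i).
have FF : ProperFilter F.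
  apply: filter_from_proper; last first.
    move=> i Di; apply: contrapT => H'; apply: H; exists i => // x Ax.
    by apply: contrapT => Ux; apply: H'; exists x.
  apply: filter_from_filter; first by exists i0.
  move=> i j Di Dj; have [k Dk ijk] := dU i j Di Dj; exists k => // x [Ax Ux].
  by split; split=> // Ux'; apply: Ux; apply: ijk; [left|right].
have FA : F A by exists i0 => // x [].
have [x [Ax clx]] := cA F FF FA; have [i Di Ux] := AU x Ax.
have Fi : F (A `\` U i) by exists i.
by have [y [[_ nUy] Uy]] := clx _ _ Fi (open_nbhs_nbhs (conj (oU i Di) Ux)).
Qed.

Section ptw.
Variables (R : realType) (K : numFieldType).
Hypothesis hK : real_or_complex R K.
Local Notation nm := (absval hK).

Definition ptw (I : eqType) : topologicalType :=
  prod_topology (fun _ : I => (K^o : topologicalType)).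

Lemma ptw_ev (I : eqType) (i : I) : continuous (fun f : ptw I => f i : K^o).
Proof. exact: (@proj_continuous I (fun _ => (K^o : topologicalType)) i). Qed.

Lemma ptw_hausdorff (I : eqType) : hausdorff_space (ptw I).
Proof. by apply: hausdorff_product => i; exact: Ko_hausdorff. Qed.

Lemma ptw_compact (I : eqType) (r : I -> R) :
  compact [set f : ptw I | forall i, nm (f i) <= r i].
Proof.
exact: (@tychonoff I (fun _ => (K^o : topologicalType))
  (fun i => [set z : K^o | nm z <= r i]) (fun i => @compact_disk R K hK (r i))).
Qed.

Lemma ptw_closed_linear (I : eqType) (a : K) (i j k : I) :
  closed [set f : ptw I | f i = a *: (f j : K^o) + f k].
Proof.
apply: (@closed_eqset_T2 (ptw I) K^o (fun f => f i) (fun f => a *: (f j : K^o) + f k)).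
- exact: Ko_hausdorff.
- exact: ptw_ev.
- by apply: KoD; [apply: KoZ|]; exact: ptw_ev.
Qed.

End ptw.

Section polars.
Variables (R : realType) (K : numFieldType).
Hypothesis hK : real_or_complex R K.
Local Notation nm := (absval hK).
Local Notation inj := (ofreal hK).
Implicit Types V : preTopologicalLmodType K.

(** The polar of the unit ball of p, that is, the unit ball of the dual seminorm. *)
Definition polar V (p : V -> R) : set (ndual V) :=
  [set phi | forall x, nm (phi x) <= p x].

Section one_polar.
Variables (V : preTopologicalLmodType K) (p : V -> R).
Hypotheses (lV : lctvs V) (hV : hausdorff_space V) (cp : cont_seminorm hK p).

Let lin_dom : set (ptw K V) :=
  [set f | linear (f : V -> K^o) /\ forall x, nm (f x) <= p x].

Let compact_lin_dom : compact lin_dom.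
Proof.
have -> : lin_dom = [set f : ptw K V | forall x, nm (f x) <= p x] `&`
    \bigcap_(t in [set: K * V * V])
      [set f : ptw K V | f (t.1.1 *: t.1.2 + t.2) = t.1.1 *: (f t.1.2 : K^o) + f t.2].
  apply/seteqP; split=> [f [lf fp]|f [fp lf]]; split=> //.
    by move=> [[a x] y] _; exact: lf.
  by move=> a x y; exact: (lf (a, x, y)).
apply: compact_closedI; first exact: ptw_compact.
by apply: closed_bigI => t _; exact: ptw_closed_linear.
Qed.

Let from_ptw (f : lin_dom) : ndual V :=
  mkndual (dominated_continuous lV cp (proj1 (set_valP f)) (proj2 (set_valP f)))
    (proj1 (set_valP f)).

Let from_ptw_cont : continuous from_ptw.
Proof.
have cQ : compact [set: lin_dom] by exact: set_type_compact.
have hQ : hausdorff_space lin_dom by apply: set_type_hausdorff; exact: ptw_hausdorff.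
apply: ndual_to => //; first exact: compact_kspace.
move=> C f q cC hC cf cq; apply/(continuous_Ko hK) => c r r0.
have r20 : 0 < r / 2 by rewrite divr_gt0.
have n1 : \forall d \near c, p (q d - q c) < r / 2.
  by have := cq c _ (cont_seminorm_lt (q c) lV cp r20).
have n2 : \forall d \near c, nm (from_ptw (f d) (q c) - from_ptw (f c) (q c)) < r / 2.
  have : continuous (fun d => (set_val (f d) : ptw K V) (q c) : K^o).
    apply: (@cont_comp _ _ _ f (fun g : lin_dom => (set_val g : ptw K V) (q c) : K^o)) => //.
    exact: (cont_comp (@set_type_cont _ lin_dom) (@ptw_ev _ _ (q c))).
  by move/(continuous_Ko hK); apply.
apply: filterS2 n1 n2 => d pd nd.
apply: le_lt_trans (absval_triangle hK _ (from_ptw (f d) (q c)) _) _.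
have : nm (from_ptw (f d) (q d) - from_ptw (f d) (q c)) <= p (q d - q c).
  rewrite -(linear_funB (q d) (q c) (ndual_linear (from_ptw (f d)))).
  exact: (proj2 (set_valP (f d))).
lra.
Qed.

(** On an equicontinuous set of functionals pointwise convergence implies convergence
in the dual, so that the polar is a continuous image of a closed subset of a
product of disks. *)
Lemma polar_compact : compact (polar p).
Proof.
have -> : polar p = from_ptw @` setT.
  apply/seteqP; split=> [phi pphi|_ [f _ <-] x]; last exact: (proj2 (set_valP f)).
  have Hf : lin_dom (phi : V -> K^o) by split=> //; exact: ndual_linear.
  by exists (exist (fun f => f \in lin_dom) (phi : V -> K^o) (mem_set Hf)) => //;
    exact: ndual_ext.
apply: continuous_compact; first exact: continuous_subspaceT.
exact: set_type_compact.
Qed.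

Lemma polar_attained (x : V) : exists2 phi : ndual V, polar p phi & phi x = inj (p x).
Proof.
have [g [lg gp gx]] := hahn_banach_point cp.1 x.
by exists (mkndual (dominated_continuous lV cp lg gp) lg).
Qed.

Lemma polar_le x (r : R) : (forall phi, polar p phi -> nm (phi x) <= r) -> p x <= r.
Proof.
move=> H; have [phi /H + phix] := polar_attained x.
by rewrite phix absval_ofreal_ge0// (sn_ge0 cp.1).
Qed.

End one_polar.

Lemma ndual_sep V (x y : V) : lctvs V -> hausdorff_space V ->
  (forall phi : ndual V, phi x = phi y) -> x = y.
Proof.
move=> lV hV H; apply/eqP; rewrite -subr_eq0; apply/eqP.
apply: (hausdorff_seminorm_eq0 (hK := hK) lV hV) => p cp.
apply/eqP; rewrite eq_le (sn_ge0 cp.1) andbT; apply: (polar_le lV cp) => phi _.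
by rewrite (linear_funB _ _ (ndual_linear phi)) H subrr absval0.
Qed.

End polars.

(** * Reflexivity *)

Section linear_dependence.
Variables (K : numFieldType) (E : lmodType K) (I : eqType) (F : I -> E -> K^o).
Hypothesis lF : forall i, linear (F i).

(** By induction on s: if f does not already vanish on the kernel of the tail, then the
head F i does not vanish at some u of that kernel, and f - (f u / F i u) F i does vanish
there. *)
Lemma linear_dependence (s : seq I) (f : E -> K^o) : linear f ->
  (forall v, (forall i, i \in s -> F i v = 0) -> f v = 0) ->
  exists c : seq (K * I), forall v, f v = \sum_(u <- c) u.1 * F u.2 v.
Proof.
elim: s f => [|i s IH] f lf H.
  by exists [::] => v; rewrite big_nil; exact: H.
have [H'|] := pselect (forall v, (forall i, i \in s -> F i v = 0) -> f v = 0).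
  exact: IH.
move=> /existsNP[u /not_implyP[us fu]].
have Fu : F i u != 0.
  apply/eqP => Fu; apply: fu; apply: H => j.
  by rewrite inE => /predU1P[->//|]; exact: us.
pose c : K := f u / F i u.
have [|v vs|d dE] := IH (fun v => f v - c * F i v).
- move=> a x y; rewrite lf lF /GRing.scale /=; ring.
- pose w := v - (F i v / F i u) *: u.
  have : f w = 0.
    apply: H => j; rewrite inE => /predU1P[->|js]; rewrite /w linear_funB// linear_funZ//.
      by rewrite /GRing.scale /= divfK// subrr.
    by rewrite (vs _ js) (us _ js) scaler0 subrr.
  rewrite /w linear_funB// linear_funZ// /c /GRing.scale /= => <-.
  by congr (_ - _); ring.
- exists ((c, i) :: d) => v; rewrite big_cons -dE /=; ring.
Qed.

End linear_dependence.

Section reflexivity.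
Variables (R : realType) (K : numFieldType).
Hypothesis hK : real_or_complex R K.
Local Notation nm := (absval hK).
Local Notation inj := (ofreal hK).
Variable V : preTopologicalLmodType K.
Hypotheses (lV : lctvs V) (hV : hausdorff_space V).

(** By compactness of the polar of p, e is smaller than 1 on those members of the polar
which vanish at suitable finitely many points; extending the restriction of e to the annihilator
of these points, without increasing its norm, changes e by a combination of these
points. *)
Lemma bidual_approx p (e : ndual (ndual V)) : cont_seminorm hK p ->
  exists x : V, forall phi, polar hK p phi -> nm (e phi - phi x) <= 1.
Proof.
move=> cp; have hp := cp.1.
pose A : set (ndual V) := polar hK p `&` [set phi | ~ nm (e phi) < 1].
have cA : compact A.
  apply: compact_closedI; first exact: polar_compact.
  have /continuous_closedP := @ndual_cont _ _ e.
  move=> /(_ _ (open_closedC (@open_absval_lt _ _ hK 1))); exact.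
have [||||s _ sA] := compact_directed (D := setT)
    (U := fun s : seq V => [set phi : ndual V | exists2 x, x \in s & phi x != 0]) cA.
- by exists [::].
- move=> s _; rewrite openE => phi [x xs phix].
  have : open [set psi : ndual V | psi x != 0].
    have /continuousP := @ndual_pt _ _ x.
    move=> /(_ (~` [set 0])); have -> : (fun f : ndual V => f x : K^o) @^-1` (~` [set 0]) =
      [set phi : ndual V | phi x != 0].
      by apply/seteqP; split=> psi /= /eqP.
    apply; apply: closed_openC; apply: accessible_closed_set1.
    by apply: hausdorff_accessible; exact: Ko_hausdorff.
  rewrite openE => /(_ phi phix); apply: filterS => psi psix; by exists x.
- move=> s t _ _; exists (s ++ t) => // phi [] [x xs phix]; exists x => //;
    by rewrite mem_cat xs ?orbT.
- move=> phi [pphi ephi]; apply: contrapT => H; apply: ephi.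
  suff -> : phi = 0 by rewrite ndual0 absval0.
  apply: ndual_ext => x; apply/eqP/negPn/negP => phix; apply: H.
  by exists [:: x] => //; exists x; rewrite ?inE.
have small phi : polar hK p phi -> (forall x, x \in s -> phi x = 0) ->
    nm (e phi) < 1.
  move=> pphi phis; apply: contrapT => ephi.
  by have [x xs /eqP] := sA phi (conj pphi ephi); apply; exact: phis.
pose Dset : set (ndual V) :=
  [set phi | exists2 c, 0 <= c & forall x, nm (phi x) <= c * p x].
have D0 : Dset 0.
  by exists 0 => // x; rewrite mul0r absval0.
have Dl a phi psi : Dset phi -> Dset psi -> Dset (a *: phi + psi).
  move=> [c c0 hc] [d d0 hd]; exists (nm a * c + d).
    by rewrite addr_ge0// mulr_ge0// absval_ge0.
  move=> x; rewrite ndualD ndualZ; apply: le_trans (absvalD _ _ _) _.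
  rewrite mulrDl; apply: lerD => //; rewrite /GRing.scale /= absvalM -mulrA.
  by rewrite ler_wpM2l// absval_ge0.
pose D : submod (ndual V) := Submod D0 Dl.
pose B : set (subsp D) := [set phi | polar hK p (subsp_val phi)].
have balB a phi : nm a <= 1 -> B phi -> B (a *: phi).
  move=> a1 Bphi x.
  rewrite -[ndual_fun _ x]/(a * ndual_fun (subsp_val phi) x) absvalM.
  have := Bphi x; have := absval_ge0 hK a.
  have := absval_ge0 hK (ndual_fun (subsp_val phi) x); nra.
have cvxB r phi psi : 0 <= r -> r <= 1 -> B phi -> B psi ->
    B (inj r *: phi + inj (1 - r) *: psi).
  move=> r0 r1 Bphi Bpsi x.
  rewrite -[ndual_fun _ x]/(inj r * ndual_fun (subsp_val phi) x +
    inj (1 - r) * ndual_fun (subsp_val psi) x).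
  apply: le_trans (absvalD _ _ _) _; rewrite !absvalM !absval_ofreal_ge0 ?subr_ge0//.
  have := Bphi x; have := Bpsi x; nra.
have absB phi : exists2 t, 0 < t & B (inj t^-1 *: phi).
  have [c c0 hc] := subsp_valP phi; exists (c + 1); first by lra.
  have c10 : 0 < c + 1 by lra.
  move=> x; rewrite -[ndual_fun _ x]/(inj (c + 1)^-1 * ndual_fun (subsp_val phi) x) absvalM.
  rewrite absval_ofreal_ge0 ?invr_ge0 ?(ltW c10)// mulrC ler_pdivrMr//.
  have := hc x; have := sn_ge0 hp x; nra.
pose N := gauge hK B.
have hN : seminorm hK N by exact: gauge_seminorm.
pose Mset : set (subsp D) := [set phi | forall x, x \in s ->
   ndual_fun (subsp_val phi) x = 0].
have M0 : Mset 0 by [].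
have Ml a phi psi : Mset phi -> Mset psi -> Mset (a *: phi + psi).
  move=> Mphi Mpsi x xs.
  rewrite -[LHS]/(a * ndual_fun (subsp_val phi) x + ndual_fun (subsp_val psi) x).
  by rewrite Mphi// Mpsi// mulr0 addr0.
have le phi : Mset phi -> nm (e (subsp_val phi)) <= N phi.
  move=> Mphi; rewrite leNgt; apply/negP => Ne.
  have t0 : 0 < nm (e (subsp_val phi)) by exact: le_lt_trans (sn_ge0 hN _) Ne.
  set t := nm _ in t0 Ne.
  have : N (inj t^-1 *: phi) < 1.
    by rewrite (snZr hN) ?invr_ge0 ?(ltW t0)// mulrC ltr_pdivrMr// mul1r.
  move=> /(gauge_lt1 balB absB) Bphi.
  have := small _ Bphi; rewrite -[subsp_val _]/(inj t^-1 *: subsp_val phi).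
  rewrite (linear_funZ _ _ (ndual_linear e)) /GRing.scale /= absvalM -/t.
  rewrite absval_ofreal_ge0 ?invr_ge0 ?(ltW t0)// mulVf ?gt_eqF// ltxx.
  move=> H; suff : false by [].
  apply: H => x xs; rewrite -[LHS]/(inj t^-1 * ndual_fun (subsp_val phi) x).
  by rewrite Mphi// mulr0.
have le_ : linear (fun phi : subsp D => e (subsp_val phi)).
  by move=> a phi psi; rewrite subsp_val_linear ndual_linear.
have [|g [lg gN gM]] := hahn_banach hN (M := Submod M0 Ml) _ le.
  by move=> a phi psi _ _; rewrite le_.
have [|||c cE] := @linear_dependence K (subsp D) V
   (fun x phi => ndual_fun (subsp_val phi) x) _ s
   (fun phi => e (subsp_val phi) - g phi).
- by [].
- move=> a phi psi; rewrite le_ lg scalerBr; by rewrite opprD addrACA.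
- by move=> phi Mphi; rewrite gM// subrr.
exists (\sum_(u <- c) u.1 *: u.2) => phi pphi.
have Dphi : sm_set D phi by exists 1 => // x; rewrite mul1r.
have -> : phi (\sum_(u <- c) u.1 *: u.2) = \sum_(u <- c) u.1 * phi u.2.
  elim: (c) => [|u c' IH]; first by rewrite !big_nil ndual0.
  by rewrite !big_cons ndual_linear IH.
have := cE (mksub Dphi : subsp D); rewrite -[subsp_val _]/phi => <-.
rewrite opprB addrC subrK.
by apply: le_trans (gN _) _; exact: (gauge_le1 absB).
Qed.

(** Grothendieck's completeness theorem: the approximations of e given by
bidual_approx form a Cauchy filter, whose limit represents e. *)
Theorem bidual_representable (e : ndual (ndual V)) : tvs_complete V ->
  exists x : V, forall phi : ndual V, e phi = phi x.
Proof.
move=> VC.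
pose A (p : V -> R) : set V := [set x | forall phi, polar hK p phi -> nm (e phi - phi x) <= 1].
pose F := filter_from (@cont_seminorm R K hK V : set (V -> R)) A.
have FF : ProperFilter F.
  apply: filter_from_proper; last by move=> p cp; exact: bidual_approx.
  apply: filter_from_filter.
    exists (fun _ : V => nm (0 : K)).
    exact: (cont_seminorm_linear hK (@cst_cont _ _ (0 : K^o))
      (fun _ _ _ => esym (etrans (addr0 _) (scaler0 _ _)))).
  move=> p q cp cq; exists (fun x => p x + q x); first exact: cont_seminormD.
  move=> x Ax; split=> phi pphi; apply: Ax => y; apply: le_trans (pphi y) _.
    by rewrite lerDl (sn_ge0 cq.1).
  by rewrite lerDr (sn_ge0 cp.1).
have FC : tvs_cauchy F.
  move=> U /(lctvs_cont_seminorm hK lV)[p cp pU].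
  (* Two members of A (4 p) differ by at most 2 on the polar of 4 p, hence 4 p is at most 2
     on their difference. *)
  have c4 : cont_seminorm hK (fun x => 4 * p x) by exact: cont_seminormM.
  exists (A (fun x => 4 * p x)); first by exists (fun x => 4 * p x).
  move=> x y Ax Ay; apply: pU.
  suff : 4 * p (x - y) <= 2 by lra.
  apply: (polar_le lV c4) => phi pphi.
  rewrite (linear_funB _ _ (ndual_linear phi)).
  apply: le_trans (absval_triangle _ _ (e phi) _) _.
  by have := Ax _ pphi; have := Ay _ pphi; rewrite [nm (phi x - _)]absvalB; lra.
have [x Fx] := VC F FF FC; exists x => phi.
apply/eqP; rewrite -subr_eq0; apply/eqP/(absval_eq0 (hK := hK)).
apply/eqP; rewrite eq_le absval_ge0 andbT; apply/ler_addgt0Pr => r r0; rewrite add0r.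
have r20 : 0 < r / 2 by rewrite divr_gt0.
have cphi := cont_seminorm_linear hK (@ndual_cont _ _ phi) (@ndual_linear _ _ phi).
have i0 : 0 <= (r / 2)^-1 by rewrite invr_ge0 ltW.
have cp := cont_seminormM i0 cphi lV.
have FA : F (A (fun x => (r / 2)^-1 * nm (phi x))).
  by exists (fun x => (r / 2)^-1 * nm (phi x)).
have [y [Ay xy]] := filter_ex (filterI FA (Fx _ (cont_seminorm_lt x lV cphi r20))).
have := Ay (inj (r / 2)^-1 *: phi).
rewrite (linear_funZ _ _ (ndual_linear e)) ndualZ -scalerBr /GRing.scale /= absvalM.
rewrite absval_ofreal_ge0// => H.
apply: le_trans (absval_triangle _ _ (phi y) _) _.
move: xy => /=; rewrite (linear_funB _ _ (ndual_linear phi)) => xy.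
suff : nm (e phi - phi y) <= r / 2 by lra.
rewrite -[leRHS]mulr1 -ler_pdivrMl//; apply: H => z.
by rewrite ndualZ /GRing.scale /= absvalM absval_ofreal_ge0.
Qed.

End reflexivity.

(** * The topology of the dual *)

Section seminorms_lctvs.
Variables (R : realType) (K : numFieldType).
Hypothesis hK : real_or_complex R K.
Local Notation nm := (absval hK).
Local Notation inj := (ofreal hK).

Lemma seminorms_lctvs (E : preTopologicalLmodType K) (P : set (E -> R)) :
  (forall p, P p -> seminorm hK p) ->
  (forall p c, 0 < c -> P p -> P (fun x => c * p x)) ->
  (forall x A, nbhs x A <-> exists2 p, P p & forall y, p (y - x) < 1 -> A y) ->
  lctvs E.
Proof.
move=> Psn PZ nP.
have Pn p x (r : R) : 0 < r -> P p -> nbhs x [set y | p (y - x) < r].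
  move=> r0 Pp; apply/nP; exists (fun x => r^-1 * p x).
    by apply: PZ => //; rewrite invr_gt0.
  by move=> y; rewrite mulrC ltr_pdivrMr// mul1r.
split.
- move=> [x y] A /nP[p Pp pA]; have hp := Psn p Pp.
  have h0 : 0 < 1 / 2 :> R by rewrite divr_gt0.
  exists ([set z | p (z - x) < 1 / 2], [set z | p (z - y) < 1 / 2]).
    by split; exact: Pn.
  move=> [z w] /= [pz pw]; apply: pA.
  have -> : z + w - (x + y) = (z - x) + (w - y) by rewrite opprD addrACA.
  by have := snD hp (z - x) (w - y); lra.
- move=> [a x] A /nP[p Pp pA]; have hp := Psn p Pp.
  have px0 := sn_ge0 hp x; have na0 := absval_ge0 hK a.
  have d0 : 0 < (2 * (p x + 1))^-1 by rewrite invr_gt0; lra.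
  have e0 : 0 < (2 * (nm a + 1))^-1 by rewrite invr_gt0; lra.
  exists ([set b : K^o | nm (b - a) < (2 * (p x + 1))^-1],
    [set z | p (z - x) < 1] `&` [set z | p (z - x) < (2 * (nm a + 1))^-1]).
    split; first by apply/(nbhs_Ko hK); exists (2 * (p x + 1))^-1.
    by apply: filterI; apply: Pn.
  move=> [b z] /= [ba [z1 z2]]; apply: pA.
  have -> : b *: z - a *: x = (b - a) *: z + a *: (z - x).
    by rewrite scalerBl scalerBr addrA subrK.
  have pz : p z <= p x + 1 by have := snD hp (z - x) x; rewrite subrK; lra.
  apply: le_lt_trans (snD hp _ _) _; rewrite !(snZ hp).
  have h1 : nm (b - a) * p z < 1 / 2.
    apply: (@le_lt_trans _ _ (nm (b - a) * (p x + 1))).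
      by rewrite ler_wpM2l ?absval_ge0.
    have -> : 1 / 2 = (2 * (p x + 1))^-1 * (p x + 1) by field; rewrite gt_eqF//; lra.
    by rewrite ltr_pM2r//; lra.
  have h2 : nm a * p (z - x) <= 1 / 2.
    have -> : 1 / 2 = (nm a + 1) * (2 * (nm a + 1))^-1 by field; rewrite gt_eqF//; lra.
    by apply: ler_pM => //; [exact: sn_ge0|lra|exact: ltW].
  lra.
- exists [set b | exists p x, P p /\ b = [set y | p (y - x) < 1]].
    move=> _ /set_mem[p [x [Pp ->]]]; have hp := Psn p Pp.
    apply/convex_setW => y z /set_mem /= yx /set_mem /= zx k k0 k1.
    apply/mem_set => /=.
    have kE : k%:num = inj (nm k%:num) by apply: ge0_ofreal; exact: ltW.
    set r := nm k%:num in kE.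
    have r0 : 0 < r by rewrite -(ofreal_lt hK) rmorph0 -kE.
    have r1 : r < 1 by rewrite -(ofreal_lt hK) rmorph1 -kE.
    have -> : conv k y z - x = inj r *: (y - x) + inj (1 - r) *: (z - x).
      rewrite !scalerBr addrACA -opprD -scalerDl -rmorphD addrCA subrr addr0.
      by rewrite rmorph1 scale1r rmorphB rmorph1 -kE.
    apply: le_lt_trans (snD hp _ _) _; rewrite !(snZr hp) ?subr_ge0 ?(ltW r0) ?(ltW r1)//.
    by nra.
  split.
    move=> _ [p [x [Pp ->]]]; have hp := Psn p Pp.
    rewrite openE => y /= yx; have d0 : 0 < 1 - p (y - x) by lra.
    apply: filterS (Pn p y _ d0 Pp) => z /= zy.
    by have := sn_triangle hp z y x; lra.
  move=> x A /nP[p Pp pA]; exists [set y | p (y - x) < 1] => //.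
  split; first by exists p, x.
  by rewrite /= subrr (sn0 (Psn p Pp)).
Qed.

End seminorms_lctvs.

Section dual_topology.
Variables (R : realType) (K : numFieldType).
Hypothesis hK : real_or_complex R K.
Local Notation nm := (absval hK).
Local Notation inj := (ofreal hK).
Implicit Types V : preTopologicalLmodType K.

Lemma ndualB V (f g : ndual V) x : ndual_fun (f - g) x = f x - g x.
Proof. by []. Qed.

Lemma ndual_linear_hk V : hausdorff_space V -> linear_hk (ndual V).
Proof.
move=> hV; apply: linear_hkI; [exact: ndual_kspace|exact: ndual_hausdorff| |].
- move=> C p q cC hC cp cq; have kC := compact_kspace cC hC.
  apply: ndual_to => // D r s cD hD cr cs; have kD := compact_kspace cD hD.
  have c1 : continuous (fun d => ndual_fun (p (r d)) (s d) : K^o).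
    by apply: (@ndual_eval _ _ _ (fun d => p (r d))) => //; exact: cont_comp cr cp.
  have c2 : continuous (fun d => ndual_fun (q (r d)) (s d) : K^o).
    by apply: (@ndual_eval _ _ _ (fun d => q (r d))) => //; exact: cont_comp cr cq.
  exact: (KoD c1 c2).
- move=> C p q cC hC cp cq; have kC := compact_kspace cC hC.
  apply: ndual_to => // D r s cD hD cr cs; have kD := compact_kspace cD hD.
  have c1 : continuous (fun d => p (r d)) by exact: cont_comp cr cp.
  have c2 : continuous (fun d => ndual_fun (q (r d)) (s d) : K^o).
    by apply: (@ndual_eval _ _ _ (fun d => q (r d))) => //; exact: cont_comp cr cq.
  exact: (linhkZ (Ko_linear_hk hK) kD c1 c2).
Qed.

Lemma linear_hk_translate V (x : V) : linear_hk V -> continuous (fun y => y + x).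
Proof.
move=> hV; have [[kV _] _ _] := hV.
by apply: (linhkD hV kV); [move=> ? ?|exact: cst_cont].
Qed.

(** The diagonal being closed for the k-product makes points closed, and a locally convex
space with closed points is separated. *)
Lemma linear_hk_hausdorff V : linear_hk V -> lctvs V -> hausdorff_space V.
Proof.
move=> [[kV dV] _ _] lV x y; apply: contraPP => /eqP xy H.
have cy : closed [set z | z = y].
  have c : continuous ((fun z => (z, y)) : V -> kprod V V).
    by apply: kprod_pair => //; [move=> ? ?|exact: cst_cont].
  by move/continuous_closedP : c => /(_ _ dV).
have ox : nbhs x (~` [set z | z = y]).
  by apply: open_nbhs_nbhs; split; [exact: closed_openC|exact/eqP].
have /(nbhs_cont_seminorm hK _ _ lV)[p cp pxy] := ox.
have h0 : 0 < 1 / 2 :> R by rewrite divr_gt0.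
have [z [/= zx zy]] := H _ _ (cont_seminorm_lt x lV cp h0) (cont_seminorm_lt y lV cp h0).
apply: (pxy y) => //.
have := sn_triangle cp.1 y z x; rewrite (snB cp.1 y z); lra.
Qed.

(** Uniform convergence on a compact set S is coarser than the k-ified topology: the
polar condition is compact-open at 0, and translations are continuous. *)
Lemma ndual_nbhs_compact V (S : set V) (phi : ndual V) (r : R) :
  hausdorff_space V -> compact S -> 0 < r ->
  nbhs phi [set psi : ndual V | forall x, S x -> nm (psi x - phi x) < r].
Proof.
move=> hV cS r0.
pose U : set (ndual V) := [set psi | forall x, S x -> nm (psi x) < r].
have oU : open U.
  pose f := fun psi : ndual V => (cmap_fun (set_val psi) : {compact-open, V -> K^o}).
  have cf : continuous f.
    exact: (cont_comp (@set_type_cont (cmap V K^o) _) (@cmap_val_cont V K^o)).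
  have := @compact_open_open V K^o S [set z | nm z < r] cS (@open_absval_lt _ _ hK r).
  move/continuousP : cf => /[apply]; congr open.
  apply/seteqP; split=> psi H; first by move=> x Sx; apply: H; exists x.
  by move=> _ [x Sx <-]; exact: H.
have n0 : nbhs (phi + - phi) U.
  by apply: open_nbhs_nbhs; split=> //; rewrite subrr => x _; rewrite absval0.
have := linear_hk_translate (x := - phi) (ndual_linear_hk hV) n0.
by apply: (@filterS _ (nbhs phi)) => psi H x Sx; rewrite -ndualB; exact: H.
Qed.

(** The topology of the natural dual is the compact-open topology, before k-ification. *)
Definition compact_open_dual V : Prop := forall (phi : ndual V) A, nbhs phi A ->
  exists S r, [/\ compact S, 0 < r
    & forall psi : ndual V, (forall x, S x -> nm (psi x - phi x) < r) -> A psi].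

Section sup_seminorm.
Variables (V : preTopologicalLmodType K) (S : set V).
Hypotheses (cS : compact S) (S0 : S 0).

Definition sup_on (phi : ndual V) : R := sup [set nm (phi x) | x in S].

Lemma compact_bounded (f : V -> K^o) : continuous f ->
  exists M : R, forall x, S x -> nm (f x) <= M.
Proof.
move=> cf; have [||||M _ SM] :=
  compact_directed (D := setT) (U := fun M : R => [set x | nm (f x) < M]) cS.
- by exists 0.
- by move=> M _; move/continuousP : cf => /(_ _ (@open_absval_lt _ _ hK M)).
- move=> M N _ _; exists (Num.max M N) => // x []; rewrite /= lt_max => ->//.
  by rewrite orbT.
- by move=> x _; exists (nm (f x) + 1) => //=; rewrite ltrDl.
by exists M => x /SM /ltW.
Qed.

Lemma sup_on_ub (phi : ndual V) x : S x -> nm (phi x) <= sup_on phi.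
Proof.
move=> Sx; apply: ub_le_sup; last by exists x.
have [M HM] := compact_bounded (@ndual_cont _ _ phi).
by exists M => _ [y Sy <-]; exact: HM.
Qed.

Lemma sup_on_le (phi : ndual V) r : (forall x, S x -> nm (phi x) <= r) -> sup_on phi <= r.
Proof.
move=> H; apply: ge_sup; last by move=> _ [x Sx <-]; exact: H.
by exists (nm (phi 0)), 0.
Qed.

Lemma sup_on_seminorm : seminorm hK sup_on.
Proof.
have H a (phi : ndual V) : sup_on (a *: phi) <= nm a * sup_on phi.
  apply: sup_on_le => x Sx; rewrite ndualZ /GRing.scale /= absvalM.
  by rewrite ler_wpM2l ?absval_ge0// sup_on_ub.
split=> [phi psi|a phi].
  apply: sup_on_le => x Sx; rewrite ndualD; apply: le_trans (absvalD _ _ _) _.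
  by apply: lerD; exact: sup_on_ub.
apply/eqP; rewrite eq_le H /=; have [->|a0] := eqVneq a 0.
  rewrite absval0 mul0r; apply: le_trans (sup_on_ub _ S0); exact: absval_ge0.
have := H a^-1 (a *: phi); rewrite scalerA mulVf// scale1r absvalV.
by rewrite [_^-1 * _]mulrC ler_pdivlMr ?absval_gt0// mulrC.
Qed.

End sup_seminorm.

Lemma ndual_lctvs V : hausdorff_space V -> compact_open_dual V -> lctvs (ndual V).
Proof.
move=> hV coV.
apply: (@seminorms_lctvs _ _ hK _ [set p | exists S c, [/\ compact S, S 0, 0 < c
  & p = fun phi => c * sup_on S phi]]).
- move=> _ [S [c [cS S0 c0 ->]]]; apply: seminormM; first exact: ltW.
  exact: sup_on_seminorm.
- move=> _ c c0 [S [d [cS S0 d0 ->]]]; exists S, (c * d); split=> //.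
    by rewrite mulr_gt0.
  by apply/funext => phi; rewrite mulrA.
move=> phi A; split=> [/coV[S [r [cS r0 SA]]]|[_ [S [c [cS S0 c0 ->]]] HA]].
  have cS' : compact (S `|` [set 0]) by apply: compactU => //; exact: compact_set1.
  have S0' : (S `|` [set 0]) 0 by right.
  exists (fun phi => r^-1 * sup_on (S `|` [set 0]) phi).
    by exists (S `|` [set 0]), r^-1; rewrite invr_gt0.
  move=> psi; rewrite mulrC ltr_pdivrMr// mul1r => H; apply: SA => x Sx.
  have Sx' : (S `|` [set 0]) x by left.
  by have := sup_on_ub cS' (psi - phi) Sx'; rewrite ndualB; lra.
have d0 : 0 < (2 * c)^-1 by rewrite invr_gt0; lra.
apply: filterS (ndual_nbhs_compact phi hV cS d0) => psi /= H; apply: HA.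
have : sup_on S (psi - phi) <= (2 * c)^-1.
  by apply: sup_on_le => // x Sx; exact: ltW (H x Sx).
move=> H'; apply: (@le_lt_trans _ _ (c * (2 * c)^-1)); first by rewrite ler_pM2l.
rewrite invfM mulrCA mulfV ?gt_eqF// mulr1; lra.
Qed.

(** The limit is locally uniform, hence continuous along every map from a compact space,
and therefore continuous since V is a k-space. *)
Lemma ndual_complete V : kspace V -> hausdorff_space V -> compact_open_dual V ->
  tvs_complete (ndual V).
Proof.
move=> kV hV coV F FF FC.
have unif S r : compact S -> 0 < r -> exists2 B, F B & forall phi psi, B phi -> B psi ->
    forall x, S x -> nm ((phi : ndual V) x - (psi : ndual V) x) < r.
  move=> cS r0; have [B FB HB] := FC _ (ndual_nbhs_compact 0 hV cS r0).
  exists B => // phi psi Bphi Bpsi x Sx.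
  by have := HB _ _ Bphi Bpsi x Sx; rewrite subr0.
have lim x : exists z : K^o, (fun phi : ndual V => phi x : K^o) @ F --> z.
  apply: (scalar_complete (hK := hK)) => r r0.
  have [B FB HB] := unif _ _ (@compact_set1 _ x) r0.
  exists ((fun phi : ndual V => phi x : K^o) @` B).
    by apply: (@filterS _ F _ B) => // phi Bphi; exists phi.
  by move=> _ _ [phi Bphi <-] [psi Bpsi <-]; exact: HB.
pose l x : K^o := sval (cid (lim x)).
have lP x : (fun phi : ndual V => phi x : K^o) @ F --> l x by exact: svalP (cid (lim x)).
have ul S r : compact S -> 0 < r -> exists2 B, F B & forall phi : ndual V, B phi ->
    forall x, S x -> nm (phi x - l x) < r.
  move=> cS r0; have r20 : 0 < r / 2 by rewrite divr_gt0.
  have [B FB HB] := unif _ _ cS r20; exists B => // phi Bphi x Sx.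
  have /(_ _ r20) := proj1 (cvg_Ko hK _ _ FF) (lP x).
  move=> /(filterI FB)/filter_ex[psi [Bpsi psix]].
  have := HB _ _ Bphi Bpsi x Sx.
  have := absval_triangle hK (ndual_fun phi x) (ndual_fun psi x) (l x); lra.
have ll : linear l.
  move=> a x y.
  have H : (fun phi : ndual V => a *: (phi x : K^o) + phi y : K^o) @ F --> a *: l x + l y.
    by apply: cvgD; [apply: cvgZr; exact: lP|exact: lP].
  have E : (fun phi : ndual V => phi (a *: x + y) : K^o) =
    (fun phi : ndual V => a *: (phi x : K^o) + phi y).
    by apply/funext => phi; rewrite ndual_linear.
  have := lP (a *: x + y); rewrite E => H'.
  exact: (cvg_unique (@Ko_hausdorff K) H' H).
have cl : continuous l.
  apply: kV => C p cC hC cp; apply/(continuous_Ko hK) => c r r0.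
  have r30 : 0 < r / 3 by rewrite divr_gt0.
  have cpC : compact (p @` setT).
    by apply: continuous_compact => //; exact: continuous_subspaceT.
  have [B FB HB] := ul _ _ cpC r30; have [phi Bphi] := filter_ex FB.
  have /(continuous_Ko hK)/(_ c _ r30) := cont_comp cp (@ndual_cont _ _ phi).
  apply: filterS => d /= H.
  have Hd := HB _ Bphi (p d) (ex_intro2 _ _ d I erefl).
  have Hc := HB _ Bphi (p c) (ex_intro2 _ _ c I erefl).
  have := absval_triangle hK (l (p d)) (ndual_fun phi (p d)) (l (p c)).
  have := absval_triangle hK (ndual_fun phi (p d)) (ndual_fun phi (p c)) (l (p c)).
  rewrite (absvalB hK (l (p d)) (ndual_fun phi (p d))); lra.
exists (mkndual cl ll) => A /coV[S [r [cS r0 SA]]].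
have [B FB HB] := ul _ _ cS r0; apply: filterS FB => phi Bphi; apply: SA.
exact: HB.
Qed.

Lemma homeo_closed_embedding (X Y : topologicalType) (f : X -> Y) (g : Y -> X) :
  continuous f -> continuous g -> cancel f g -> cancel g f -> closed_embedding f.
Proof.
move=> cf cg fK gK; split; first exact: can_inj fK.
  move=> U; split=> [oU|[O oO ->]]; last by move/continuousP : cf; apply.
  exists (g @^-1` U); first by move/continuousP : cg; apply.
  by apply/seteqP; split=> x; rewrite /preimage /= fK.
rewrite (_ : range f = setT); first exact: closedT.
by apply/seteqP; split=> // y _; exists (g y).
Qed.

Section bidual.
Variable V : preTopologicalLmodType K.
Hypotheses (hkV : linear_hk V) (lV : lctvs V) (VC : tvs_complete V).

Let kV : kspace V. Proof. by have [[]] := hkV. Qed.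
Let hV : hausdorff_space V. Proof. exact: linear_hk_hausdorff. Qed.

Definition bidual_eval (x : V) : ndual (ndual V) :=
  mkndual (@ndual_pt _ V x) (fun a phi psi => erefl).

Lemma bidual_eval_cont : continuous bidual_eval.
Proof.
apply: ndual_to => //; first exact: ndual_hausdorff.
move=> C p q cC hC cp cq; apply: (@ndual_eval _ _ _ q p) => //.
exact: compact_kspace.
Qed.

Lemma bidual_eval_lin : linear bidual_eval.
Proof. by move=> a x y; apply: ndual_ext => phi; exact: ndual_linear. Qed.

Definition bidual_inv (e : ndual (ndual V)) : V :=
  sval (cid (bidual_representable hK lV hV e VC)).

Lemma bidual_invE e (phi : ndual V) : phi (bidual_inv e) = e phi.
Proof. exact: esym (svalP (cid (bidual_representable hK lV hV e VC)) phi). Qed.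

Lemma bidual_evalK : cancel bidual_eval bidual_inv.
Proof. by move=> x; apply: (ndual_sep hK lV hV) => phi; rewrite bidual_invE. Qed.

Lemma bidual_invK : cancel bidual_inv bidual_eval.
Proof. by move=> e; apply: ndual_ext => phi; exact: bidual_invE. Qed.

Lemma bidual_inv_lin : linear bidual_inv.
Proof.
move=> a e f; apply: (ndual_sep hK lV hV) => phi.
by rewrite ndual_linear !bidual_invE.
Qed.

(** The seminorm p is the supremum over its polar, which is compact: so convergence in
the bidual, which is uniform on compact sets, implies convergence for p. *)
Lemma bidual_inv_cont : continuous bidual_inv.
Proof.
move=> e A /(nbhs_cont_seminorm hK _ _ lV)[p cp pA].
have h0 : 0 < 1 / 2 :> R by rewrite divr_gt0.
have cP := polar_compact lV hV cp.
apply: filterS (ndual_nbhs_compact e (@ndual_hausdorff _ V) cP h0) => f /= H.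
apply: pA; apply: (@le_lt_trans _ _ (1 / 2)); last by lra.
apply: (polar_le lV cp) => phi pphi.
rewrite (linear_funB _ _ (ndual_linear phi)) !bidual_invE; exact: ltW (H _ pphi).
Qed.

Let T := submodT (ndual V).

Lemma complete_naturally_paired : naturally_paired V.
Proof.
split=> //.
pose w : clin (subsp T) (ndual V) := Clin (@subsp_cont _ _ T) (@subsp_val_linear _ _ T).
pose u0 (phi : ndual V) : subsp T := mksub (S := T) (x := phi) I.
have cu : continuous u0 by apply: cont_to_set => ? ?.
have lu : linear u0 by move=> a phi psi; exact: subsp_inj.
pose u : clin (ndual V) (subsp T) := Clin cu lu.
have E x : dual_eval T x = transpose w (bidual_eval x) by exact: ndual_ext.
have -> : dual_eval T = transpose w \o bidual_eval by apply/funext.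
apply: (@homeo_closed_embedding _ _ _ (bidual_inv \o transpose u)).
- exact: (cont_comp bidual_eval_cont (@clin_cont _ _ _ (transpose w))).
- exact: (cont_comp (@clin_cont _ _ _ (transpose u)) bidual_inv_cont).
- move=> x /=; rewrite -[RHS]bidual_evalK; congr bidual_inv; exact: ndual_ext.
- move=> e /=; rewrite bidual_invK; apply: ndual_ext => phi.
  by rewrite /=; congr (ndual_fun e _); exact: subsp_inj.
Qed.

End bidual.
End dual_topology.

(** * Convergent sequences and exhaustions by compact sets *)

Section sequences.

Definition seq_to (X : topologicalType) (x : nat -> X) (l : X) : Prop :=
  forall A, nbhs l A -> exists N, forall n, (N <= n)%N -> A (x n).

Local Notation Noo := (one_point_compactification nat).

Lemma Noo_compact : compact [set: Noo].
Proof. exact: one_point_compactification_compact. Qed.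

Lemma Noo_hausdorff : hausdorff_space Noo.
Proof.
apply: one_point_compactification_hausdorff; last exact: discrete_hausdorff.
move=> n _; exists [set n].
  by rewrite withinET nbhs_principalE; apply/principal_filterP.
split; first exact: compact_set1.
by rewrite -[[set n]]setCK; apply: open_closedC; exact: discrete_open.
Qed.

Lemma compact_nat_bounded (A : set nat) : compact A -> exists N, forall n, A n -> (n < N)%N.
Proof.
move=> cA; have [||||N _ AN] := compact_directed (D := setT)
  (U := fun N : nat => [set n | (n < N)%N]) cA.
- by exists 0%N.
- by move=> N _; exact: discrete_open.
- move=> M N _ _; exists (maxn M N) => // n [] /= nM; rewrite leq_max nM ?orbT//.
- by move=> n _; exists n.+1 => /=.
by exists N.
Qed.

Lemma nbhs_Noo (A : set Noo) : nbhs (None : Noo) A ->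
  exists N, forall n, (N <= n)%N -> A (Some n).
Proof.
move=> [C [cC _] CA]; have [N CN] := compact_nat_bounded cC.
exists N => n Nn; apply: CA; left; exists n => // /CN; by rewrite ltnNge Nn.
Qed.

Definition seq_map (X : Type) (x : nat -> X) (l : X) (o : Noo) : X :=
  if o is Some n then x n else l.

Lemma seq_map_cont (X : topologicalType) (x : nat -> X) (l : X) :
  seq_to x l -> continuous (seq_map x l).
Proof.
move=> xl [n|].
  move=> A /nbhs_singleton /= Ax; rewrite /nbhs /= /one_point_nbhs /=.
  rewrite /fmap /= nbhs_principalE; exact/principal_filterP.
move=> A nA; have [N NA] := xl A nA; exists `I_N.
  split; first by apply: finite_compact; exact: finite_II.
  by rewrite -(setCK `I_N); apply: open_closedC; exact: discrete_open.
move=> _ [[n /= nN <-]|->] /=; last exact: nbhs_singleton.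
by apply: NA; rewrite leqNgt; exact/negP.
Qed.

Lemma kopen_seq (X : topologicalType) (U : set X) (x : nat -> X) (l : X) :
  kopen U -> U l -> seq_to x l -> exists n, U (x n).
Proof.
move=> kU Ul /seq_map_cont cx.
have := kU _ _ Noo_compact Noo_hausdorff cx.
rewrite openE => /(_ None Ul)/nbhs_Noo[N H].
by exists N; exact: H N (leqnn N).
Qed.

Lemma metrizable_kspace (R : realType) (X : topologicalType) :
  metrizable R X -> kspace X.
Proof.
move=> [d [d0 dC dT dn]].
suff H (U : set X) : @kopen X U -> open U.
  move=> Y f tf; apply/continuousP => O oO; apply: H => C p cC hC cp.
  by have /continuousP/(_ _ oO) := tf C p cC hC cp.
move=> kU; rewrite openE => x Ux; apply: contrapT => nU.
have y_ex (n : nat) : exists y : X, d x y < n.+1%:R^-1 /\ ~ U y.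
  apply: contrapT => H; apply: nU; apply/dn; exists n.+1%:R^-1.
    by rewrite invr_gt0.
  by move=> y /= xy; apply: contrapT => nUy; apply: H; exists y.
have [y Hy] := choice y_ex.
have [|n] := kopen_seq kU Ux (x := y); last by have [] := Hy n.
move=> A /dn[e e0 eA].
exists (Num.truncn e^-1).+1 => n Nn; apply: eA; have [+ _] := Hy n => /lt_trans; apply.
rewrite invf_plt ?posrE//; apply: lt_le_trans (truncnS_gt _) _.
by rewrite ler_nat; exact: leq_trans Nn (leqnSn _).
Qed.

Lemma hausdorff_prod (X Y : topologicalType) :
  hausdorff_space X -> hausdorff_space Y -> hausdorff_space (X * Y)%type.
Proof.
move=> hX hY [a b] [a' b'] H; congr pair; [apply: hX|apply: hY] => P Q Pc Qc.
  have [] := H (P `*` setT) (Q `*` setT).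
  - by exists (P, setT) => //; split=> //; exact: filterT.
  - by exists (Q, setT) => //; split=> //; exact: filterT.
  by move=> [x y] [[? _] [? _]]; exists x.
have [] := H (setT `*` P) (setT `*` Q).
- by exists (setT, P) => //; split=> //; exact: filterT.
- by exists (setT, Q) => //; split=> //; exact: filterT.
by move=> [x y] [[_ ?] [_ ?]]; exists y.
Qed.

Lemma compact_prodT (X Y : topologicalType) :
  compact [set: X] -> compact [set: Y] -> compact [set: X * Y].
Proof. by move=> cX cY; rewrite -setXTT; exact: compact_setX. Qed.

(** The tube lemma around infinity in the one-point compactification. It is what
makes a compact set of functionals equicontinuous. *)
Lemma uniform_null (R : realType) (K : numFieldType) (hK : real_or_complex R K)
    (C : topologicalType) (g : C * Noo -> K^o) :
  compact [set: C] -> continuous g -> (forall c, g (c, None) = 0) ->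
  exists N, forall c, absval hK (g (c, Some N)) < 1.
Proof.
move=> cC cg g0; have [||||N _ CN] := compact_directed (D := setT)
  (U := fun N => interior [set c | forall n, (N <= n)%N -> absval hK (g (c, Some n)) < 1]) cC.
- by exists 0%N.
- by move=> N _; exact: open_interior.
- move=> M N _ _; exists (maxn M N) => // c [];
    apply: filterS => c' H n; rewrite geq_max => /andP[Mn Nn]; exact: H.
- move=> c _; have /(continuous_Ko hK)/(_ (c, None) _ ltr01) := cg.
  rewrite g0 => -[[P Q] [/= Pc /nbhs_Noo[N QN]] PQ]; exists N => //.
  apply: filterS Pc => c' Pc' n /QN Qn; have := PQ (c', Some n) (conj Pc' Qn).
  by rewrite /= subr0.
by exists N => c; have /interior_subset := CN c I; apply.
Qed.

End sequences.

Section exhaustions.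

(** Stated with maps from compact spaces rather than with compact subsets, as these maps
define k-spaces and the topology of mapping spaces. *)
Definition exhaustion (X : topologicalType) (B : nat -> set X) : Prop :=
  [/\ forall n, compact (B n), forall n, B n `<=` B n.+1
    & forall (C : topologicalType) (p : C -> X), compact [set: C] ->
        hausdorff_space C -> continuous p -> exists n, forall c, B n (p c)].

Lemma exhaustion_le (X : topologicalType) (B : nat -> set X) m n :
  exhaustion B -> (m <= n)%N -> B m `<=` B n.
Proof.
move=> [_ Bi _]; elim: n => [|n IH]; first by rewrite leqn0 => /eqP ->.
rewrite leq_eqVlt => /predU1P[->//|]; rewrite ltnS => /IH H x /H; exact: Bi.
Qed.

Lemma exhaustion_cover (X : topologicalType) (B : nat -> set X) x :
  exhaustion B -> exists n, B n x.
Proof.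
move=> [_ _ /(_ _ (fun=> x) Noo_compact Noo_hausdorff (@cst_cont _ _ x))[n H]].
by exists n; exact: (H None).
Qed.

(** A compatible family of maps on the B n glues to a map on X, continuous along every test
map since the latter factors through one of the B n. *)
Lemma exhaustion_hemicompact (X : topologicalType) (B : nat -> set X) :
  kspace X -> hausdorff_space X -> exhaustion B -> hemicompact X.
Proof.
move=> kX hX eB; have [Bc Bi Bt] := eB.
pose s n (x : B n) : B n.+1 := exist _ (set_val x) (mem_set (Bi n _ (set_valP x))).
exists (fun n => set_type (B n) : topologicalType), s, (fun n x => set_val x); split=> //.
- by move=> n; split; [exact: set_type_compact|exact: set_type_hausdorff].
- move=> n; split; first by apply: cont_to_set; exact: set_type_cont.
  by move=> x y /(congr1 set_val) /= H; exact: val_inj.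
- by move=> n; exact: set_type_cont.
move=> Y f cf fs.
have mk n x (Bx : B n x) : {y : B n | set_val y = x}.
  by exists (exist _ x (mem_set Bx)).
have f_le m n (x : B m) (y : B n) : (m <= n)%N -> set_val x = set_val y -> f m x = f n y.
  elim: n y => [|n IH] y.
    rewrite leqn0 => /eqP m0; move: x; rewrite m0 => x xy.
    by congr (f _ _); exact: val_inj.
  rewrite leq_eqVlt => /predU1P[m0|].
    by clear IH; subst m => xy; congr (f _ _); exact: val_inj.
  rewrite ltnS => mn xy.
  have [z zE] := mk n (set_val x) (exhaustion_le eB mn (set_valP x)).
  rewrite (IH z mn (esym zE)) -fs; congr (f _ _); apply: val_inj => /=.
  exact: etrans zE xy.
have f_eq m n (x : B m) (y : B n) : set_val x = set_val y -> f m x = f n y.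
  by move=> xy; have [mn|/ltnW nm] := leqP m n; [exact: f_le|symmetry; exact: f_le].
have gx x : {y : Y | forall n (z : B n), set_val z = x -> f n z = y}.
  apply: cid; have [n Bx] := exhaustion_cover x eB.
  have [z zx] := mk n x Bx; exists (f n z) => m w wx; apply: f_eq; by rewrite wx.
pose g x := sval (gx x).
have gP n (z : B n) : g (set_val z) = f n z.
  by symmetry; exact: (svalP (gx (set_val z)) n z erefl).
exists g; split; last first.
  move=> h [_ hP]; apply/funext => x; have [n Bx] := exhaustion_cover x eB.
  by have [z <-] := mk n x Bx; rewrite gP hP.
split=> //; apply: kX => C p cC hC cp.
have [n Bp] := Bt C p cC hC cp.
pose q c : B n := exist _ (p c) (mem_set (Bp c)).
have -> : g \o p = f n \o q by apply/funext => c /=; rewrite -gP.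
by apply: cont_comp => //; exact: cont_to_set.
Qed.

End exhaustions.

(** X with the final topology for the maps i n: the test object which turns the universal
property of a colimit into a statement on open sets. *)
Definition final_space (X : topologicalType) (C : nat -> topologicalType)
  (i : forall n, C n -> X) : Type := X.

Section final_topology.
Variables (X : topologicalType) (C : nat -> topologicalType) (i : forall n, C n -> X).
Let fopen (U : set X) : Prop := forall n, open (@i n @^-1` U).
Let fopenT : fopen setT. Proof. by move=> n; rewrite preimage_setT; exact: openT. Qed.
Let fopenI : setI_closed fopen.
Proof. by move=> A B fA fB n; rewrite preimage_setI; exact: openI. Qed.
Let fopen_bigU (I : Type) (f : I -> set X) :
  (forall j, fopen (f j)) -> fopen (\bigcup_j f j).
Proof. by move=> ff n; rewrite preimage_bigcup; apply: bigcup_open => j _; exact: ff. Qed.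
HB.instance Definition _ := Choice.on (final_space (@i)).
HB.instance Definition _ :=
  isOpenTopological.Build (final_space (@i)) fopenT fopenI fopen_bigU.
Lemma final_openE (U : set (final_space (@i))) : open U = forall n, open (@i n @^-1` U).
Proof. by []. Qed.
End final_topology.

Section hemicompact_exhaustion.

(** The identity from X to the final topology is the map given by the universal
property, by uniqueness of maps out of X; hence X has the final topology. If a test
map p met the complement of every compact set of the sequence, it would hit points
x_n outside the n-th compact set, all of whose subsets are closed. *)
Lemma hemicompact_exhaustion (X : topologicalType) : hausdorff_space X ->
  hemicompact X -> exists B : nat -> set X, exhaustion B.
Proof.
move=> hX [C [s [i [cC cs ci iS univ]]]].
have open_final (U : set X) : (forall n, open (i n @^-1` U)) -> open U.
  move=> fU.
  have [||g [[cg gi] _]] := univ (final_space i) i.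
  - by move=> n; apply/continuousP => W; rewrite final_openE.
  - exact: iS.
  have cid' : continuous (id : final_space i -> X).
    apply/continuousP => W oW; rewrite final_openE => n.
    by have /continuousP := ci n; apply.
  have [h [_ uh]] := univ X i ci iS.
  have gid : g = id.
    rewrite -(uh g); first by apply: uh; split=> // x.
    by split=> //; exact: (cont_comp cg cid').
  by move/continuousP : cg => /(_ U); rewrite gid; apply.
have closed_final (D : set X) : (forall n, closed (i n @^-1` D)) -> closed D.
  move=> fD; rewrite -[D]setCK; apply: open_closedC; apply: open_final => n.
  by rewrite preimage_setC; exact: closed_openC.
have closed1 (x : X) : closed [set x].
  by apply: accessible_closed_set1; exact: hausdorff_accessible.
have surj x : exists n c, i n c = x.
  apply: contrapT => nx.
  have xi n c : i n c <> x by move=> E; apply: nx; exists n, c.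
  have o1 : open [set x].
    apply: open_final => n; rewrite (_ : _ @^-1` _ = set0); first exact: open0.
    by apply/seteqP; split=> // c /xi.
  have [h [_ uh]] := univ bool (fun _ _ => false) (fun n => @cst_cont _ _ false)
    (fun _ _ => erefl).
  have hx : h = (fun=> false) by apply: uh; split=> //; exact: cst_cont.
  have : h = (fun y => `[< y = x >]).
    apply: uh; split=> [|n c]; last by apply/asboolP; exact: xi.
    apply/continuousP => W _.
    have [Wt|nWt] := pselect (W true); have [Wf|nWf] := pselect (W false).
    - rewrite (_ : _ @^-1` _ = setT); first exact: openT.
      by apply/seteqP; split=> // y _ /=; case: asboolP.
    - rewrite (_ : _ @^-1` _ = [set x]) //.
      apply/seteqP; split=> y /=; first by case: asboolP.
      by move=> ->; rewrite asboolT.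
    - rewrite (_ : _ @^-1` _ = ~` [set x]); first exact: closed_openC.
      apply/seteqP; split=> y /=; first by case: asboolP.
      by move=> yx; rewrite asboolF.
    - rewrite (_ : _ @^-1` _ = set0); first exact: open0.
      by apply/seteqP; split=> // y /=; case: asboolP.
  by rewrite hx => /(congr1 (fun k => k x)); rewrite asboolT.
pose B n := range (i n).
have Bi n : B n `<=` B n.+1 by move=> _ [c _ <-]; exists (s n c) => //; exact: iS.
have Ble m n : (m <= n)%N -> B m `<=` B n.
  elim: n => [|n IH]; first by rewrite leqn0 => /eqP ->.
  rewrite leq_eqVlt => /predU1P[->//|]; rewrite ltnS => /IH H x /H; exact: Bi.
exists B; split=> //.
  move=> n; apply: continuous_compact; last by have [] := cC n.
  exact: continuous_subspaceT.
move=> D p cD hD cp; apply: contrapT => H.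
have d_ex n : exists d, ~ B n (p d).
  by apply: contrapT => H'; apply: H; exists n => d; apply: contrapT => ?; apply: H'; exists d.
have [d dP] := choice d_ex.
pose T N : set X := [set p (d n) | n in [set n | (N <= n)%N]].
have cT N : closed (T N).
  apply: closed_final => m.
  have -> : i m @^-1` T N = i m @^-1` [set p (d n) | n in [set n | (N <= n < m)%N]].
    apply/seteqP; split=> c [n /= Nn nc].
      exists n => //=; rewrite Nn /= ltnNge; apply/negP => mn.
      by apply: (dP n); rewrite nc; apply: (Ble m) => //; exists c.
    by exists n => //=; have /andP[] := Nn.
  have /continuous_closedP := ci m; apply.
  have -> : [set p (d n) | n in [set n | (N <= n < m)%N]] =
      \bigcup_(n in [set n | (N <= n < m)%N]) [set p (d n)].
    by apply/seteqP; split=> x [n Hn]; [move=> <-|move=> ->]; exists n.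
  apply: closed_bigcup.
    by apply: (@sub_finite_set _ _ `I_m); [move=> n /= /andP[]|exact: finite_II].
  by move=> n _; exact: closed1.
have cDT : compact [set: D] := cD.
have [||||N _ DN] := compact_directed (D := setT) (U := fun N => p @^-1` ~` T N) cDT.
- by exists 0%N.
- by move=> N _; move/continuousP : cp; apply; exact: closed_openC.
- move=> M N _ _; exists (maxn M N) => // e [] + [n /= Hn ne]; apply;
    exists n => //=; apply: leq_trans Hn; by rewrite ?leq_maxl ?leq_maxr.
- move=> e _; have [m [c mc]] := surj (p e); exists m => // -[n /= mn ne].
  by apply: (dP n); rewrite ne -mc; apply: (Ble m) => //; exists c.
by apply: (DN (d N) I); exists N => /=.
Qed.

End hemicompact_exhaustion.

(** * Duals of exhausted spaces are Frechet *)

Section exhausted.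
Variables (R : realType) (K : numFieldType).
Hypothesis hK : real_or_complex R K.
Local Notation nm := (absval hK).
Local Notation inj := (ofreal hK).
Variables (V : preTopologicalLmodType K) (B : nat -> set V).
Hypotheses (kV : kspace V) (hV : hausdorff_space V) (eB : exhaustion B).

Let inv_succ_gt0 n : 0 < n.+1%:R^-1 :> R. Proof. by rewrite invr_gt0. Qed.

(** The sequence together with its limit is a continuous family parametrized by the one-point
compactification of nat, which is compact; hence it converges for the k-ified topology. *)
Lemma exhausted_seq (psi : nat -> ndual V) (phi : ndual V) :
  (forall n x, B n x -> nm (psi n x - phi x) < n.+1%:R^-1) -> seq_to psi phi.
Proof.
move=> H; suff cf : continuous (seq_map psi phi).
  move=> A nA; exact: (nbhs_Noo (cf None A nA)).
have kN : kspace (one_point_compactification nat).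
  by apply: compact_kspace; [exact: Noo_compact|exact: Noo_hausdorff].
apply: ndual_to => // C p q cC hC cp cq; apply/(continuous_Ko hK) => c r r0.
have [m Bq] : exists m, forall d, B m (q d) by have [_ _] := eB; apply.
have r20 : 0 < r / 2 by rewrite divr_gt0.
case E : (p c) => [n|].
  have n1 : \forall d \near c, p d = Some n.
    have nb : nbhs (p c) [set o : one_point_compactification nat | o = Some n].
      rewrite E /nbhs /= /one_point_nbhs /= /fmap /=.
      by rewrite nbhs_principalE; apply/principal_filterP.
    exact: (cp c _ nb).
  have /(continuous_Ko hK)/(_ c _ r0) n2 := cont_comp cq (@ndual_cont _ _ (psi n)).
  by apply: filterS2 n1 n2 => d ->.
pose N := maxn m (Num.truncn (r / 2)^-1).+1.
have n1 : \forall d \near c, (p d = None \/ exists2 n, (N <= n)%N & p d = Some n).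
  have nb : nbhs (p c) [set o : one_point_compactification nat |
      o = None \/ exists2 n, (N <= n)%N & o = Some n].
    rewrite E; exists `I_N.
      split; first by apply: finite_compact; exact: finite_II.
      by rewrite -(setCK `I_N); apply: open_closedC; exact: discrete_open.
    move=> _ [[n /= nN <-]|->]; [right|by left].
    by exists n => //; rewrite leqNgt; exact/negP.
  exact: (cp c _ nb).
have /(continuous_Ko hK)/(_ c _ r20) n2 := cont_comp cq (@ndual_cont _ _ phi).
apply: filterS2 n1 n2 => d [->|[n Nn ->]] /= phid; first by lra.
have Bn : B n (q d).
  by apply: (exhaustion_le eB _ (Bq d)); apply: leq_trans Nn; exact: leq_maxl.
have h1 : n.+1%:R^-1 < r / 2.
  rewrite invf_plt ?posrE//; apply: lt_le_trans (truncnS_gt _) _.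
  by rewrite ler_nat; apply: leq_trans (leq_maxr m _) (leq_trans Nn (leqnSn _)).
have {h1} := lt_trans (H n _ Bn) h1.
have := absval_triangle hK (ndual_fun (psi n) (q d)) (ndual_fun phi (q d))
  (ndual_fun phi (q c)).
lra.
Qed.

(** If no neighborhood given by one of the B n were contained in A, functionals outside A
would converge to phi. *)
Lemma exhausted_nbhs (phi : ndual V) A : nbhs phi A -> exists n,
  forall psi : ndual V, (forall x, B n x -> nm (psi x - phi x) < n.+1%:R^-1) -> A psi.
Proof.
move=> nA; apply: contrapT => H.
have psi_ex n : exists psi : ndual V,
    (forall x, B n x -> nm (psi x - phi x) < n.+1%:R^-1) /\ ~ A psi.
  apply: contrapT => H'; apply: H; exists n => psi Hpsi; apply: contrapT => nApsi.
  by apply: H'; exists psi.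
have [psi Hpsi] := choice psi_ex.
have [N HN] := @exhausted_seq psi phi (fun n => (Hpsi n).1) A nA.
exact: (Hpsi N).2 (HN N (leqnn N)).
Qed.

Lemma exhausted_compact_open : compact_open_dual hK V.
Proof.
move=> phi A /exhausted_nbhs[n nA]; exists (B n), n.+1%:R^-1; split=> //.
by have [] := eB.
Qed.

(** The size of phi is the infimum of the r such that phi is bounded by r on the B n with
n + 1 < 1 / r; it is a translation invariant distance to 0 for uniform convergence on
the B n. *)
Let small (r : R) (phi : ndual V) : Prop :=
  forall n, r * n.+1%:R < 1 -> forall x, B n x -> nm (phi x) <= r.
Let size_set (phi : ndual V) : set R := [set r | 0 < r /\ small r phi].
Let size (phi : ndual V) : R := inf (size_set phi).

Let size_set1 phi : size_set phi 1.
Proof. by split=> // n; rewrite mul1r ltNge ler1n. Qed.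

Let size_has_lb phi : has_lbound (size_set phi).
Proof. by exists 0 => r [/ltW]. Qed.

Let size_le phi r : 0 < r -> small r phi -> size phi <= r.
Proof. by move=> r0 sr; apply: ge_inf. Qed.

Let size_ge0 phi : 0 <= size phi.
Proof. by apply: lb_le_inf => [|r [/ltW]//]; exists 1; exact: size_set1. Qed.

Let size_lt phi r : size phi < r -> small r phi.
Proof.
move=> /(inf_lt (ex_intro _ _ (size_set1 phi)))[s [s0 Hs] sr] n rn x Bx.
apply: le_trans (ltW sr); apply: (Hs n) => //; apply: le_lt_trans rn.
by rewrite ler_wpM2r// ltW.
Qed.

Let sizeD phi psi : size (phi + psi) <= size phi + size psi.
Proof.
apply/ler_addgt0Pr => e e0; have e20 : 0 < e / 2 by rewrite divr_gt0.
have s1 : small (size phi + e / 2) phi by apply: size_lt; lra.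
have s2 : small (size psi + e / 2) psi by apply: size_lt; lra.
have -> : size phi + size psi + e = (size phi + e / 2) + (size psi + e / 2) by field.
have := size_ge0 phi; have := size_ge0 psi => p0 q0.
apply: size_le; first by lra.
move=> n; have n0 : 0 < n.+1%:R :> R by rewrite ltr0n.
rewrite mulrDl => Hn x Bx.
rewrite ndualD; apply: le_trans (absvalD _ _ _) _; apply: lerD.
  by apply: (s1 n) => //; apply: le_lt_trans Hn; rewrite lerDl mulr_ge0 ?(ltW n0)//; lra.
by apply: (s2 n) => //; apply: le_lt_trans Hn; rewrite lerDr mulr_ge0 ?(ltW n0)//; lra.
Qed.

Let sizeB phi psi : size (phi - psi) = size (psi - phi).
Proof.
have H (f g : ndual V) : size (f - g) <= size (g - f).
  apply/ler_addgt0Pr => e e0; have := size_ge0 (g - f) => s0.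
  have s1 : small (size (g - f) + e) (g - f) by apply: size_lt; lra.
  apply: size_le; first by lra.
  move=> n Hn x Bx; have := s1 n Hn x Bx; rewrite !ndualB; by rewrite absvalB.
by apply/eqP; rewrite eq_le !H.
Qed.

Lemma exhausted_metrizable : metrizable R (ndual V).
Proof.
exists (fun phi psi => size (phi - psi)); split.
- move=> phi psi; split=> [s0|->]; last first.
    apply/eqP; rewrite eq_le size_ge0 andbT; apply/ler_addgt0Pr => e e0; rewrite add0r.
    by apply: size_le => // n _ x _; rewrite subrr absval0 ltW.
  apply: ndual_ext => x; apply/eqP; rewrite -subr_eq0; apply/eqP.
  apply: (absval_eq0 (hK := hK)); apply/eqP; rewrite eq_le absval_ge0 andbT.
  apply/ler_addgt0Pr => e e0; rewrite add0r -ndualB.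
  have [n Bx] := exhaustion_cover x eB.
  pose r := Num.min e (n.+1%:R^-1 / 2).
  have r0 : 0 < r by rewrite lt_min e0 divr_gt0.
  have sr : small r (phi - psi) by apply: size_lt; rewrite s0.
  apply: (@le_trans _ _ r); last by rewrite ge_min lexx.
  apply: (sr n) => //; apply: (@le_lt_trans _ _ (n.+1%:R^-1 / 2 * n.+1%:R)).
    by rewrite ler_wpM2r// ge_min lexx orbT.
  by rewrite mulrAC mulVf// mul1r; lra.
- exact: sizeB.
- move=> phi psi chi; apply: le_trans (sizeD _ _).
  by rewrite addrA subrK.
move=> phi A; split=> [/exhausted_nbhs[n nA]|[e e0 eA]].
  have n0 := inv_succ_gt0 n; exists (n.+1%:R^-1 / 2); first by rewrite divr_gt0.
  move=> psi /=; rewrite sizeB => /size_lt s; apply: nA => x Bx.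
  have : nm (ndual_fun (psi - phi) x) <= n.+1%:R^-1 / 2.
    apply: (s n) => //; by rewrite mulrAC mulVf// mul1r; lra.
  by rewrite ndualB; move: (n.+1%:R^-1) n0 => e; lra.
have e20 : 0 < e / 2 by rewrite divr_gt0.
have [N HN] : exists N, forall n, e / 2 * n.+1%:R < 1 -> B n `<=` B N.
  exists (Num.truncn (e / 2)^-1).+1 => n Hn; apply: (exhaustion_le eB).
  rewrite -(@ler_nat R); apply: le_trans (ltW (truncnS_gt _)).
  rewrite -(@ler_pM2l _ (e / 2))// mulfV ?gt_eqF//.
  by apply: ltW; apply: le_lt_trans Hn; rewrite ler_wpM2l ?(ltW e20)// ler_nat.
have cBN : compact (B N) by have [] := eB.
apply: filterS (ndual_nbhs_compact hK phi hV cBN e20) => psi /= Hpsi.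
apply: eA => /=; rewrite sizeB; apply: (@le_lt_trans _ _ (e / 2)); last by lra.
apply: size_le => // n Hn x Bx; rewrite ndualB; apply: ltW; apply: Hpsi.
exact: HN Hn _ Bx.
Qed.

Lemma exhausted_frechet : frechet R (ndual V).
Proof.
split.
- exact: ndual_lctvs hV exhausted_compact_open.
- exact: exhausted_metrizable.
- exact: ndual_complete kV hV exhausted_compact_open.
Qed.

End exhausted.

(** * Duals of Frechet spaces are Brauner *)

Section frechet_dual.
Variables (R : realType) (K : numFieldType).
Hypothesis hK : real_or_complex R K.
Local Notation nm := (absval hK).
Local Notation inj := (ofreal hK).
Implicit Types V : preTopologicalLmodType K.

Definition fundamental V (p : nat -> V -> R) : Prop :=
  [/\ forall n, cont_seminorm hK (p n), forall n x, p n x <= p n.+1 x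
    & forall A, nbhs (0 : V) A -> exists n, forall x, p n x < 1 -> A x].

Lemma fundamental_le V p m n (x : V) : fundamental p -> (m <= n)%N -> p m x <= p n x.
Proof.
move=> [_ pi _]; elim: n => [|n IH]; first by rewrite leqn0 => /eqP ->.
rewrite leq_eqVlt => /predU1P[->//|]; rewrite ltnS => /IH H; exact: le_trans H (pi _ _).
Qed.

Lemma fundamental_null V p (x : nat -> V) : fundamental p ->
  (forall n, p n (x n) < 1) -> seq_to x 0.
Proof.
move=> fp px A nA; have [_ _ /(_ A nA)[N NA]] := fp.
exists N => n Nn; apply: NA; apply: le_lt_trans (px n); exact: fundamental_le.
Qed.

Lemma frechet_fundamental V : frechet R V -> exists p, @fundamental V p.
Proof.
move=> [lV [d [_ _ _ dn]] _].
have q_ex (n : nat) : exists q : V -> R, cont_seminorm hK q /\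
    forall x, q x < 1 -> d 0 x < n.+1%:R^-1.
  have nb : nbhs (0 : V) [set x | d 0 x < n.+1%:R^-1].
    by apply/dn; exists n.+1%:R^-1; rewrite ?invr_gt0.
  by have [q cq qn] := lctvs_cont_seminorm hK lV nb; exists q.
have [q Hq] := choice q_ex.
pose p := fix p n : V -> R := if n is n'.+1 then fun x => p n' x + q n x else q 0%N.
exists p; have cp n : cont_seminorm hK (p n).
  elim: n => [|n IH] /=; first by have [] := Hq 0%N.
  by apply: cont_seminormD => //; have [] := Hq n.+1.
have qp n x : q n x <= p n x.
  by case: n => [|n] //=; rewrite lerDr (sn_ge0 (cp n).1).
split=> // [n x|A /dn[e e0 eA]] /=; first by rewrite lerDl (sn_ge0 (Hq n.+1).1.1).
exists (Num.truncn e^-1).+1 => x px; apply: eA => /=.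
apply: lt_trans ((Hq _).2 x (le_lt_trans (qp _ _) px)) _.
rewrite invf_plt ?posrE//; apply: lt_le_trans (truncnS_gt _) _.
by rewrite ler_nat.
Qed.

Lemma frechet_linear_hk V : frechet R V -> linear_hk V.
Proof.
move=> [lV mV _]; have kV := metrizable_kspace mV.
have hV : hausdorff_space V.
  have [d [d0 dC dT dn]] := mV; move=> x y H; apply/d0/eqP; rewrite eq_le.
  have d_ge0 z w : 0 <= d z w.
    by have := dT z w z; rewrite (proj2 (d0 z z) erefl) (dC w z); lra.
  rewrite d_ge0 andbT; apply/ler_addgt0Pr => e e0; rewrite add0r.
  have e20 : 0 < e / 2 by rewrite divr_gt0.
  have nb w : nbhs w [set z | d w z < e / 2] by apply/dn; exists (e / 2).
  have [z [/= xz yz]] := H _ _ (nb x) (nb y).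
  by have := dT x z y; rewrite (dC z y); lra.
apply: linear_hkI => // C p q cC hC cp cq; first exact: lctvs_add.
exact: lctvs_scale.
Qed.

Lemma frechet_hausdorff V : frechet R V -> hausdorff_space V.
Proof.
by move=> fV; apply: (linear_hk_hausdorff hK (frechet_linear_hk fV)); have [] := fV.
Qed.

Lemma frechet_kspace V : frechet R V -> kspace V.
Proof. by move=> /frechet_linear_hk[[]]. Qed.

Section one_frechet.
Variables (V : preTopologicalLmodType K) (p : nat -> V -> R).
Hypotheses (fV : frechet R V) (fp : fundamental p).

Let lV : lctvs V. Proof. by have [] := fV. Qed.
Let hV : hausdorff_space V. Proof. exact: frechet_hausdorff fV. Qed.
Let kV : kspace V. Proof. exact: frechet_kspace fV. Qed.
Let cp n : cont_seminorm hK (p n). Proof. by have [] := fp. Qed.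

(** A compact family of functionals contained in none of these polars would take values of
absolute value at least 1 along a null sequence of points, against uniform_null. *)
Lemma polar_exhaustion : exhaustion (fun n => polar hK (p n)).
Proof.
split=> [n|n phi pphi x|C f cC hC cf].
- exact: polar_compact.
- by apply: le_trans (pphi x) _; have [] := fp.
apply: contrapT => H.
have cx_ex n : exists cx : C * V, p n cx.2 < 1 /\ 1 <= nm (ndual_fun (f cx.1) cx.2).
  apply: contrapT => H'; apply: H; exists n => c x.
  apply: (unit_ball_polar (cp n).1 (@ndual_linear _ _ (f c))) => y py.
  by rewrite leNgt; apply/negP => fy; apply: H'; exists (c, y); split=> //; exact: ltW.
have [cx Hcx] := choice cx_ex.
have x0 : seq_to (fun n => (cx n).2) 0.
  by apply: fundamental_null fp _ => n; have [] := Hcx n.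
have kCN : kspace (C * one_point_compactification nat)%type.
  apply: compact_kspace; first by apply: compact_prodT => //; exact: Noo_compact.
  by apply: hausdorff_prod => //; exact: Noo_hausdorff.
have [||N HN] := @uniform_null R K hK C
    (fun z => ndual_fun (f z.1) (seq_map (fun n => (cx n).2) 0 z.2)) cC.
- apply: (@ndual_eval _ _ _ (fun z : C * one_point_compactification nat => f z.1)
    (fun z => seq_map (fun n => (cx n).2) 0 z.2)) => //.
    by apply: (@cont_comp _ _ _ fst f) => // z; exact: cvg_fst.
  apply: (@cont_comp _ _ _ snd (seq_map (fun n => (cx n).2) 0)).
    by move=> z; exact: cvg_snd.
  exact: seq_map_cont.
- by move=> c; exact: ndual0.
by have [_] := Hcx N; have := HN (cx N).1; rewrite /= ltNge => /negP.
Qed.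

(** The members of the polar of q outside O which are bounded by 1 on S form a compact
set, and none of them is bounded by 1 on all of U; so finitely many points of U exclude
them all. *)
Let finite_step (q : V -> R) (U : set V) (S : seq V) (O : set (ndual V)) :
  cont_seminorm hK q -> open O ->
  (forall phi : ndual V, (forall x, x \in S -> nm (phi x) <= 1) ->
     (forall x, U x -> nm (phi x) <= 1) -> O phi) ->
  exists F : seq V, (forall x, x \in F -> U x) /\
    forall phi : ndual V, (forall x, x \in S ++ F -> nm (phi x) <= 1) ->
      polar hK q phi -> O phi.
Proof.
move=> cq oO H.
have clx (x : V) : closed [set phi : ndual V | nm (phi x) <= 1].
  have /continuous_closedP := @ndual_pt _ _ x.
  by move=> /(_ _ (@closed_absval_le _ _ hK 1)).
pose A : set (ndual V) := polar hK q `&`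
  (~` O `&` \bigcap_(x in [set x | x \in S]) [set phi : ndual V | nm (phi x) <= 1]).
have cA : compact A.
  apply: compact_closedI; first exact: polar_compact.
  apply: closedI; first exact: open_closedC.
  by apply: closed_bigI => x _; exact: clx.
have [||||F FU AF] := compact_directed (D := [set F : seq V | forall x, x \in F -> U x])
    (U := fun F => [set phi : ndual V | exists2 x, x \in F & ~ nm (phi x) <= 1]) cA.
- by exists [::].
- move=> F _; rewrite openE => phi [x xF phix].
  have : open (~` [set psi : ndual V | nm (psi x) <= 1]) by exact: closed_openC.
  rewrite openE => /(_ phi phix); apply: filterS => psi psix; by exists x.
- move=> F G FU GU; exists (F ++ G) => [x|phi [] [x xF phix]].
  + by rewrite mem_cat => /orP[/FU|/GU].
  + by exists x => //; rewrite mem_cat xF.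
  + by exists x => //; rewrite mem_cat xF orbT.
- move=> phi [pphi [nO Sphi]]; apply: contrapT => nF; apply: nO; apply: H => // x Ux.
  apply: contrapT => phix; apply: nF; exists [:: x].
    by move=> y; rewrite inE => /eqP ->.
  by exists x; rewrite ?inE.
exists F; split=> // phi SF pphi; apply: contrapT => nO.
have [|x xF] := AF phi.
  by split=> //; split=> // x xS; apply: SF; rewrite mem_cat xS.
by apply; apply: SF; rewrite mem_cat xF orbT.
Qed.

(** Near coverings: what covers x0 covers S up to a compact subset. *)
Lemma compact_tail (X : topologicalType) (S : set X) (x0 : X) : S x0 ->
  (forall U, nbhs x0 U -> exists C, [/\ compact C, C `<=` S & S `<=` U `|` C]) ->
  compact S.
Proof.
move=> Sx0 H; apply/compact_near_coveringP => I F P FF HP.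
have [[U W] [/= nU FW] UW] := HP x0 Sx0.
have [C [/compact_near_coveringP cC CS SUC]] := H U nU.
have := cC I F P FF (fun x Cx => HP x (CS x Cx)).
apply: filterS2 FW => i Wi PC x /SUC[Ux|Cx]; last exact: PC.
exact: (UW (x, i)).
Qed.

(** The Banach-Dieudonne theorem: a neighborhood O of 0 for the k-topology contains
the polar of a null sequence, assembled from finite subsets of the unit balls of the
seminorms p n in such a way that the polar of what has been chosen so far, intersected
with the polar of p n, is contained in O. *)
Theorem banach_dieudonne : compact_open_dual hK V.
Proof.
move=> phi0 A0 nA0.
have n0 : nbhs (0 : ndual V) [set psi | A0 (psi + phi0)].
  have := linear_hk_translate (x := phi0) (ndual_linear_hk hK hV) (x0 := 0).
  by move=> /(_ A0); rewrite add0r; apply.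
move: n0; rewrite nbhsE => -[O [oO O0] OA].
pose good n (S : seq V) := forall phi : ndual V, (forall x, x \in S -> nm (phi x) <= 1) ->
  polar hK (p n) phi -> O phi.
have base : exists S, good 0%N S.
  have [|F [_ HF]] := @finite_step (p 0%N) setT [::] O (cp 0%N) oO.
    move=> phi _ H; suff -> : phi = 0 by [].
    apply: ndual_ext => x; apply: (absval_eq0 (hK := hK)).
    apply/eqP; rewrite eq_le absval_ge0 andbT.
    apply: (unit_ball_polar (p := fun=> 0) _ (@ndual_linear _ _ phi)) => //.
      by split=> [*|*]; rewrite ?addr0 ?mulr0.
    by move=> y _; exact: H.
  by exists F.
have step n S : good n S -> exists S', [/\ good n.+1 S', {subset S <= S'}
    & forall x, x \in S' -> x \in S \/ p n x < 1].
  move=> gS; have [|F [HF HO]] := @finite_step (p n.+1) [set x | p n x < 1] S O (cp n.+1) oO.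
    move=> phi Sphi pphi; apply: gS => // x.
    exact: (unit_ball_polar (cp n).1 (@ndual_linear _ _ phi)).
  exists (S ++ F); split=> //.
    by move=> x xS; rewrite mem_cat xS.
  by move=> x; rewrite mem_cat => /orP[xS|/HF]; [left|right].
pose T := {nS : nat * seq V | good nS.1 nS.2}.
have [S0 gS0] := base.
have next_ex (t : T) : exists t' : T, [/\ (sval t').1 = (sval t).1.+1,
    {subset (sval t).2 <= (sval t').2}
    & forall x, x \in (sval t').2 -> x \in (sval t).2 \/ p (sval t).1 x < 1].
  case: t => -[n S] /= gS; have [S' [gS' SS' S'p]] := step n S gS.
  by exists (exist _ (n.+1, S') gS').
have [next Hnext] := choice next_ex.
pose tt n : T := iter n next (exist _ (0%N, S0) gS0).
have ttn n : (sval (tt n)).1 = n.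
  by elim: n => //= n IH; have [-> _ _] := Hnext (tt n); rewrite IH.
pose S n := (sval (tt n)).2.
have gS n : good n (S n) by have := svalP (tt n); rewrite ttn.
have Sinc m n : (m <= n)%N -> {subset S m <= S n}.
  elim: n => [|n IH]; first by rewrite leqn0 => /eqP ->.
  rewrite leq_eqVlt => /predU1P[->//|]; rewrite ltnS => /IH H x /H.
  by have [_ + _] := Hnext (tt n); apply.
have Stail n m x : x \in S m -> x \in S n \/ p n x < 1.
  have [mn|/ltnW nm] := leqP m n; first by move=> /(Sinc _ _ mn); left.
  elim: m nm x => [|m IH]; first by rewrite leqn0 => /eqP -> x; left.
  rewrite leq_eqVlt => /predU1P[<- x ?|]; first by left.
  rewrite ltnS => nm x; have [_ _ /(_ x)] := Hnext (tt m); rewrite ttn => H /H[/IH|].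
    exact.
  by move=> px; right; apply: le_lt_trans px; exact: fundamental_le.
pose Kset : set V := [set x | x = 0 \/ exists n, x \in S n].
exists Kset, 1; split=> //.
  apply: (@compact_tail _ _ 0); first by left.
  move=> U nU; have [_ _ /(_ U nU)[n pU]] := fp.
  exists [set x | x \in S n]; split; first by apply: finite_compact; exact: finite_seq.
    by move=> x xS; right; exists n.
  move=> x [->|[m /(Stail n)[xS|px]]]; [|by right|by left; exact: pU].
  by left; exact: nbhs_singleton.
move=> psi Hpsi; rewrite -[psi](subrK phi0); apply: OA.
have [_ c1] := cont_seminorm_linear hK (@ndual_cont _ _ (psi - phi0))
  (@ndual_linear _ _ (psi - phi0)).
have [_ _ /(_ _ c1)[n pn]] := fp.
apply: (gS n); first by move=> x xS; apply: ltW; apply: Hpsi; right; exists n.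
move=> x; apply: (unit_ball_polar (cp n).1 (@ndual_linear _ _ _)) => y /pn; exact: ltW.
Qed.

Lemma frechet_dual_brauner : brauner (ndual V).
Proof.
split.
- exact: (ndual_linear_hk hK hV).
- apply: exhaustion_hemicompact polar_exhaustion; first exact: ndual_kspace.
  exact: ndual_hausdorff.
- exact: ndual_lctvs hV banach_dieudonne.
- exact: ndual_complete kV hV banach_dieudonne.
Qed.

End one_frechet.
End frechet_dual.

(** * Embeddings, closed subspaces and completions *)

Section embeddings.
Variables (R : realType) (K : numFieldType).
Hypothesis hK : real_or_complex R K.
Local Notation nm := (absval hK).
Local Notation inj := (ofreal hK).
Implicit Types E F : preTopologicalLmodType K.

Section one_embedding.
Variables (E F : preTopologicalLmodType K) (f : E -> F).
Hypotheses (lf : linear f) (ef : closed_embedding f).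

Lemma embedding_nbhs (x : E) (A : set E) : nbhs x A ->
  exists2 O, nbhs (f x) O & f @^-1` O `<=` A.
Proof.
rewrite nbhsE => -[U [oU Ux] UA]; have [_ fo _] := ef.
have [O oO UO] := (fo U).1 oU; exists O; last by rewrite -UO.
by apply: open_nbhs_nbhs; split=> //; rewrite UO in Ux.
Qed.

Lemma embedding_lctvs : lctvs F -> lctvs E.
Proof.
move=> lF; have cf := cemb_cont ef; have [_ _ [B Bcvx [Bopen Bb]]] := lF.
split.
- apply: (cemb_to ef).
  have -> : f \o (fun xy : E * E => xy.1 + xy.2) = fun xy => f xy.1 + f xy.2.
    by apply/funext => xy /=; rewrite linear_funD.
  apply: lctvs_add => //.
    by apply: (@cont_comp _ _ _ fst f) => // z; exact: cvg_fst.
  by apply: (@cont_comp _ _ _ snd f) => // z; exact: cvg_snd.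
- apply: (cemb_to ef).
  have -> : f \o (fun ax : K^o * E => ax.1 *: ax.2) = fun ax => ax.1 *: f ax.2.
    by apply/funext => ax /=; rewrite linear_funZ.
  apply: lctvs_scale => //; first by move=> z; exact: cvg_fst.
  by apply: (@cont_comp _ _ _ snd f) => // z; exact: cvg_snd.
- exists [set b | exists2 c, B c & b = f @^-1` c].
    move=> _ /set_mem[c Bc ->] x y k /set_mem cx /set_mem cy; apply/mem_set.
    have := Bcvx c (mem_set Bc) (f x) (f y) k (mem_set cx) (mem_set cy).
    move=> /set_mem H.
    suff : c (f ((k%:num : K) *: (x : E) + (1 - k%:num) *: (y : E))) by [].
    rewrite (linear_funD _ _ lf) !(linear_funZ _ _ lf); exact: H.
  split.
    by move=> _ [c Bc ->]; move/continuousP : cf; apply; exact: Bopen.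
  move=> x A /embedding_nbhs[O nO OA]; have [c [Bc cx] cO] := Bb (f x) O nO.
  by exists (f @^-1` c); [split=> //; exists c|move=> y fy; apply: OA; exact: cO].
Qed.

Lemma embedding_metrizable : metrizable R F -> metrizable R E.
Proof.
move=> [d [d0 dC dT dn]]; exists (fun x y => d (f x) (f y)); split=> //.
- move=> x y; split=> [/d0|->]; last exact/d0.
  by have [finj _ _] := ef; exact: finj.
- move=> x A; split=> [/embedding_nbhs[O /dn[e e0 eO] OA]|[e e0 eA]].
    by exists e => // y fy; apply: OA; exact: eO.
  apply: filterS eA _.
  have nb : nbhs (f x) [set y | d (f x) y < e] by apply/dn; exists e.
  exact: (cemb_cont ef nb).
Qed.

Lemma embedding_complete : tvs_complete F -> tvs_complete E.
Proof.
move=> FC G GG GC; have [finj _ cr] := ef.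
have f0 : f 0 = 0 by exact: linear_fun0.
have [|y Gy] := FC (f @ G) (fmap_proper_filter f GG).
  move=> U nU.
  have nU' : nbhs (0 : E) (f @^-1` U) by apply: (cemb_cont ef); rewrite f0.
  have [A GA HA] := GC _ nU'; exists (f @` A).
    by apply: (@filterS _ G _ A) => // x Ax; exists x.
  by move=> _ _ [x Ax <-] [z Az <-]; rewrite -linear_funB//; exact: HA.
have [x _ fx] : range f y.
  apply: cr => N /Gy GN; have [x Nx] := @filter_ex _ G _ (f @^-1` N) GN.
  by exists (f x); split=> //; exists x.
exists x => A /embedding_nbhs[O]; rewrite fx => /Gy GO OA.
exact: (@filterS _ G _ (f @^-1` O)).
Qed.

Lemma embedding_frechet : frechet R F -> frechet R E.
Proof.
move=> [lF mF FC]; split; [exact: embedding_lctvs|exact: embedding_metrizable|].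
exact: embedding_complete.
Qed.

End one_embedding.

(** The infimum q of p on the cosets of S is a seminorm which vanishes on S; a functional
dominated by q with value q e at e separates e from S. *)
Lemma closed_separation E (S : submod E) (e : E) : lctvs E -> closed (sm_set S) ->
  ~ sm_set S e -> exists L : ndual E, (forall s, sm_set S s -> L s = 0) /\ L e <> 0.
Proof.
move=> lE cS nSe.
have ne : nbhs e (~` sm_set S).
  by apply: open_nbhs_nbhs; split=> //; exact: closed_openC.
have /(nbhs_cont_seminorm hK _ _ lE)[p cp pe] := ne; have hp := cp.1.
pose D x : set R := [set p (x - s) | s in sm_set S].
pose q x : R := inf (D x).
have Dlb x : has_lbound (D x) by exists 0 => _ [s _ <-]; exact: sn_ge0.
have D0 x : D x !=set0 by exists (p (x - 0)), 0 => //; exact: sm0.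
have q_le x s : sm_set S s -> q x <= p (x - s) by move=> Ss; apply: ge_inf => //; exists s.
have q_lt x r : q x < r -> exists2 s, sm_set S s & p (x - s) < r.
  by move=> /(inf_lt (D0 x))[_ [s Ss <-] sr]; exists s.
have q_ge0 x : 0 <= q x by apply: lb_le_inf => // _ [s _ <-]; exact: sn_ge0.
have qZ a x : q (a *: x) <= nm a * q x.
  have [->|a0] := eqVneq a 0.
    rewrite scale0r absval0 mul0r; apply: le_trans (q_le 0 0 (sm0 S)) _.
    by rewrite subrr (sn0 hp).
  have na := absval_gt0 hK a0; rewrite mulrC -ler_pdivrMr//.
  apply/ler_addgt0Pr => r r0; rewrite ler_pdivrMr//.
  have [|s Ss ps] := q_lt x (q x + r); first by lra.
  have Sas : sm_set S (a *: s) by have := sm_lin a Ss (sm0 S); rewrite addr0.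
  apply: le_trans (q_le _ _ Sas) _; rewrite -scalerBr (snZ hp) mulrC.
  by rewrite ler_pM2r// ltW.
have hq : seminorm hK q.
  split=> [x y|a x].
    apply/ler_addgt0Pr => r r0; have r20 : 0 < r / 2 by rewrite divr_gt0.
    have [|s Ss ps] := q_lt x (q x + r / 2); first by lra.
    have [|t St pt] := q_lt y (q y + r / 2); first by lra.
    have Sst : sm_set S (s + t) by have := sm_lin 1 Ss St; rewrite scale1r.
    apply: le_trans (q_le _ _ Sst) _; rewrite opprD addrACA.
    by have := snD hp (x - s) (y - t); lra.
  apply/eqP; rewrite eq_le qZ /=; have [->|a0] := eqVneq a 0.
    by rewrite absval0 mul0r.
  have := qZ a^-1 (a *: x); rewrite scalerA mulVf// scale1r absvalV.
  by rewrite [_^-1 * _]mulrC ler_pdivlMr ?absval_gt0// mulrC.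
have q_le_p x : q x <= p x by have := q_le x 0 (sm0 S); rewrite subr0.
have [g [lg gq ge]] := hahn_banach_point hq e.
have cg : continuous g.
  by apply: (dominated_continuous lE cp lg) => x; apply: le_trans (gq x) _.
exists (mkndual cg lg); split=> [s Ss|].
  apply: (absval_eq0 (hK := hK)); apply/eqP; rewrite eq_le absval_ge0 andbT.
  apply: le_trans (gq s) _; apply: le_trans (q_le s s Ss) _.
  by rewrite subrr (sn0 hp).
rewrite -[ndual_fun _ e]/(g e) ge => /eqP; rewrite fmorph_eq0 => /eqP q0.
have [|s Ss ps] := q_lt e 1; first by rewrite q0.
by apply: (pe s) => //; rewrite (snB hp).
Qed.

Lemma closure_submod E (S : submod E) : lctvs E ->
  exists T : submod E, sm_set T = closure (sm_set S).
Proof.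
move=> lE.
have c0 : closure (sm_set S) 0 by apply: subset_closure; exact: sm0.
suff cl a x y : closure (sm_set S) x -> closure (sm_set S) y ->
    closure (sm_set S) (a *: x + y) by exists (Submod c0 cl).
move=> Sx Sy N nN.
have c1 : continuous (fun z : E * E => (a : K^o) *: z.1 + z.2).
  apply: (@lctvs_add _ E) => //; last by move=> z; exact: cvg_snd.
  apply: (@lctvs_scale _ E) => //; first exact: cst_cont.
  by move=> z; exact: cvg_fst.
have [[P Q] [/= Px Qy] PQ] := c1 (x, y) N nN.
have [x' [Sx' Px']] := Sx _ Px; have [y' [Sy' Qy']] := Sy _ Qy.
exists (a *: x' + y'); split; first exact: sm_lin.
exact: (PQ (x', y')).
Qed.

End embeddings.

Section paired_duals.
Variables (R : realType) (K : numFieldType).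
Hypothesis hK : real_or_complex R K.
Local Notation nm := (absval hK).
Variable X : pairedHK K.

Definition scalar_id : ndual (scalL hK) :=
  @mkndual K K^o id (fun x U h => h) (fun _ _ _ => erefl).

(** The morphisms from X to the scalars are the members of the paired dual of X, with the
same topology. *)
Definition dual_incl (t : dualL hK X) : ndual X :=
  mkndual (@ihom_cont _ _ _ (t : ihom X (scalL hK)))
    (@ihom_linear _ _ _ (t : ihom X (scalL hK))).

Lemma dual_inclE (t : dualL hK X) x : dual_incl t x = ihom_fun (t : ihom X (scalL hK)) x.
Proof. by []. Qed.

Lemma dual_incl_lin : linear dual_incl.
Proof.
move=> a s t; apply: ndual_ext => x; rewrite dual_inclE.
by rewrite (ihomD (a *: s : ihom X (scalL hK)) t) ihomZ.
Qed.

Section lift.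
Variables (phi : ndual X) (Xphi : sm_set (pdual X) phi).

Let lift_dual (psi : ndual (scalL hK)) : sm_set (pdual (scalL hK)) psi ->
  in_dual (fun x : X => psi (phi x : scalL hK)).
Proof.
move=> _; exists (ndual_fun psi (1 : K^o) *: phi).
  by have := sm_lin (ndual_fun psi (1 : K^o)) Xphi (sm0 (pdual X)); rewrite addr0.
move=> x; rewrite ndualZ.
have := linear_funZ (phi x : K) (1 : K^o) (ndual_linear psi).
by rewrite /GRing.scale /= mulr1 => ->; rewrite mulrC.
Qed.

Definition dual_lift : dualL hK X :=
  @mkihom K X (scalL hK) phi (@ndual_cont _ _ phi) (@ndual_linear _ _ phi) lift_dual.

Lemma dual_liftK : dual_incl dual_lift = phi.
Proof. exact: ndual_ext. Qed.
End lift.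

Lemma dual_incl_pdual t : sm_set (pdual X) (dual_incl t).
Proof.
have [psi Xpsi E] := @ihom_dualP K X (scalL hK) t scalar_id I.
by have <- : psi = dual_incl t by exact: ndual_ext.
Qed.

Lemma dual_incl_embedding : closed_embedding dual_incl.
Proof.
split.
- move=> s t E; apply: ihom_ext => x.
  by have := congr1 (fun h => ndual_fun h x) E.
- have vE : (fun t => set_val (dual_incl t) : cmap X K^o) = set_val.
    by apply/funext => t; exact: cmap_inj.
  move=> U; split=> [[O oO <-]|[_ [O oO <-] ->]].
    exists ((@set_val (cmap X K^o) [set f : cmap X K^o | linear f]) @^-1` O).
      by exists O.
    by rewrite -[RHS]/((fun t => set_val (dual_incl t) : cmap X K^o) @^-1` O) vE.
  rewrite -[X in open X]/((fun t => set_val (dual_incl t) : cmap X K^o) @^-1` O) vE.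
  by exists O.
- rewrite (_ : range _ = sm_set (pdual X)); first exact: pdual_closed.
  apply/seteqP; split=> [_ [t _ <-]|phi Xphi]; first exact: dual_incl_pdual.
  by exists (dual_lift Xphi) => //; exact: dual_liftK.
Qed.

(** By Hahn-Banach in the dual: a functional vanishing on the paired dual is the evaluation
at a point of X, and this point is 0 because the paired dual separates the points. *)
Lemma pdual_full : lctvs X -> tvs_complete X -> lctvs (ndual X) ->
  forall phi, sm_set (pdual X) phi.
Proof.
move=> lX XC lD phi; apply: contrapT => nphi.
have [L [L0 Lphi]] := closed_separation hK lD (@pdual_closed _ X) nphi.
have [x xE] := bidual_representable hK lX (@paired_hausdorff _ X) L XC.
apply: Lphi; rewrite xE; suff -> : x = 0 by rewrite ndual0.
by apply: paired_sep => psi Xpsi; rewrite ndual0 -xE L0.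
Qed.

End paired_duals.

Section completions.
Variables (R : realType) (K : numFieldType).
Hypothesis hK : real_or_complex R K.
Local Notation nm := (absval hK).
Local Notation inj := (ofreal hK).
Variables (E P Q : preTopologicalLmodType K) (j : E -> P) (k : E -> Q).
Hypotheses (hj : completion j) (hk : completion k).

Let lP : lctvs P. Proof. by have [[]] := hj. Qed.
Let lQ : lctvs Q. Proof. by have [[]] := hk. Qed.
Let hQ : hausdorff_space Q. Proof. by have [[_ []]] := hk. Qed.
Let QC : tvs_complete Q. Proof. by have [[_ []]] := hk. Qed.
Let lj : linear j. Proof. by have [] := hj. Qed.
Let lk : linear k. Proof. by have [] := hk. Qed.

Let dense (x : P) (A : set P) : nbhs x A -> exists z, A (j z).
Proof.
move=> nA; have [_ _ _ cl] := hj; have : closure (range j) x by rewrite cl.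
by move=> /(_ A nA)[_ [[z _ <-] Az]]; exists z.
Qed.

Let dominated (q : Q -> R) : cont_seminorm hK q -> exists2 p : P -> R, cont_seminorm hK p &
  forall z, q (k z) <= p (j z).
Proof.
move=> cq; have [hq] := cq; rewrite nbhsE => -[O [oO O0] Oq].
have [_ _ jo _] := hj; have [_ _ ko _] := hk.
have /jo[O' oO' E'] : open (k @^-1` O) by apply/ko; exists O.
have n0 : nbhs (0 : P) O'.
  apply: open_nbhs_nbhs; split=> //.
  have : (k @^-1` O) 0 by rewrite /preimage /= linear_fun0.
  by rewrite E' /preimage /= linear_fun0.
have [p cp pO] := lctvs_cont_seminorm hK lP n0; exists p => //.
have hpj : seminorm hK (p \o j).
  by split=> [x y|a x] /=; rewrite ?linear_funD ?linear_funZ//;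
    [exact: snD cp.1 _ _|exact: snZ cp.1 _ _].
have hqk : seminorm hK (q \o k).
  by split=> [x y|a x] /=; rewrite ?linear_funD ?linear_funZ//;
    [exact: snD hq _ _|exact: snZ hq _ _].
apply: (unit_ball_le hpj hqk) => z /pO; rewrite -[O' _]/((j @^-1` O') z) -E' => /Oq /=.
exact: ltW.
Qed.

Let ext_ex (x : P) : exists y : Q, forall q p, cont_seminorm hK q -> cont_seminorm hK p ->
  forall r, 0 < r -> exists z, p (j z - x) < r /\ q (k z - y) < r.
Proof.
pose F := filter_from (nbhs x) (fun A => k @` (j @^-1` A)).
have FF : ProperFilter F.
  apply: filter_from_proper; last first.
    by move=> A /dense[z Az]; exists (k z), z.
  apply: filter_from_filter; first by exists setT; exact: filterT.
  move=> A B nA nB; exists (A `&` B); first exact: filterI.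
  by move=> _ [z [Az Bz] <-]; split; exists z.
have [U nU|y Fy] := QC FF.
  have [q cq qU] := lctvs_cont_seminorm hK lQ nU; have [p cp pq] := dominated cq.
  have h0 : 0 < 1 / 2 :> R by rewrite divr_gt0.
  exists (k @` (j @^-1` [set y | p (y - x) < 1 / 2])).
    by exists [set y | p (y - x) < 1 / 2] => //; exact: cont_seminorm_lt.
  move=> _ _ [z /= zx <-] [w /= wx <-]; apply: qU; rewrite -linear_funB//.
  apply: le_lt_trans (pq _) _; rewrite linear_funB//.
  by have := sn_triangle cp.1 (j z) x (j w); rewrite (snB cp.1 x); lra.
exists y => q p cq cp r r0.
have [A nA Aq] := Fy _ (cont_seminorm_lt y lQ cq r0).
have [z [Az pz]] := dense (filterI nA (cont_seminorm_lt x lP cp r0)).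
by exists z; split=> //; apply: Aq; exists z.
Qed.

(** The images under k of the preimages under j of the neighborhoods of x form a Cauchy
filter, because every seminorm of Q, pulled back to E, is dominated by one pulled back from
P; G x is its limit. *)
Lemma completion_extend : exists G : clin P Q, forall z, G (j z) = k z.
Proof.
have [G HG] := choice ext_ex.
have Q0 (y : Q) : (forall q, cont_seminorm hK q -> q y = 0) -> y = 0.
  exact: (hausdorff_seminorm_eq0 lQ hQ).
have lG : linear G.
  move=> a x y; apply/eqP; rewrite -subr_eq0; apply/eqP/Q0 => q cq.
  have hq := cq.1; have [p cp pq] := dominated cq; have hp := cp.1.
  apply/eqP; rewrite eq_le (sn_ge0 hq) andbT; apply/ler_addgt0Pr => e e0; rewrite add0r.
  have na := absval_ge0 hK a.
  (* The error is bounded by r, twice, and by p at z1 - (a z2 + z3), which is at most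
     r + (nm a r + r), plus nm a r. *)
  pose r := e / (2 * nm a + 4).
  have r0 : 0 < r by rewrite divr_gt0//; lra.
  have rE : r * (2 * nm a + 4) = e by rewrite /r divfK// gt_eqF//; lra.
  have [z1 [p1 q1]] := HG (a *: x + y) q p cq cp r r0.
  have [z2 [p2 q2]] := HG x q p cq cp r r0.
  have [z3 [p3 q3]] := HG y q p cq cp r r0.
  have -> : G (a *: x + y) - (a *: G x + G y) =
    - (k z1 - G (a *: x + y)) + (k (z1 - (a *: z2 + z3)) + (a *: (k z2 - G x) + (k z3 - G y))).
    rewrite (linear_funB z1 _ lk) lk scalerBr opprB [a *: k z2 - _ + _]addrACA -opprD.
    by rewrite [k z1 - _ + _]addrA subrK addrA subrK.
  have : p (j (z1 - (a *: z2 + z3))) <= r + (nm a * r + r).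
    have -> : j (z1 - (a *: z2 + z3)) =
       (j z1 - (a *: x + y)) - (a *: (j z2 - x) + (j z3 - y)).
      rewrite (linear_funB z1 _ lj) lj scalerBr [a *: j z2 - _ + _]addrACA -opprD opprB.
      by rewrite addrA subrK.
    apply: le_trans (snD hp _ _) _; rewrite (snN hp); apply: lerD; first exact: ltW.
    apply: le_trans (snD hp _ _) _; rewrite (snZ hp); apply: lerD; last exact: ltW.
    by rewrite ler_wpM2l// ltW.
  have := pq (z1 - (a *: z2 + z3)).
  have := snD hq (- (k z1 - G (a *: x + y)))
    (k (z1 - (a *: z2 + z3)) + (a *: (k z2 - G x) + (k z3 - G y))).
  have := snD hq (k (z1 - (a *: z2 + z3))) (a *: (k z2 - G x) + (k z3 - G y)).
  have := snD hq (a *: (k z2 - G x)) (k z3 - G y).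
  have : nm a * q (k z2 - G x) <= nm a * r by rewrite ler_wpM2l// ltW.
  rewrite (snZ hq) (snN hq); lra.
have bound q p : cont_seminorm hK q -> cont_seminorm hK p -> (forall z, q (k z) <= p (j z)) ->
    forall x, q (G x) <= p x.
  move=> cq cp pq x; apply/ler_addgt0Pr => e e0.
  have e20 : 0 < e / 2 by rewrite divr_gt0.
  have [z [pz qz]] := HG x q p cq cp _ e20.
  have := snD cq.1 (G x - k z) (k z); rewrite subrK (snB cq.1 (G x)).
  have := snD cp.1 (j z - x) x; rewrite subrK.
  by have := pq z; lra.
have cG : continuous G.
  move=> x A /(nbhs_cont_seminorm hK _ _ lQ)[q cq qA]; have [p cp pq] := dominated cq.
  apply: filterS (cont_seminorm_lt x lP cp ltr01) => y /= yx; apply: qA.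
  by rewrite -linear_funB//; apply: le_lt_trans yx; exact: bound.
exists (Clin cG lG) => z /=; apply/eqP; rewrite -subr_eq0; apply/eqP/Q0 => q cq.
have [p cp pq] := dominated cq.
apply/eqP; rewrite eq_le (sn_ge0 cq.1) andbT; apply/ler_addgt0Pr => e e0; rewrite add0r.
have e20 : 0 < e / 2 by rewrite divr_gt0.
have [w [pw qw]] := HG (j z) q p cq cp _ e20.
have := pq (z - w); rewrite !linear_funB//.
have := sn_triangle cq.1 (G (j z)) (k w) (k z).
rewrite (snB cq.1 (G (j z)) (k w)) (snB cq.1 (k w) (k z)) (snB cp.1 (j z)); lra.
Qed.

End completions.

Section completion_unique.
Variables (R : realType) (K : numFieldType).
Hypothesis hK : real_or_complex R K.
Variables (E P Q : preTopologicalLmodType K) (j : E -> P) (k : E -> Q).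
Hypotheses (hj : completion j) (hk : completion k).

Lemma completion_unique : exists (f : clin P Q) (g : clin Q P),
  [/\ cancel f g, cancel g f & forall z, f (j z) = k z].
Proof.
have ext_id (P' : preTopologicalLmodType K) (j' : E -> P') (G : clin P' P') :
    completion j' -> (forall z, G (j' z) = j' z) -> forall x, G x = x.
  move=> [[_ [hP _]] _ _ cl] Gj x.
  have cG : closed [set x | G x = x].
    by apply: closed_eqset_T2 => //; [exact: clin_cont|move=> ? ?].
  have : closure (range j') x by rewrite cl.
  move=> clx; apply: cG => N /clx[_ [[z _ <-] Nz]].
  by exists (j' z); split=> //; exact: Gj.
have [f fE] := completion_extend hK hj hk.
have [g gE] := completion_extend hK hk hj.
exists f, g; split=> // x.
  by apply: (ext_id _ _ (clin_comp g f) hj) => z; rewrite /= fE gE.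
by apply: (ext_id _ _ (clin_comp f g) hk) => z; rewrite /= gE fE.
Qed.

End completion_unique.

(** * Bilinear maps and the projective tensor product *)

Section bilinear.
Variables (R : realType) (K : numFieldType).
Hypothesis hK : real_or_complex R K.
Local Notation nm := (absval hK).
Local Notation inj := (ofreal hK).
Variables (V W : preTopologicalLmodType K).
Hypotheses (lV : lctvs V) (lW : lctvs W).
Variables (p : V -> R) (q : W -> R).
Hypotheses (cp : cont_seminorm hK p) (cq : cont_seminorm hK q).

Definition dominated_bilinear (b : V -> W -> K^o) : Prop :=
  @bilinear_map K V W K^o b /\ forall x y, nm (b x y) <= p x * q y.

(** Domination makes the family equicontinuous, so that pointwise continuity in z is
enough. *)
Lemma dominated_bilinear_cont (Z : topologicalType) (b : Z -> V -> W -> K^o)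
    (u : Z -> V) (w : Z -> W) :
  (forall z, dominated_bilinear (b z)) ->
  (forall x y, continuous (fun z => b z x y : K^o)) ->
  continuous u -> continuous w -> continuous (fun z => b z (u z) (w z) : K^o).
Proof.
move=> hb cb cu cw; apply/(continuous_Ko hK) => z r r0.
have p0 := sn_ge0 cp.1 (u z); have q0 := sn_ge0 cq.1 (w z).
have d1 : 0 < r / (3 * (q (w z) + 1)) by rewrite divr_gt0//; lra.
have d2 : 0 < r / (3 * (p (u z) + 1)) by rewrite divr_gt0//; lra.
have d3 : 0 < r / 3 by rewrite divr_gt0.
have n1 : \forall t \near z, p (u t - u z) < r / (3 * (q (w z) + 1)).
  exact: cu z _ (cont_seminorm_lt (u z) lV cp d1).
have n2 : \forall t \near z, q (w t - w z) < 1 /\ q (w t - w z) < r / (3 * (p (u z) + 1)).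
  exact: filterI (cw z _ (cont_seminorm_lt (w z) lW cq ltr01))
    (cw z _ (cont_seminorm_lt (w z) lW cq d2)).
have n3 := proj1 (continuous_Ko hK _) (cb (u z) (w z)) z _ d3.
apply: filterS3 n1 n2 n3 => t /= h1 [h2 h3] h4.
have [[bl br] bpq] := hb t.
have E : b t (u t) (w t) - b z (u z) (w z) = b t (u t - u z) (w t) +
    b t (u z) (w t - w z) + (b t (u z) (w z) - b z (u z) (w z)).
  rewrite (linear_funB _ _ (bl (w t))) (linear_funB _ _ (br (u z))).
  have telescope (A B C D : K) : A - D = A - B + (B - C) + (C - D) by ring.
  exact: telescope.
have qt : q (w t) <= q (w z) + 1.
  by have := snD cq.1 (w t - w z) (w z); rewrite subrK; lra.
have b1 : nm (b t (u t - u z) (w t)) <= r / 3.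
  apply: le_trans (bpq _ _) _.
  have -> : r / 3 = r / (3 * (q (w z) + 1)) * (q (w z) + 1).
    by field; rewrite gt_eqF//; lra.
  by apply: ler_pM => //; [exact: sn_ge0 cp.1 _|exact: sn_ge0 cq.1 _|exact: ltW].
have b2 : nm (b t (u z) (w t - w z)) <= r / 3.
  apply: le_trans (bpq _ _) _.
  have -> : r / 3 = (p (u z) + 1) * (r / (3 * (p (u z) + 1))).
    by field; rewrite gt_eqF//; lra.
  by apply: ler_pM => //; [exact: sn_ge0 cq.1 _|lra|exact: ltW].
rewrite E.
have := absvalD hK (b t (u t - u z) (w t) + b t (u z) (w t - w z))
  (b t (u z) (w z) - b z (u z) (w z)).
have := absvalD hK (b t (u t - u z) (w t)) (b t (u z) (w t - w z)).
lra.
Qed.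

Let dom : set (ptw K (V * W)%type) :=
  [set g | dominated_bilinear (fun x y => g (x, y))].

Lemma compact_dominated : compact dom.
Proof.
have -> : dom = [set g : ptw K (V * W)%type | forall xy, nm (g xy) <= p xy.1 * q xy.2] `&`
   (\bigcap_(t in [set: K * V * V * W]) [set g : ptw K (V * W)%type |
     g (t.1.1.1 *: t.1.1.2 + t.1.2, t.2) =
     t.1.1.1 *: (g (t.1.1.2, t.2) : K^o) + g (t.1.2, t.2)] `&`
   \bigcap_(t in [set: K * W * W * V]) [set g : ptw K (V * W)%type |
     g (t.2, t.1.1.1 *: t.1.1.2 + t.1.2) =
     t.1.1.1 *: (g (t.2, t.1.1.2) : K^o) + g (t.2, t.1.2)]).
  apply/seteqP; split=> [g [[gl gr] gpq]|g [gpq [gl gr]]].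
    split; first by move=> [x y]; exact: gpq.
    split; first by move=> [[[a x] x'] y] _; exact: gl.
    by move=> [[[a y] y'] x] _; exact: gr.
  split; last by move=> x y; exact: (gpq (x, y)).
  split; first by move=> y a x x'; exact: (gl (a, x, x', y)).
  by move=> x a y y'; exact: (gr (a, y, y', x)).
apply: compact_closedI; first exact: ptw_compact.
by apply: closedI; apply: closed_bigI => t _; exact: ptw_closed_linear.
Qed.

Definition proj_seminorm (z : ptensor V W) : R :=
  inf [set \sum_(u <- s) p u.1 * q u.2 | s in [set s | tclass s = z]].

Let reps (z : ptensor V W) : set R :=
  [set \sum_(u <- s) p u.1 * q u.2 | s in [set s | tclass s = z]].

Let pq_ge0 s : 0 <= \sum_(u <- s) p u.1 * q u.2.
Proof.
apply: sumr_ge0 => u _; apply: mulr_ge0; [exact: sn_ge0 cp.1 _|exact: sn_ge0 cq.1 _].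
Qed.

Lemma treprK (z : ptensor V W) : tclass (trepr z) = z.
Proof. exact: reprK. Qed.

Let reps0 z : reps z !=set0.
Proof. by eexists; exists (trepr z); [exact: treprK|]. Qed.

Let proj_le s : proj_seminorm (tclass s) <= \sum_(u <- s) p u.1 * q u.2.
Proof. by apply: ge_inf; [exists 0 => _ [t _ <-]|exists s]. Qed.

Lemma proj_lt z r : proj_seminorm z < r ->
  exists2 s, tclass s = z & \sum_(u <- s) p u.1 * q u.2 < r.
Proof. by move=> /(inf_lt (reps0 z))[_ [s sz <-] sr]; exists s. Qed.

Let proj_ge0 z : 0 <= proj_seminorm z.
Proof. by apply: lb_le_inf; [exact: reps0|move=> _ [s _ <-]]. Qed.

Lemma tclass_cat s t : tclass (s ++ t) = tclass s + tclass t :> ptensor V W.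
Proof. by rewrite !tclassE big_cat. Qed.

Lemma tclass_scale a (s : seq (V * W)) :
  tclass [seq (a *: u.1, u.2) | u <- s] = a *: tclass s :> ptensor V W.
Proof.
rewrite !tclassE big_map scaler_sumr; apply: eq_bigr => u _ /=.
have [H _] := @tens_bilinear K V W; exact: (linear_funZ a u.1 (H u.2)).
Qed.

Lemma proj_seminormP : seminorm hK proj_seminorm.
Proof.
have qZ a x : proj_seminorm (a *: x) <= nm a * proj_seminorm x.
  apply/ler_addgt0Pr => r r0; have na := absval_ge0 hK a.
  have d0 : 0 < r / (nm a + 1) by rewrite divr_gt0//; lra.
  have [|s sx sr] := @proj_lt x (proj_seminorm x + r / (nm a + 1)); first by lra.
  rewrite -sx -tclass_scale; apply: le_trans (proj_le _) _.
  rewrite big_map /=.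
  have -> : \sum_(u <- s) p (a *: u.1) * q u.2 = nm a * \sum_(u <- s) p u.1 * q u.2.
    by rewrite mulr_sumr; apply: eq_bigr => u _; rewrite (snZ cp.1) mulrA.
  rewrite sx; apply: (@le_trans _ _ (nm a * (proj_seminorm x + r / (nm a + 1)))).
    by rewrite ler_wpM2l// ltW.
  rewrite mulrDr lerD2l.
  have -> : nm a * (r / (nm a + 1)) = r * (nm a / (nm a + 1)) by ring.
  by rewrite -[leRHS]mulr1 ler_pM2l// ler_pdivrMr; lra.
split=> [x y|a x].
  apply/ler_addgt0Pr => r r0; have d0 : 0 < r / 2 by rewrite divr_gt0.
  have [|s sx sr] := @proj_lt x (proj_seminorm x + r / 2); first by lra.
  have [|t ty tr] := @proj_lt y (proj_seminorm y + r / 2); first by lra.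
  rewrite -{1}sx -{1}ty -tclass_cat; apply: le_trans (proj_le _) _.
  by rewrite big_cat /=; lra.
apply/eqP; rewrite eq_le qZ /=; have [->|a0] := eqVneq a 0.
  by rewrite absval0 mul0r.
have := qZ a^-1 (a *: x); rewrite scalerA mulVf// scale1r absvalV.
by rewrite [_^-1 * _]mulrC ler_pdivlMr ?absval_gt0// mulrC.
Qed.

(** A functional on the tensor product is dominated by the projective seminorm exactly
when the bilinear map it comes from is dominated by p and q; Hahn-Banach at z does the
rest. *)
Lemma proj_attained (z : ptensor V W) : exists2 b, dominated_bilinear b &
  @tlift K V W K^o b z = inj (proj_seminorm z).
Proof.
have [g [lg gp gz]] := hahn_banach_point proj_seminormP z.
have [tl tr] := @tens_bilinear K V W.
have hb : @bilinear_map K V W K^o (fun x y => g (tens x y)).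
  by split=> [y a x x'|x a y y']; rewrite ?(tl y) ?(tr x) lg.
exists (fun x y => g (tens x y)).
  split=> // x y; apply: le_trans (gp _) _.
  apply: le_trans (proj_le [:: (x, y)]) _; by rewrite big_seq1.
rewrite -gz -[in RHS](treprK z) /tlift /tsum tclassE.
elim: (trepr z) => [|u s IH]; first by rewrite !big_nil linear_fun0.
by rewrite !big_cons linear_funD// IH.
Qed.

End bilinear.

Section natural_bidual.
Variables (R : realType) (K : numFieldType).
Hypothesis hK : real_or_complex R K.
Variables (U : preTopologicalLmodType K) (n : naturally_paired U).
Local Notation UL := (natural_pairing n).

Definition natural_lift (phi : ndual U) : dualL hK UL :=
  dual_lift hK (X := UL) (phi := phi) I.

Lemma natural_liftE phi x :
  ihom_fun (natural_lift phi : ihom UL (scalL hK)) x = phi x.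
Proof. by []. Qed.

Lemma natural_lift_lin : linear natural_lift.
Proof.
move=> a phi psi; apply: ihom_ext => x.
by rewrite (ihomD (a *: natural_lift phi : ihom UL (scalL hK)) (natural_lift psi)) ihomZ.
Qed.

Lemma natural_lift_cont : continuous natural_lift.
Proof.
apply: (cemb_to (@dual_incl_embedding _ _ hK UL)).
rewrite (_ : _ \o _ = id); first by move=> ? ?.
by apply/funext => g; exact: ndual_ext.
Qed.

Lemma natural_liftK (g : dualL hK UL) : natural_lift (dual_incl g) = g.
Proof. by apply: ihom_ext => x; rewrite natural_liftE. Qed.

(** The dual of U in the category of paired spaces is homeomorphic to the natural dual, so
this is reflexivity again. *)
Lemma natural_bidual : lctvs U -> tvs_complete U ->
  forall phi : ndual (dualL hK UL), exists x, forall g : dualL hK UL,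
    phi g = ihom_fun (g : ihom UL (scalL hK)) x.
Proof.
move=> lU UC phi.
have cphi := cont_comp natural_lift_cont (@ndual_cont _ _ phi).
have lphi : linear (phi \o natural_lift).
  by move=> a f g /=; rewrite natural_lift_lin ndual_linear.
have [x xE] := bidual_representable hK lU (@paired_hausdorff _ UL)
  (mkndual cphi lphi) UC.
exists x => g; rewrite -[RHS]/(dual_incl g x) -xE.
by rewrite -[RHS]/(phi (natural_lift (dual_incl g))) natural_liftK.
Qed.

End natural_bidual.

Section tensor.
Variables (R : realType) (K : numFieldType).
Hypothesis hK : real_or_complex R K.
Local Notation nm := (absval hK).
Local Notation inj := (ofreal hK).
Variables (V W : preTopologicalLmodType K).
Hypotheses (fV : frechet R V) (fW : frechet R W).
Hypotheses (nV : naturally_paired V) (nW : naturally_paired W).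

Let lV : lctvs V. Proof. by have [] := fV. Qed.
Let lW : lctvs W. Proof. by have [] := fW. Qed.
Let WC : tvs_complete W. Proof. by have [] := fW. Qed.
Let kV : kspace V. Proof. exact: (frechet_kspace fV). Qed.

Local Notation S := (scalL hK).
Local Notation VL := (natural_pairing nV).
Local Notation WL := (natural_pairing nW).
Local Notation DW := (dualL hK WL).
Local Notation HL := (ihomL VL DW).
Local Notation T := (tensorL hK VL WL).

(** A morphism from V to the dual of W, seen as a bilinear form. *)
Definition ev2 (f : ihom VL DW) (x : V) (y : W) : K^o :=
  ihom_fun (ihom_fun f x : ihom WL S) y.

Lemma ev2_bilinear f : @bilinear_map K V W K^o (ev2 f).
Proof.
split=> [y a x x'|x]; last exact: (@ihom_linear _ WL S (ihom_fun f x)).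
rewrite /ev2 (ihom_linear f).
by rewrite (ihomD (a *: ihom_fun f x : ihom WL S) (ihom_fun f x')) ihomZ.
Qed.

Lemma natural_in_dual (U : preTopologicalLmodType K) (n : naturally_paired U)
    (f : U -> K^o) : continuous f -> linear f -> @in_dual K (natural_pairing n) f.
Proof. by move=> cf lf; exists (mkndual cf lf). Qed.

Section one_bilinear.
Variables (p : V -> R) (q : W -> R) (b : V -> W -> K^o).
Hypotheses (cp : cont_seminorm hK p) (cq : cont_seminorm hK q).
Hypothesis hb : dominated_bilinear hK p q b.

Let bx_cts x : continuous (b x).
Proof.
have cpq : cont_seminorm hK (fun y => p x * q y).
  by apply: cont_seminormM => //; exact: sn_ge0 cp.1 _.
apply: (dominated_continuous lW cpq); first exact: hb.1.2.
exact: hb.2.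
Qed.

Let bx_dual x (phi : ndual S) : sm_set (pdual S) phi ->
  in_dual (fun y : WL => phi (b x y : S)).
Proof.
move=> _; apply: natural_in_dual; first exact: cont_comp (@bx_cts x) (@ndual_cont _ _ phi).
by move=> a y y'; rewrite (hb.1.2 x) ndual_linear.
Qed.

Let bx x : DW := @mkihom K WL S (b x) (@bx_cts x) (hb.1.2 x) (@bx_dual x).

Let bx_cont : continuous (bx : V -> DW).
Proof.
apply: (@ihom_to K WL S V bx kV) => C f g cC hC cf cg.
by apply: (@dominated_bilinear_cont R K hK V W lV lW p q cp cq C (fun=> b)) => // x y;
  exact: cst_cont.
Qed.

Let bx_linear : linear bx.
Proof.
move=> a x x'; apply: ihom_ext => y.
rewrite (ihomD (a *: bx x : ihom WL S) (bx x')) (ihomZ a (bx x : ihom WL S)).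
exact: (hb.1.1 y).
Qed.

Let b_dual (phi : ndual DW) : sm_set (pdual DW) phi -> in_dual (fun x : VL => phi (bx x)).
Proof.
move=> _; apply: natural_in_dual; first exact: cont_comp bx_cont (@ndual_cont _ _ phi).
by move=> a x x'; rewrite bx_linear ndual_linear.
Qed.

Definition mkbil : ihom VL DW := @mkihom K VL DW bx bx_cont bx_linear b_dual.

End one_bilinear.

Definition bil_ball (p : V -> R) (q : W -> R) : set (ihom VL DW) :=
  [set f | forall x y, nm (ev2 f x y) <= p x * q y].

Lemma bil_ball_compact p q :
  cont_seminorm hK p -> cont_seminorm hK q -> compact (bil_ball p q).
Proof.
move=> cp cq.
pose dom : set (ptw K (V * W)%type) :=
  [set g | dominated_bilinear hK p q (fun x y => g (x, y))].
have cdom : compact dom by exact: compact_dominated.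
have cQ : compact [set: dom] by exact: set_type_compact.
have hQ : hausdorff_space dom by apply: set_type_hausdorff; exact: ptw_hausdorff.
have kQ := compact_kspace cQ hQ.
pose F (g : dom) : ihom VL DW := mkbil cp cq (set_valP g).
have cF : continuous F.
  apply: (@ihom_to K VL DW dom F kQ) => C f u cC hC cf cu; have kC := compact_kspace cC hC.
  apply: (@ihom_to K WL S C _ kC) => D g w cD hD cg cw.
  apply: (@dominated_bilinear_cont R K hK V W lV lW p q cp cq D
    (fun d x y => (set_val (f (g d)) : ptw K (V * W)%type) (x, y)) (fun d => u (g d)) w) => //.
  - by move=> d; exact: (set_valP (f (g d))).
  - move=> x y.
    have := cont_comp (cont_comp cg cf) (@set_type_cont _ dom).
    by move=> /cont_comp/(_ (@ptw_ev K _ (x, y))).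
  - exact: cont_comp cg cu.
have -> : bil_ball p q = F @` setT.
  apply/seteqP; split=> [f fpq|_ [g _ <-]]; last exact: (set_valP g).2.
  have df : dom (fun xy => ev2 f xy.1 xy.2) by split=> //; exact: ev2_bilinear.
  exists (exist (fun g => g \in dom) _ (mem_set df)) => //.
  by apply: ihom_ext => x; apply: ihom_ext => y.
apply: continuous_compact => //; exact: continuous_subspaceT.
Qed.

Section fundamental_seminorms.
Variables (p : nat -> V -> R) (q : nat -> W -> R).
Hypotheses (fp : fundamental hK p) (fq : fundamental hK q).

Let cp n : cont_seminorm hK (p n). Proof. by have [] := fp. Qed.
Let cq n : cont_seminorm hK (q n). Proof. by have [] := fq. Qed.

(** The analogue for bilinear forms of polar_exhaustion, with a null sequence in each
variable. *)
Lemma bilinear_exhaustion :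
  exhaustion ((fun n => bil_ball (p n) (q n)) : nat -> set (ihom VL DW)).
Proof.
split=> [n|n f fpq x y|C f cC hC cf].
- exact: bil_ball_compact.
- apply: le_trans (fpq x y) _; have [_ pi _] := fp; have [_ qi _] := fq.
  by apply: ler_pM => //; [exact: sn_ge0 (cp n).1 _|exact: sn_ge0 (cq n).1 _].
apply: contrapT => H.
have w_ex n : exists w : C * V * W, [/\ p n w.1.2 < 1, q n w.2 < 1
    & 1 <= nm (ev2 (f w.1.1) w.1.2 w.2)].
  apply: contrapT => H'; apply: H; exists n => c x y.
  rewrite leNgt; apply/negP; set s := nm _ => pqs; apply: H'.
  have p0 := sn_ge0 (cp n).1 x; have q0 := sn_ge0 (cq n).1 y.
  set a := p n x in p0 pqs; set d := q n y in q0 pqs.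
  (* Chosen so that (a + e) (d + e) <= s; then x / (a + e) and y / (d + e) are in the open
     unit balls, and the value of f c at them has absolute value at least 1. *)
  pose e := Num.min 1 ((s - a * d) / (a + d + 1)).
  have e0 : 0 < e by rewrite lt_min ltr01 divr_gt0//; lra.
  have es : (a + e) * (d + e) <= s.
    have e1 : e <= 1 by rewrite ge_min lexx.
    have e2 : e * (a + d + 1) <= s - a * d.
      by rewrite -ler_pdivlMr; [rewrite ge_min lexx orbT|lra].
    have : e * e <= e by rewrite -[leRHS]mulr1 ler_pM2l.
    lra.
  have ae : 0 < a + e by lra.
  have de : 0 < d + e by lra.
  exists (c, inj (a + e)^-1 *: x, inj (d + e)^-1 *: y); split=> /=.
  - rewrite (snZr (cp n).1) ?invr_ge0 ?(ltW ae)// mulrC ltr_pdivrMr// -/a; lra.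
  - rewrite (snZr (cq n).1) ?invr_ge0 ?(ltW de)// mulrC ltr_pdivrMr// -/d; lra.
  - have [bl br] := ev2_bilinear (f c).
    rewrite (linear_funZ _ _ (br _)).
    have -> : ev2 (f c) (inj (a + e)^-1 *: x) y = inj (a + e)^-1 *: ev2 (f c) x y.
      exact: (linear_funZ _ _ (bl y)).
    rewrite /GRing.scale /= !absvalM !absval_ofreal_ge0 ?invr_ge0 ?(ltW ae) ?(ltW de)// -/s.
    rewrite mulrA -invfM mulrC ler_pdivlMr ?mulr_gt0// mul1r mulrC; exact: es.
have [w Hw] := choice w_ex.
have x0 : seq_to (fun n => (w n).1.2) 0.
  by apply: (fundamental_null fp) => n; have [] := Hw n.
have y0 : seq_to (fun n => (w n).2) 0.
  by apply: (fundamental_null fq) => n; have [] := Hw n.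
have kCN : kspace (C * one_point_compactification nat)%type.
  apply: compact_kspace; first by apply: compact_prodT => //; exact: Noo_compact.
  by apply: hausdorff_prod => //; exact: Noo_hausdorff.
pose X := fun z : C * one_point_compactification nat => seq_map (fun n => (w n).1.2) 0 z.2.
pose Y := fun z : C * one_point_compactification nat => seq_map (fun n => (w n).2) 0 z.2.
have csnd : continuous (snd : C * one_point_compactification nat -> _).
  by move=> z; exact: cvg_snd.
have cX : continuous X by exact: cont_comp csnd (seq_map_cont x0).
have cY : continuous Y by exact: cont_comp csnd (seq_map_cont y0).
have cf1 : continuous (fun z : C * one_point_compactification nat => f z.1).
  by apply: (@cont_comp _ _ _ fst f) => // z; exact: cvg_fst.
have [||N HN] := @uniform_null R K hK C (fun z => ev2 (f z.1) (X z) (Y z)) cC.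
- have c1 := @ihom_eval K VL DW _ _ X kCN cf1 cX.
  exact: (@ihom_eval K WL S _ _ Y kCN c1 cY).
- by move=> c; have [_ br] := ev2_bilinear (f c); exact: (linear_fun0 (br _)).
by have [_ _] := Hw N; have := HN (w N).1.1; rewrite /X /Y /= ltNge => /negP.
Qed.

End fundamental_seminorms.

Let HL_kspace : kspace (ihom VL DW). Proof. exact: ihom_kspace. Qed.
Let HL_hausdorff : hausdorff_space (ihom VL DW). Proof. exact: ihom_hausdorff. Qed.

Lemma bilinear_dual_frechet : frechet R (ndual (ihom VL DW : preTopologicalLmodType K)).
Proof.
have [p fp] := frechet_fundamental hK fV; have [q fq] := frechet_fundamental hK fW.
exact: (exhausted_frechet hK HL_kspace HL_hausdorff (bilinear_exhaustion fp fq)).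
Qed.

Lemma tensor_frechet : frechet R T.
Proof.
exact: (embedding_frechet (@dual_incl_lin R K hK HL) (dual_incl_embedding hK HL)
  bilinear_dual_frechet).
Qed.

Definition tensor_point (x : V) (y : W) : T :=
  dual_lift hK (X := HL)
    (@hev_dual K VL DW x _ (@hev_dual K WL S y (scalar_id hK) I)).

Definition tensor_apply (t : T) (f : ihom VL DW) : K^o := ihom_fun (t : ihom HL S) f.

Lemma tensor_pointE x y f : tensor_apply (tensor_point x y) f = ev2 f x y.
Proof. by []. Qed.

Lemma tensor_applyD s t f : tensor_apply (s + t) f = tensor_apply s f + tensor_apply t f.
Proof. exact: (ihomD (s : ihom HL S) t f). Qed.

Lemma tensor_applyZ a t f : tensor_apply (a *: t) f = a *: tensor_apply t f.
Proof. exact: (ihomZ a (t : ihom HL S) f). Qed.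

Lemma tensor_point_bilinear : @bilinear_map K V W T tensor_point.
Proof.
split=> [y a x x'|x a y y']; apply: ihom_ext => f;
  rewrite -[LHS]/(tensor_apply _ f) -[RHS]/(tensor_apply _ f);
  rewrite tensor_applyD tensor_applyZ !tensor_pointE;
  have [bl br] := ev2_bilinear f; [exact: bl|exact: br].
Qed.

Definition tensor_map : ptensor V W -> T := @tlift K V W T tensor_point.

Lemma tensor_map_lin : linear tensor_map.
Proof. exact: (tlift_lin tensor_point_bilinear). Qed.

Lemma tensor_map_tens x y : tensor_map (tens x y) = tensor_point x y.
Proof. by rewrite /tensor_map tliftE ?/tsum ?big_seq1//; exact: tensor_point_bilinear. Qed.

Lemma tensor_mapE z f : tensor_apply (tensor_map z) f = @tlift K V W K^o (ev2 f) z.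
Proof.
rewrite /tensor_map /tlift /tsum; elim: (trepr z) => [|u s IH].
  rewrite !big_nil.
  by have := tensor_applyZ 0 0 f; rewrite !scale0r.
by rewrite !big_cons tensor_applyD IH.
Qed.

Lemma cseminorm_cont_seminorm (E : preTopologicalLmodType K) (p : E -> R) :
  lctvs E -> cont_seminorm hK p -> cseminorm (fun x => inj (p x) : K^o).
Proof.
move=> lE cp; split.
- by move=> x; rewrite -(rmorph0 inj) ofreal_le; exact: sn_ge0 cp.1 _.
- by move=> x y; rewrite -rmorphD ofreal_le; exact: snD cp.1 _ _.
- by move=> a x; rewrite (snZ cp.1) rmorphM (normE hK).
- apply/(continuous_Ko hK) => x r r0; apply: filterS (cont_seminorm_lt x lE cp r0) => y /=.
  rewrite -rmorphB absval_ofreal ltr_norml => yx.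
  have := snD cp.1 (y - x) x; have := snD cp.1 (x - y) y; rewrite !subrK.
  by rewrite (snB cp.1 x y); lra.
Qed.

Lemma cont_seminorm_cseminorm (E : preTopologicalLmodType K) (p : E -> K^o) :
  cseminorm p -> cont_seminorm hK (fun x => nm (p x)) /\ forall x, p x = inj (nm (p x)).
Proof.
move=> [p0 pD pZ cp].
have pE x : p x = inj (nm (p x)) by exact: ge0_ofreal.
split=> //; split.
  split=> [x y|a x]; last by rewrite pZ (normE hK) absvalM absval_ofreal_ge0 ?absval_ge0.
  by rewrite -(ofreal_le hK) rmorphD -!pE.
have /(continuous_Ko hK)/(_ 0 _ ltr01) := cp.
apply: filterS => x; suff -> : p 0 = 0 by rewrite subr0.
by have := pZ 0 0; rewrite scale0r normr0 mul0r.
Qed.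

(** The tensor product is the closed span of the functionals f |-> phi (f x) with phi in the
dual of the dual of W; by reflexivity phi is the evaluation at a point y of W, and the
functional is the image of the tensor of x and y. *)
Let dense_points (t : T) (A : set T) : nbhs t A -> exists z, A (tensor_map z).
Proof.
move=> nA; pose io := dual_incl (hK := hK) (X := HL).
have io_lin : linear io by exact: dual_incl_lin.
have io_emb : closed_embedding io by exact: dual_incl_embedding.
have [O nO OA] := embedding_nbhs io_emb nA.
pose A0 : set (ndual HL) := range (io \o tensor_map).
have A00 : A0 0 by exists 0 => //=; rewrite (linear_fun0 tensor_map_lin) linear_fun0.
have A0l a x y : A0 x -> A0 y -> A0 (a *: x + y).
  by move=> [z _ <-] [w _ <-]; exists (a *: z + w) => //=; rewrite tensor_map_lin io_lin.
have lD : lctvs (ndual HL) by have [] := bilinear_dual_frechet.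
have [Cl ClE] := closure_submod (Submod A00 A0l) lD.
have ClC : closed (sm_set Cl) by rewrite ClE; exact: closed_closure.
have hevC : [set psi : ndual (ihom VL DW) | exists x : VL,
    exists2 phi : ndual DW, sm_set (pdual DW) phi &
      forall f : ihom VL DW, psi f = phi (ihom_fun f x)] `<=` sm_set Cl.
  move=> psi [x [phi _ psiE]].
  have [y yE] := natural_bidual (hK := hK) (n := nW) lW WC phi.
  suff -> : psi = io (tensor_map (tens x y)).
    by rewrite ClE; apply: subset_closure; exists (tens x y).
  apply: ndual_ext => f; rewrite psiE yE -[RHS]/(tensor_apply _ f) tensor_map_tens.
  by rewrite tensor_pointE.
have : sm_set Cl (io t) by exact: (@dual_incl_pdual _ _ hK HL t Cl ClC hevC).
by rewrite ClE => /(_ O nO)[_ [[z _ <-] Oz]]; exists z; exact: OA.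
Qed.

(** A basic neighborhood in the tensor product is given by the uniform norm on the
bilinear forms dominated by p n and q n, which is at most their projective seminorm. *)
Let open_popen (O : set T) : open O -> open (tensor_map @^-1` O).
Proof.
move=> oO; have [p fp] := frechet_fundamental hK fV; have [q fq] := frechet_fundamental hK fW.
have cp n : cont_seminorm hK (p n) by have [] := fp.
have cq n : cont_seminorm hK (q n) by have [] := fq.
move=> z Oz; have nO : nbhs (tensor_map z) O by apply: open_nbhs_nbhs.
have [O' nO' OO'] := embedding_nbhs (dual_incl_embedding hK HL) nO.
have [n nA] := exhausted_nbhs hK HL_hausdorff (bilinear_exhaustion fp fq) nO'.
exists (fun x => inj (p n x)), (fun y => inj (q n y)), (inj n.+1%:R^-1).
split; [exact: cseminorm_cont_seminorm|exact: cseminorm_cont_seminorm| |].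
  by rewrite -(rmorph0 inj) ofreal_lt invr_gt0.
move=> s hs; apply: OO'; apply: nA => f fpq.
rewrite -[ndual_fun _ f]/(tensor_apply (tensor_map (z + tclass s)) f).
rewrite -[X in _ - X]/(tensor_apply (tensor_map z) f).
rewrite (linear_funD _ _ tensor_map_lin) tensor_applyD addrC addKr tensor_mapE.
rewrite tliftE; last exact: ev2_bilinear.
rewrite -(ofreal_lt hK); apply: le_lt_trans hs.
rewrite -(normE hK) /tsum; apply: le_trans (ler_norm_sum _ _ _) _.
apply: ler_sum => u _; rewrite (normE hK) -rmorphM ofreal_le; exact: fpq.
Qed.

(** Conversely the projective seminorm of p and q is at most the uniform norm on the
bilinear forms dominated by p and q, by proj_attained; these forms are a compact set. *)
Let popen_open (U : set (ptensor V W)) : open U -> exists2 O, open O & U = tensor_map @^-1` O.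
Proof.
move=> oU.
exists (\bigcup_(A in [set A | open A /\ tensor_map @^-1` A `<=` U]) A).
  by apply: bigcup_open => A [].
apply/seteqP; split=> [z Uz|z [A [_ AU] Az]]; last exact: AU.
have [p0 [q0 [e [hp hq e0 HU]]]] := oU z Uz.
have [cp pE] := cont_seminorm_cseminorm hp; have [cq qE] := cont_seminorm_cseminorm hq.
set p := fun x => nm (p0 x) in cp pE; set q := fun x => nm (q0 x) in cq qE.
have eE : e = inj (nm e) by apply: ge0_ofreal; exact: ltW.
have ne0 : 0 < nm e by rewrite -(ofreal_lt hK) rmorph0 -eE.
have nb := ndual_nbhs_compact hK (dual_incl (tensor_map z)) HL_hausdorff
  (bil_ball_compact cp cq) ne0.
have := cemb_cont (dual_incl_embedding hK HL) nb.
rewrite /= nbhsE => -[A [oA Az] AN].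
exists A => //; split=> // z' Az'; have := AN _ Az' => /= Hz'.
have : proj_seminorm p q (z' - z) < nm e.
  have [b hb bz] := proj_attained cp cq (z' - z).
  have := Hz' (mkbil cp cq hb) hb.2.
  rewrite -[ndual_fun _ _]/(tensor_apply (tensor_map z') (mkbil cp cq hb)).
  rewrite -[X in _ - X]/(tensor_apply (tensor_map z) (mkbil cp cq hb)).
  rewrite !tensor_mapE -(linear_funB _ _ (tlift_lin (ev2_bilinear _))).
  rewrite -[tlift _ _]/(@tlift K V W K^o b (z' - z)) bz absval_ofreal_ge0//.
  exact: sn_ge0 (proj_seminormP cp cq) _.
move=> /proj_lt[s sz sr].
have := HU s; rewrite sz addrC subrK; apply.
rewrite eE (eq_bigr (fun u => inj (p u.1 * q u.2))); last first.
  by move=> u _; rewrite pE qE rmorphM.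
by rewrite -rmorph_sum ofreal_lt.
Qed.

Theorem tensor_completion : completion tensor_map.
Proof.
have [lT _ TC] := tensor_frechet.
split.
- by split=> //; split=> //; exact: paired_hausdorff.
- exact: tensor_map_lin.
- by move=> U; split=> [/popen_open//|[O oO ->]]; exact: open_popen.
- apply/seteqP; split=> // t _ A nA; have [z Az] := dense_points nA.
  by exists (tensor_map z).
Qed.

Lemma tensor_pdual_full (phi : ndual T) : sm_set (pdual T) phi.
Proof.
have fT := tensor_frechet; have [lT _ TC] := fT.
apply: (pdual_full hK lT TC); have [p fp] := frechet_fundamental hK fT.
by have [_ _] := frechet_dual_brauner fT fp.
Qed.

End tensor.

(** * The embeddings and the dualities *)

Section embedding_functor.
Variables (K : numFieldType) (P : preTopologicalLmodType K -> Prop).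
Hypothesis pP : forall V, P V -> naturally_paired V.

Lemma embed_fully_faithful : fully_faithful (embed pP).
Proof.
move=> A B.
exists (fun f : ihom (embed_obj pP A) (embed_obj pP B) => ihom_clin f).
  by move=> f; apply: clin_ext.
by move=> f; apply: ihom_ext.
Qed.

Lemma embed_injective : injective (fobj (embed pP)).
Proof.
move=> [V PV] [W PW] /(congr1 (@psp K)) /= VW.
by move: PW; rewrite -VW => PW; congr exist; exact: Prop_irrelevance.
Qed.

End embedding_functor.

Section duality.
Variables (R : realType) (K : numFieldType).
Hypothesis hK : real_or_complex R K.
Variables P Q : preTopologicalLmodType K -> Prop.
Hypotheses (pP : forall V, P V -> naturally_paired V)
  (pQ : forall V, Q V -> naturally_paired V)
  (dPQ : forall V, P V -> Q (ndual V)) (dQP : forall V, Q V -> P (ndual V)).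
Hypotheses (lP : forall V, P V -> lctvs V) (cP : forall V, P V -> tvs_complete V).

Section component.
Variables (V : preTopologicalLmodType K) (PV : P V).
Local Notation UL := (natural_pairing (pP PV)).
Local Notation DL := (natural_pairing (pQ (dPQ PV))).

Let incl_dual (phi : ndual DL) : sm_set (pdual DL) phi ->
  in_dual (fun t : dualL hK UL => phi (dual_incl t : DL)).
Proof.
move=> _.
have c := cont_comp (cemb_cont (dual_incl_embedding hK UL)) (@ndual_cont _ _ phi).
have l : linear ((phi : ndual V -> K^o) \o dual_incl (hK := hK) (X := UL)).
  by move=> a s t /=; rewrite dual_incl_lin ndual_linear.
have [x xE] := natural_bidual (hK := hK) (n := pP PV) (lP PV) (cP PV) (mkndual c l).
exists (@hev K UL (scalL hK) x (scalar_id hK)); first exact: hev_dual.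
by move=> t; rewrite -[RHS]/(mkndual c l t) xE.
Qed.

Definition incl_hom : ihom (dualL hK UL) DL :=
  @mkihom K (dualL hK UL) DL (dual_incl (hK := hK) (X := UL))
    (cemb_cont (dual_incl_embedding hK UL)) (@dual_incl_lin _ _ hK UL) incl_dual.

Let lift_dual (phi : ndual (dualL hK UL)) : sm_set (pdual (dualL hK UL)) phi ->
  in_dual (fun g : DL => phi (natural_lift hK (pP PV) g)).
Proof.
move=> _; apply: natural_in_dual.
  exact: cont_comp (@natural_lift_cont _ _ hK _ (pP PV)) (@ndual_cont _ _ phi).
by move=> a f g; rewrite natural_lift_lin ndual_linear.
Qed.

Definition lift_hom : ihom DL (dualL hK UL) :=
  @mkihom K DL (dualL hK UL) (natural_lift hK (pP PV))
    (@natural_lift_cont _ _ hK _ (pP PV)) (@natural_lift_lin _ _ hK _ (pP PV)) lift_dual.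

End component.

Let iP := embed pP.
Let iQ := embed pQ.
Let DP : functor (opcat (tvs_cat P)) (tvs_cat Q) := natural_dual_functor dPQ.

(** The components identify the morphisms to the scalars with the natural dual; they are
morphisms of paired spaces by reflexivity. *)
Lemma embed_dual : exists eta : nat_iso (functor_comp (dual_functor hK) (functor_op iP))
    (functor_comp iQ DP),
  forall (V : obj (tvs_cat P)) (phi : dualL hK (iP V)) (x : sval V),
    ndual_fun (ihom_fun (eta V) phi) x = ihom_fun phi x.
Proof.
pose F := functor_comp (dual_functor hK) (functor_op iP).
pose G := functor_comp iQ DP.
pose eta (A : obj (opcat (tvs_cat P))) : arr (F A) (G A) := incl_hom (svalP A).
have nat (A B : obj (opcat (tvs_cat P))) (f : arr A B) :
    comparr (eta B) (farr F f) = comparr (farr G f) (eta A).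
  by apply: ihom_ext => t; apply: ndual_ext.
have iso A : is_iso (eta A).
  exists (lift_hom (svalP A) : arr (G A) (F A)); split; apply: ihom_ext => t.
    exact: natural_liftK.
  exact: ndual_ext.
by exists (NatIso nat iso).
Qed.

Let DQ : functor (opcat (tvs_cat Q)) (tvs_cat P) := natural_dual_functor dQP.
Hypothesis hkP : forall V, P V -> linear_hk V.

Let ev (V : preTopologicalLmodType K) (PV : P V) : clin V (ndual (ndual V)) :=
  Clin (bidual_eval_cont (hkP PV)) (@bidual_eval_lin K V).

Let ev_inv (V : preTopologicalLmodType K) (PV : P V) : clin (ndual (ndual V)) V :=
  Clin (@bidual_inv_cont _ _ hK V (hkP PV) (lP PV) (cP PV))
    (@bidual_inv_lin _ _ hK V (hkP PV) (lP PV) (cP PV)).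

Lemma bidual_unit : exists eta : nat_iso (functor_id (tvs_cat P))
    (functor_comp DQ (functor_transpose DP)),
  forall (V : obj (tvs_cat P)) (x : sval V) (phi : ndual (sval V)),
    ndual_fun (clin_fun (eta V) x) phi = phi x.
Proof.
pose F := functor_id (tvs_cat P).
pose G := functor_comp DQ (functor_transpose DP).
pose eta (A : obj (tvs_cat P)) : arr (F A) (G A) := ev (svalP A).
have nat (A B : obj (tvs_cat P)) (f : arr A B) :
    comparr (eta B) (farr F f) = comparr (farr G f) (eta A).
  by apply: clin_ext => x; apply: ndual_ext.
have iso A : is_iso (eta A).
  exists (ev_inv (svalP A) : arr (G A) (F A)); split; apply: clin_ext => x.
    exact: bidual_evalK.
  exact: bidual_invK.
by exists (NatIso nat iso).
Qed.

Lemma bidual_counit : exists eps : nat_iso (functor_comp (functor_transpose DQ) DP)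
    (functor_id (opcat (tvs_cat P))),
  forall (V : obj (tvs_cat P)) (x : sval V) (phi : ndual (sval V)),
    ndual_fun (clin_fun (eps V : clin _ _) x) phi = phi x.
Proof.
pose F := functor_comp (functor_transpose DQ) DP.
pose G := functor_id (opcat (tvs_cat P)).
pose eps (A : obj (opcat (tvs_cat P))) : arr (F A) (G A) := ev (svalP A).
have nat (A B : obj (opcat (tvs_cat P))) (f : arr A B) :
    comparr (eps B) (farr F f) = comparr (farr G f) (eps A).
  by apply: clin_ext => x; apply: ndual_ext.
have iso A : is_iso (eps A).
  exists (ev_inv (svalP A) : arr (G A) (F A)); split; apply: clin_ext => x.
    exact: bidual_invK.
  exact: bidual_evalK.
by exists (NatIso nat iso).
Qed.

End duality.

Section tensor_iso.
Variables (R : realType) (K : numFieldType).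
Hypothesis hK : real_or_complex R K.
Variables (V W : preTopologicalLmodType K).
Hypotheses (fV : frechet R V) (fW : frechet R W).
Hypotheses (nV : naturally_paired V) (nW : naturally_paired W).
Local Notation T := (tensorL hK (natural_pairing nV) (natural_pairing nW)).

(** The isomorphism of completions is continuous and linear both ways. It preserves the
pairings as both paired duals are the whole natural duals. *)
Lemma completion_tensor_iso (P : preTopologicalLmodType K) (j : ptensor V W -> P) :
  completion j -> frechet R P /\ forall nP : naturally_paired P,
    exists Phi : @arr (Lcat K) (natural_pairing nP) T,
    is_iso Phi /\ forall x y (f : ihom (natural_pairing nV) (dualL hK (natural_pairing nW))),
      ihom_fun (ihom_fun Phi (j (tens x y)) : ihom _ _) f
        = ihom_fun (ihom_fun f x : ihom _ _) y.
Proof.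
move=> hj.
have [f [g [fK gK fj]]] := completion_unique hK hj (tensor_completion hK fV fW nV nW).
split.
  apply: (embedding_frechet (@clin_lin _ _ _ f)
    (homeo_closed_embedding (@clin_cont _ _ _ f) (@clin_cont _ _ _ g) fK gK)).
  exact: tensor_frechet.
move=> nP.
have df (phi : ndual T) : sm_set (pdual T) phi ->
    in_dual (fun x : natural_pairing nP => phi (f x)).
  move=> _; apply: natural_in_dual.
    exact: cont_comp (@clin_cont _ _ _ f) (@ndual_cont _ _ phi).
  by move=> a x y; rewrite clin_lin ndual_linear.
have dg (phi : ndual (natural_pairing nP)) :
    sm_set (pdual (natural_pairing nP)) phi -> in_dual (fun t : T => phi (g t)).
  move=> _; exists (trfun g phi) => //; exact: tensor_pdual_full.
exists (@mkihom K (natural_pairing nP) T f (@clin_cont _ _ _ f) (@clin_lin _ _ _ f) df).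
split.
  exists (@mkihom K T (natural_pairing nP) g (@clin_cont _ _ _ g) (@clin_lin _ _ _ g) dg).
  by split; apply: ihom_ext => x; [exact: fK|exact: gK].
move=> x y h.
rewrite -[LHS]/(tensor_apply (f (j (tens x y))) h) fj tensor_map_tens.
exact: tensor_pointE.
Qed.

End tensor_iso.

(** * The theorem *)

Theorem theorem2p0p2 (R : realType) (K : numFieldType)
    (hK : real_or_complex R K) :
  exists (pF : forall V : preTopologicalLmodType K,
            frechet R V -> naturally_paired V)
         (pB : forall V : preTopologicalLmodType K,
            brauner V -> naturally_paired V)
         (dFB : forall V : preTopologicalLmodType K,
            frechet R V -> brauner (ndual V))
         (dBF : forall V : preTopologicalLmodType K,
            brauner V -> frechet R (ndual V)),
  let iF : functor (Fre R K) (Lcat K) := embed pF in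
  let iB : functor (Bra K) (Lcat K) := embed pB in
  let DF : functor (opcat (Fre R K)) (Bra K) := natural_dual_functor dFB in
  let DB : functor (opcat (Bra K)) (Fre R K) := natural_dual_functor dBF in
  [/\ fully_faithful iF /\ injective (fobj iF),
      fully_faithful iB /\ injective (fobj iB),
      (exists eta : nat_iso (functor_comp (dual_functor hK) (functor_op iF))
                            (functor_comp iB DF),
         forall (V : obj (Fre R K)) (phi : dualL hK (iF V)) (x : sval V),
           ndual_fun (ihom_fun (eta V) phi) x = ihom_fun phi x) /\
      (exists eta : nat_iso (functor_comp (dual_functor hK) (functor_op iB))
                            (functor_comp iF DB),
         forall (V : obj (Bra K)) (phi : dualL hK (iB V)) (x : sval V),
           ndual_fun (ihom_fun (eta V) phi) x = ihom_fun phi x),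
      (exists eta : nat_iso (functor_id (Bra K))
                            (functor_comp DF (functor_transpose DB)),
         forall (V : obj (Bra K)) (x : sval V) (phi : ndual (sval V)),
           ndual_fun (clin_fun (eta V) x) phi = phi x) /\
      (exists eps : nat_iso (functor_comp (functor_transpose DB) DF)
                            (functor_id (opcat (Fre R K))),
         forall (V : obj (Fre R K)) (x : sval V) (phi : ndual (sval V)),
           ndual_fun (clin_fun (eps V : clin _ _) x) phi = phi x)
    & forall V W : obj (Fre R K),
        (exists (P : preTopologicalLmodType K)
                (j : ptensor (sval V) (sval W) -> P), completion j) /\
        forall (P : preTopologicalLmodType K)
               (j : ptensor (sval V) (sval W) -> P), completion j ->
          exists (hP : frechet R P)
                 (Phi : @arr (Lcat K) (iF (exist _ P hP)) (tensorL hK (iF V) (iF W))),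
            is_iso Phi /\
            forall (x : sval V) (y : sval W)
                   (f : ihom (iF V) (dualL hK (iF W))),
              ihom_fun (ihom_fun Phi (j (tens x y)) : ihom _ _) f
                = ihom_fun (ihom_fun f x : ihom _ _) y].

Proof.
have hkF (V : preTopologicalLmodType K) : frechet R V -> linear_hk V.
  exact: frechet_linear_hk.
have lF (V : preTopologicalLmodType K) : frechet R V -> lctvs V by case.
have cF (V : preTopologicalLmodType K) : frechet R V -> tvs_complete V by case.
have hkB (V : preTopologicalLmodType K) : brauner V -> linear_hk V by case.
have lB (V : preTopologicalLmodType K) : brauner V -> lctvs V by case.
have cB (V : preTopologicalLmodType K) : brauner V -> tvs_complete V by case.
have pF (V : preTopologicalLmodType K) : frechet R V -> naturally_paired V.
  by move=> fV; apply: (complete_naturally_paired hK); [exact: hkF|exact: lF|exact: cF].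
have pB (V : preTopologicalLmodType K) : brauner V -> naturally_paired V.
  by move=> bV; apply: (complete_naturally_paired hK); [exact: hkB|exact: lB|exact: cB].
have dFB (V : preTopologicalLmodType K) : frechet R V -> brauner (ndual V).
  by move=> fV; have [p] := frechet_fundamental hK fV; exact: frechet_dual_brauner.
have dBF (V : preTopologicalLmodType K) : brauner V -> frechet R (ndual V).
  move=> bV; have [[[kV _] _ _] hV _ _] := bV.
  have HV : hausdorff_space V.
    by apply: (linear_hk_hausdorff hK); [exact: hkB|exact: lB].
  by have [B] := hemicompact_exhaustion HV hV; exact: exhausted_frechet hK _ _ kV HV.
exists pF, pB, dFB, dBF => iF iB DF DB; split.
- by split; [exact: embed_fully_faithful|exact: embed_injective].
- by split; [exact: embed_fully_faithful|exact: embed_injective].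
- by split; exact: embed_dual.
- split.
    exact: (bidual_unit hK dBF dFB lB cB hkB).
  exact: (bidual_counit hK dFB dBF lF cF hkF).
move=> V W; split.
  exists (tensorL hK (natural_pairing (pF _ (svalP V))) (natural_pairing (pF _ (svalP W)))).
  exists (tensor_map hK (pF _ (svalP V)) (pF _ (svalP W))).
  by apply: tensor_completion; exact: svalP.
move=> P j hj.
have [hP H] := completion_tensor_iso hK (svalP V) (svalP W)
  (pF _ (svalP V)) (pF _ (svalP W)) hj.
have [Phi HPhi] := H (pF P (svalP (exist _ P hP))).
by exists hP, Phi.
Qed.
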